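(* Let $F(\mathbf X,\bar{\mathbf X})$ and $G(\mathbf X,\bar{\mathbf X})$, $\mathbf X=(X_0,X_1,X_2)$, be strongly polar homogeneous mixed polynomials of polar degrees $d$ and $d'$ respectively, defining mixed projective curves $C=\{F=0\}$ and $C'=\{G=0\}$ in $\mathbb P^2$ whose mixed singularities are at worst isolated. Assume $C\cap C'\cap\{X_0=0\}=\emptyset$ and $C\cap C'=\{P_1,\dots,P_\mu\}$ is finite. Then \[ \sum_{j=1}^\mu I_{top}(C,C';P_j)=dd'. \]
   Context: A mixed polynomial $F(\mathbf X,\bar{\mathbf X})=\sum c_{\nu\mu}\mathbf X^\nu\bar{\mathbf X}^\mu$ is strongly polar homogeneous of radial degree $d_r$ and polar degree $q$ if every monomial with $c_{\nu\mu}\ne0$ satisfies $|\nu|+|\mu|=d_r$ and $|\nu|-|\mu|=q$; then its zero set is a well-defined subset of $\mathbb P^2$ (a mixed projective curve). Since $C\cap C'\subset\{X_0\ne0\}$, the local intersection numbers are computed in the affine chart $z_1=X_1/X_0$, $z_2=X_2/X_0$ using $f(\mathbf z,\bar{\mathbf z})=F(1,z_1,z_2,1,\bar z_1,\bar z_2)$ and $g(\mathbf z,\bar{\mathbf z})=G(1,z_1,z_2,1,\bar z_1,\bar z_2)$: identifying $\mathbb C^2$ with $\mathbb R^4$ via $z_j=x_j+iy_j$ (standard orientation), writing $f=f_{\mathbb R}+if_I$, $g=g_{\mathbb R}+ig_I$, $I_{top}(C,C';P)$ is the mapping degree of $\varphi/\|\varphi\|:S^3_\varepsilon(P)\to S^3$,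 $\varphi=(f_{\mathbb R},f_I,g_{\mathbb R},g_I)$, where $S^3_\varepsilon(P)$ is the boundary of a small ball around $P$ containing no other intersection point. A point is a mixed singularity of $\{f=0\}$ if the Jacobian of $(f_{\mathbb R},f_I)$ has rank $<2$ there. *)

(* Defs.v *)
From HB Require Import structures.
From mathcomp Require Import all_boot all_order all_algebra.
From mathcomp Require Import all_classical all_reals.
From mathcomp Require Import topology normedtype derive.
From mathcomp Require Import complex.

Set Implicit Arguments.
Unset Strict Implicit.
Unset Printing Implicit Defensive.

Import Order.TTheory GRing.Theory Num.Theory.
Import numFieldNormedType.Exports.
Local Open Scope ring_scope.

Section MixedCurves.
Variable R : realType.

Local Notation C := (R[i]).

(** A mixed monomial X^nu Xbar^mu : ((nu0,nu1,nu2),(mu0,mu1,mu2)). *)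
Definition mmono := ((nat * nat * nat) * (nat * nat * nat))%type.

Record mixed_poly := MixedPoly {
  mp_coef : mmono -> C ;
  mp_supp : seq mmono ;
  mp_suppP : forall m, mp_coef m != 0 -> m \in mp_supp }.

Definition nu_deg (m : mmono) : nat := m.1.1.1 + m.1.1.2 + m.1.2.
Definition mu_deg (m : mmono) : nat := m.2.1.1 + m.2.1.2 + m.2.2.

Definition mp_eval (F : mixed_poly) (x0 x1 x2 : C) : C :=
  \sum_(m <- undup (mp_supp F))
     mp_coef F m
     * x0 ^+ m.1.1.1 * x1 ^+ m.1.1.2 * x2 ^+ m.1.2
     * (conjc x0) ^+ m.2.1.1 * (conjc x1) ^+ m.2.1.2 * (conjc x2) ^+ m.2.2.

Definition strongly_polar_homogeneous (F : mixed_poly) (dr : nat) (q : int) :=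
  forall m, mp_coef F m != 0 ->
    (nu_deg m + mu_deg m)%N = dr /\ (nu_deg m)%:Z - (mu_deg m)%:Z = q.

Definition z1_of (v : 'rV[R]_4) : C := Complex (v ord0 0) (v ord0 1).
Definition z2_of (v : 'rV[R]_4) : C := Complex (v ord0 2) (v ord0 3).

Definition chart_eval (F : mixed_poly) (k : 'I_3) (v : 'rV[R]_4) : C :=
  if k == 0 :> nat then mp_eval F 1 (z1_of v) (z2_of v)
  else if k == 1 :> nat then mp_eval F (z1_of v) 1 (z2_of v)
  else mp_eval F (z1_of v) (z2_of v) 1.

Definition real_jacobian (f : 'rV[R]_4 -> C) (v : 'rV[R]_4) : 'M[R]_(2, 4) :=
  \matrix_(i < 2, j < 4)
    (if i == 0 :> nat then 'D_(delta_mx ord0 j) (fun w => complex.Re (f w)) v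
     else 'D_(delta_mx ord0 j) (fun w => complex.Im (f w)) v).

Definition mixed_singular (f : 'rV[R]_4 -> C) (v : 'rV[R]_4) :=
  f v = 0 /\ (\rank (real_jacobian f v) < 2)%N.

Definition enorm (v : 'rV[R]_4) : R := Num.sqrt (\sum_(j < 4) v ord0 j ^+ 2).

(** The mixed singularities of C = {F = 0} are at worst isolated: in every
    affine chart (these cover P^2) each mixed singular point is isolated. *)
Definition isolated_mixed_singularities (F : mixed_poly) :=
  forall (k : 'I_3) (v : 'rV[R]_4), mixed_singular (chart_eval F k) v ->
    exists2 r : R, 0 < r & forall w, w != v -> enorm (w - v) < r ->
      ~ mixed_singular (chart_eval F k) w.

Definition phi_map (F G : mixed_poly) (v : 'rV[R]_4) : 'rV[R]_4 :=
  \row_(j < 4)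
    (if j == 0 :> nat then complex.Re (chart_eval F 0 v)
     else if j == 1 :> nat then complex.Im (chart_eval F 0 v)
     else if j == 2 :> nat then complex.Re (chart_eval G 0 v)
     else complex.Im (chart_eval G 0 v)).

Definition jac4 (h : 'rV[R]_4 -> 'rV[R]_4) (x : 'rV[R]_4) : 'M[R]_4 :=
  \matrix_(i < 4, j < 4) ('D_(delta_mx ord0 j) h x) ord0 i.

(** Orientation sign of d(psi|S) : T_x S -> T_y S^3 where S = S_eps(p),
    both spheres oriented as boundaries (outward normal first).  With
    n the outward unit normal at x and M = D psi(x), the matrix
    M + (y - M n) n^T maps a positive orthonormal frame (n, v1, v2, v3) of
    R^4 to (y, M v1, M v2, M v3); its determinant's sign is the sign of
    d(psi|S)_x. *)
Definition sphere_det (psi : 'rV[R]_4 -> 'rV[R]_4) (p : 'rV[R]_4) (eps : R)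
    (x : 'rV[R]_4) : R :=
  let n := eps^-1 *: (x - p) in
  let M := jac4 psi x in
  let y := psi x in
  \det (M + (y^T - M *m n^T) *m n).

Definition on_sphere (p : 'rV[R]_4) (eps : R) (x : 'rV[R]_4) :=
  enorm (x - p) = eps.

(** Mapping degree (Milnor's definition via regular values) of
    psi : S_eps(p) -> S^3: for every regular value y, the signed count of
    preimages equals n. *)
Definition sphere_map_degree (psi : 'rV[R]_4 -> 'rV[R]_4) (p : 'rV[R]_4)
    (eps : R) (n : int) :=
  forall y : 'rV[R]_4, enorm y = 1 ->
    (forall x, on_sphere p eps x -> psi x = y -> sphere_det psi p eps x != 0) ->
    exists s : seq 'rV[R]_4,
      [/\ uniq s,
          (forall x, (on_sphere p eps x /\ psi x = y) <-> x \in s) &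
          \sum_(x <- s) (if 0 < sphere_det psi p eps x then 1 else -1 : int)
            = n].

(** I_top(C, C'; P) = n, P given by real coordinates p in the chart X0 = 1. *)
Definition Itop (F G : mixed_poly) (p : 'rV[R]_4) (n : int) :=
  exists2 eps : R, 0 < eps &
    (forall v, enorm (v - p) <= eps -> phi_map F G v = 0 -> v = p) /\
    sphere_map_degree
      (fun v => (enorm (phi_map F G v))^-1 *: phi_map F G v) p eps n.

End MixedCurves.

(* Main.v *)
Require Import Defs.
From HB Require Import structures.
From mathcomp Require Import all_boot all_order all_algebra.
From mathcomp Require Import fingroup perm separable cyclotomic zify ring lra.
From mathcomp Require Import all_classical all_reals interval_inference.
From mathcomp Require Import topology normedtype sequences derive realfun.
From mathcomp Require Import complex.

Set Implicit Arguments.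
Unset Strict Implicit.
Unset Printing Implicit Defensive.
Import Order.TTheory GRing.Theory Num.Theory.
Import numFieldNormedType.Exports.
Local Open Scope ring_scope.

(** The curves are not holomorphic: local numbers may be negative and resultants do not apply, so
    the count has to be a topological degree. A local intersection number is specified only through
    signed counts over regular values, so it says something only once a regular value exists. Sard's
    theorem thus serves twice: for [phi/||phi||] on each small sphere, and for the choice of
    [(alpha, beta)]. The normalised map is not polynomial. This is why C^{1,1} functions are used:
    they are stable under sums, products, reciprocals, square roots and composition, and their
    quadratic remainder makes a counting proof of Sard possible in equal dimensions. The two notions
    of degree meet in the cone over a sphere map, its extension to the whole space that is
    homogeneous of degree 1 about [P]: its solutions at a unit vector [y] are the preimages of [y]
    on the sphere, with the same signs. Without the constants [(alpha, beta)] the segment from [h]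
    to the monomials could meet 0. By homogeneity only the line [[z1 : z2]] (two real parameters)
    and the time (one more) matter, against four real dimensions for [(alpha, beta)]. *)

(** Near infinity [(f, g)] is dominated by its leading part
    [h = (F(0, z1, z2), G(0, z1, z2))], so the sum of the local degrees of
    [(f, g)] is the degree of [h] on a large sphere.  Strong polar homogeneity
    gives [F(l X) = l^p (conj l)^q F(X)] with [p - q = d], and likewise for [G];
    hence a common zero of the segment from [h] to
    [(alpha z1^p (conj z1)^q, beta z2^p' (conj z2)^q')] forces [(alpha, beta)]
    into the image of a map of three real variables, and generic
    [(alpha, beta)] avoid it by Sard's theorem.  The monomial map is deformed to
    [(z1^d - 1, z2^d' - 1)] (with conjugates for negative exponents), which has
    [|d d'|] regular zeros, all of sign [sgn (d d')].

    Degrees are counted combinatorially: label each vertex of a fine grid by the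
    first negative coordinate of the map, and add up the orientations of the
    fully labelled simplices of the Kuhn triangulation.  The count depends only
    on the boundary labels, whence homotopy invariance; fully labelled simplices
    lie near zeros, whence additivity. *)
(** * Kuhn triangulation degree *)

Section Combinatorial.
Variable m : nat.
Local Notation n := m.+1.
Local Notation vert := {ffun 'I_n -> nat}.

(* The [k]-th vertex of the Kuhn simplex of the cell at [a]: coordinate [i] is
   raised at step [s i]. *)
Definition kuhn_vertex (a : vert) (s : 'S_n) (k : nat) : vert :=
  [ffun i => (a i + (s i < k))%N].

(** The sign of [l] if it is a bijection and 0 otherwise, because a repeated label gives two equal
    rows. As a determinant it can be expanded over the faces. *)
Definition label_sign (l : 'I_n.+1 -> 'I_n.+1) : int :=
  \det (\matrix_(k, j) (l k == j)%:R).

(** Nonzero only for faces that carry every label except the last: a vertex with the label [ord_max]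
    gives a zero row. *)
Definition face_sign (l : 'I_n -> 'I_n.+1) : int :=
  \det (\matrix_(k, j) (l k == lift ord_max j)%:R).

Lemma eq_label_sign l l' : l =1 l' -> label_sign l = label_sign l'.
Proof. by move=> ll'; congr (\det _); apply/matrixP => i j; rewrite !mxE ll'. Qed.

Lemma eq_face_sign l l' : l =1 l' -> face_sign l = face_sign l'.
Proof. by move=> ll'; congr (\det _); apply/matrixP => i j; rewrite !mxE ll'. Qed.

(* The rows of the matrix sum to 1, so its last column may be replaced by ones
   and expanded. *)
Lemma label_sign_faces (l : 'I_n.+1 -> 'I_n.+1) :
  label_sign l = \sum_(k < n.+1) (-1) ^+ (k + n) * face_sign (l \o lift k).
Proof.
pose T : 'M[int]_n.+1 := \matrix_(i, j) ((i == j) || (j == ord_max))%:R.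
have detT : \det T = 1.
  rewrite -det_tr det_trig; last first.
    apply/is_trig_mxP => i j ij; rewrite !mxE.
    have -> : (j == i) = false by apply/eqP => E; move: ij; rewrite E ltnn.
    have -> // : (i == ord_max) = false.
    by apply/eqP => E; move: ij (ltn_ord j); rewrite E /=; lia.
  by rewrite big1 // => i _; rewrite !mxE eqxx.
rewrite /label_sign; set A := \matrix_(k, j) _.
rewrite -[LHS]mulr1 -[X in _ * X = _]detT -det_mulmx (expand_det_col _ ord_max).
apply: eq_bigr => k _.
have AT j : (A *m T) k j = ((l k == j) || (j == ord_max))%:R.
  rewrite !mxE (bigD1 (l k)) //= big1 ?addr0; last first.
    by move=> i /negPf il; rewrite !mxE eq_sym il mul0r.
  by rewrite !mxE eqxx mul1r.
rewrite AT eqxx orbT mul1r /cofactor; congr (_ * _).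
rewrite /face_sign; congr (\det _); apply/matrixP => i j; rewrite !mxE.
rewrite (bigD1 (l (lift k i))) //= big1 ?addr0; last first.
  by move=> i' /negPf il; rewrite !mxE eq_sym il mul0r.
rewrite !mxE eqxx mul1r.
have /negPf-> : lift ord_max j != ord_max by rewrite eq_sym neq_lift.
by rewrite orbF.
Qed.

Lemma label_sign_full (l : 'I_n.+1 -> 'I_n.+1) :
  label_sign l != 0 -> forall j, exists k, l k = j.
Proof.
move=> ls j; apply/'exists_eqP; apply: contraNT ls => /existsPn lj.
rewrite /label_sign (expand_det_col _ j) big1 // => k _.
by rewrite !mxE (negPf (lj k)) mul0r.
Qed.

Definition cell_sign (L : vert -> 'I_n.+1) (a : vert) : int :=
  \sum_(s : 'S_n) (-1) ^+ s * label_sign (fun k => L (kuhn_vertex a s k)).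

Definition kuhn_degree K (L : vert -> 'I_n.+1) : int :=
  \sum_(a : {ffun 'I_n -> 'I_K}) cell_sign L [ffun i => val (a i)].

Definition incr (a : vert) (j : 'I_n) : vert := [ffun i => (a i + (i == j))%N].

Let fs (L : vert -> 'I_n.+1) s a : int :=
  face_sign (fun k : 'I_n => L (kuhn_vertex a s k)).

(* The inner faces cancel under the transposition of two consecutive steps; the
   last face for [s] and the first face for the cyclic shift of [s] are
   translates of each other. *)
Lemma cell_sign_boundary L a :
  cell_sign L a = \sum_(s : 'S_n) (-1) ^+ s *
    (fs L s a - fs L s (incr a ((s^-1)%g ord_max))).
Proof.
rewrite /cell_sign.
under eq_bigr do rewrite label_sign_faces mulr_sumr.
rewrite exchange_big big_ord_recl big_ord_recr /= [X in _ + (X + _)]big1 ?add0r.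
  rewrite addrC; under [RHS]eq_bigr do rewrite mulrBr.
  rewrite sumrB; congr (_ + _).
    apply: eq_bigr => s _; rewrite mulrCA -signr_odd.
    have -> : odd (bump 0 m + n) = false by rewrite /bump /=; lia.
    rewrite mul1r /fs; congr (_ * _); apply: eq_face_sign => i /=; congr L.
    by rewrite /bump; congr kuhn_vertex; have := ltn_ord i; lia.
  (* [c] sends the last step to step 0 and every other step [k] to [k + 1]. Thus [s * c] starts with
     the direction that [s] takes last, and its vertices from 1 on are the vertices of [s] from 0
     on, moved by one unit in that direction. *)
  pose c : 'S_n := lift_perm ord_max ord0 1%g.
  rewrite (reindex_inj (mulIg c)) -sumrN; apply: eq_bigr => s _.
  rewrite odd_permM odd_lift_perm odd_perm1 addbF /= addbF add0n.
  have sgn : (-1) ^+ (s (+) odd m) * (-1) ^+ n = - (-1) ^+ s :> int.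
    by rewrite signr_addb signr_odd exprS mulN1r mulrN -mulrA -expr2 sqrr_sign mulr1.
  rewrite mulrA sgn mulNr; congr (- (_ * _)).
  apply: eq_face_sign => i /=; congr L; apply/ffunP => x; rewrite !ffunE permM.
  rewrite /bump /= add1n.
  case: (unliftP ord_max (s x)) => [y sy|sy]; rewrite sy.
    rewrite lift_perm_lift perm1.
    have -> : (x == (s^-1)%g ord_max) = false.
      apply/eqP => xE; move: sy; rewrite xE permKV => /eqP.
      by rewrite (negPf (neq_lift _ _)).
    by rewrite addn0 lift0 lift_max.
  have -> : x = (s^-1)%g ord_max by rewrite -sy permK.
  by rewrite lift_perm_id eqxx /= addn1; have := ltn_ord i; lia.
move=> k _.
pose k0 : 'I_n := widen_ord (leqnSn m) k; pose k1 : 'I_n := lift ord0 k.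
have k01 : k0 != k1 by rewrite -val_eqE /= /bump /=; lia.
suff : forall x : int, x = - x -> x = 0 by [apply; 
  rewrite {1}(reindex_inj (mulIg (tperm k0 k1))) -sumrN; apply: eq_bigr => s _;
  rewrite odd_permM odd_tperm k01 addbT signrN mulNr; congr (- (_ * (_ * _)));
  apply: eq_face_sign => i /=; congr L; apply/ffunP => x; rewrite !ffunE permM; congr (_ + nat_of_bool _)%N;
  case: tpermP => [->|->|//] /=; rewrite /bump /=; lia|].
by move=> x xN; lia.
Qed.

(** The shift is made cyclic in coordinate [j]; the layer pushed out at [K] and the layer brought in
    at 0 both contribute zero. *)
Lemma sum_incr_shift K (g : vert -> int) (j : 'I_n) :
  (forall a : vert, a j = 0%N \/ a j = K -> g a = 0) ->
  \sum_(a : {ffun 'I_n -> 'I_K}) g (incr [ffun i => val (a i)] j) =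
  \sum_(a : {ffun 'I_n -> 'I_K}) g [ffun i => val (a i)].
Proof.
move=> g0.
pose sh (a : {ffun 'I_n -> 'I_K}) : {ffun 'I_n -> 'I_K} :=
  [ffun i => if i == j then ordS (a i) else a i].
have sh_inj : injective sh.
  move=> a b /ffunP ab; apply/ffunP => i; have := ab i; rewrite !ffunE.
  by case: eqP => // _ /(can_inj (@ordSK _)).
rewrite [RHS](reindex_inj sh_inj); apply: eq_bigr => a _.
have [lt|ge] := ltnP (a j).+1 K.
  congr g; apply/ffunP => i; rewrite !ffunE; case: eqP => [->|_]; last by rewrite addn0.
  by rewrite /= modn_small ?addn1.
have aj : (a j).+1 = K by apply/eqP; rewrite eqn_leq ge ltn_ord.
rewrite !g0 //; first by left; rewrite !ffunE eqxx /= aj modnn.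
by right; rewrite !ffunE eqxx addn1.
Qed.

(** For fixed [s] the two remaining faces of the cells telescope in the direction [j] that [s]
    raises last. A face with [a j] equal to 0 or [K] lies entirely in the boundary hyperplane, since
    its vertices stop before step [j]; there the two labellings agree. *)
Lemma kuhn_degree_boundary K (L L' : vert -> 'I_n.+1) :
  (forall (a : vert) j, a j = 0%N \/ a j = K -> L a = L' a) ->
  kuhn_degree K L = kuhn_degree K L'.
Proof.
move=> LL'; apply/eqP; rewrite -subr_eq0 /kuhn_degree -sumrB; apply/eqP.
under eq_bigr do rewrite !cell_sign_boundary -sumrB.
rewrite exchange_big big1 //= => s _.
under eq_bigr do rewrite -mulrBr.
rewrite -mulr_sumr.
set j := (s^-1)%g ord_max.
pose g a := fs L s a - fs L' s a.
have -> : \sum_(a : {ffun 'I_n -> 'I_K})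
   (fs L s [ffun i => val (a i)] - fs L s (incr [ffun i => val (a i)] j) -
   (fs L' s [ffun i => val (a i)] - fs L' s (incr [ffun i => val (a i)] j))) = 
   \sum_(a : {ffun 'I_n -> 'I_K}) g [ffun i => val (a i)] - 
   \sum_(a : {ffun 'I_n -> 'I_K}) g (incr [ffun i => val (a i)] j).
  by rewrite -sumrB; apply: eq_bigr => a _; rewrite /g; ring.
rewrite sum_incr_shift ?subrr ?mulr0 // => a aj.
rewrite /g /fs; apply/eqP; rewrite subr_eq0; apply/eqP; apply: eq_face_sign => k.
apply: (LL' _ j); rewrite ffunE permKV /=.
by have -> : (m < k)%N = false; [have := ltn_ord k; lia | rewrite addn0].
Qed.

Lemma eq_kuhn_degree K (L L' : vert -> 'I_n.+1) :
  (forall a : vert, (forall i, a i <= K)%N -> L a = L' a) ->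
  kuhn_degree K L = kuhn_degree K L'.
Proof.
move=> LL'; apply: eq_bigr => a _; apply: eq_bigr => s _; congr (_ * _).
apply: eq_label_sign => k; apply: LL' => i; rewrite !ffunE.
by case: (s i < k)%N; rewrite ?addn1 ?addn0 ?ltn_ord // ltnW ?ltn_ord.
Qed.

(** Permuting the coordinates maps the Kuhn triangulation to itself and multiplies all orientations
    by the sign of [t]. *)
Lemma kuhn_degree_perm K (L : vert -> 'I_n.+1) (t : 'S_n) :
  kuhn_degree K (fun a => L [ffun i => a (t i)]) = (-1) ^+ t * kuhn_degree K L.
Proof.
pose f (a : {ffun 'I_n -> 'I_K}) : {ffun 'I_n -> 'I_K} := [ffun i => a (t i)].
have f_inj : injective f.
  move=> a b /ffunP ab; apply/ffunP => i.
  by have := ab ((t^-1)%g i); rewrite !ffunE permKV.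
rewrite /kuhn_degree [in RHS](reindex_inj f_inj) mulr_sumr; apply: eq_bigr => a _.
rewrite /cell_sign [in RHS](reindex_inj (mulgI t)) mulr_sumr; apply: eq_bigr => s _.
rewrite odd_permM signr_addb mulrA mulrA -expr2 sqrr_sign mul1r; congr (_ * _).
apply: eq_label_sign => k; congr L; apply/ffunP => i.
by rewrite !ffunE permM.
Qed.

(* [c] is the cut: coordinate [i] of a vertex is "nonnegative" from [c] on. *)
Lemma kuhn_degree_id K c (L : vert -> 'I_n.+1) : (0 < c <= K)%N ->
  (forall a k, L a = k <-> (forall i : 'I_n, (i < k)%N -> (c <= a i)%N) /\
     (forall i : 'I_n, val i = k -> (a i < c)%N)) ->
  kuhn_degree K L = 1.
Proof.
move=> /andP[c0 cK] LP.
have c1K : (c.-1 < K)%N by lia.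
have Lmono (a : vert) s (k k' : 'I_n.+1) : (k <= k')%N ->
    (L (kuhn_vertex a s k) <= L (kuhn_vertex a s k'))%N.
  move=> kk'; set v := kuhn_vertex a s k; set v' := kuhn_vertex a s k'.
  have [_ ] := (LP v' _).1 erefl => h'.
  have [h _] := (LP v _).1 erefl.
  rewrite leqNgt; apply/negP => lt.
  have ltn : (L v' < n)%N by apply: leq_trans lt _; rewrite -ltnS ltn_ord.
  have := h' (Ordinal ltn) erefl; have := h (Ordinal ltn) lt.
  rewrite !ffunE; case: (ltnP _ k) => [/leq_trans/(_ kk') ->|_]; first by lia.
  rewrite addn0 => c1 /(leq_ltn_trans (leq_addr _ _))/(leq_ltn_trans c1).
  by rewrite ltnn.
(* Labels do not decrease along a simplex, so a full labelling must be the identity. Going from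
   label [i] to [i + 1] at step [i] then means that this step raises coordinate [i] from [c - 1] to
   [c], which determines both [s] and [a]. *)
have key (a : vert) s : label_sign (fun k => L (kuhn_vertex a s k)) != 0 ->
    s = 1%g /\ forall i, a i = c.-1.
  move=> /label_sign_full full.
  have Lid (k : 'I_n.+1) : L (kuhn_vertex a s k) = k.
    pose l (k : 'I_n.+1) := L (kuhn_vertex a s k).
    have {}full j : exists k, l k = j by exact: full.
    have [g gK] := fin_all_exists full.
    have l_inj : injective l.
      exact: bij_inj (bij_can_bij (injF_bij (can_inj gK)) gK).
    case: k => j jn; elim/ltn_ind: j jn => j IH jn; set J := Ordinal jn.
    have IH' (k : 'I_n.+1) : (k < j)%N -> l k = k by case: k => k kn kj; exact: IH.
    apply/val_inj/eqP; rewrite eqn_leq; apply/andP; split; last first.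
      rewrite leqNgt; apply/negP => lt.
      by have /l_inj lJ := IH' (l J) lt; rewrite -/(l J) lJ ltnn in lt.
    have [k kj] := full J.
    have jk : (J <= k)%N.
      rewrite leqNgt; apply/negP => lt.
      by have := IH' k lt; rewrite kj => E; rewrite E ltnn in lt.
    by apply: leq_trans (Lmono a s _ _ jk) _; rewrite -/(l k) kj.
  have h (i : 'I_n) : s i = i /\ a i = c.-1.
    have [_ h1] := (LP _ _).1 (Lid (widen_ord (leqnSn n) i)).
    have [h2 _] := (LP _ _).1 (Lid (lift ord0 i)).
    have := h1 i erefl; have := h2 i; rewrite lift0 ltnSn => /(_ isT).
    rewrite !ffunE ltnS /= => {h1 h2} h2 h1.
    have E : (s i <= i)%N /\ ~~ (s i < i)%N.
      by move: h1 h2; case: (s i <= i)%N; case: (s i < i)%N => // *; lia.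
    split; first by apply/val_inj => /=; lia.
    by move: h1 h2; case: E => -> /negPf->; lia.
  split; last by move=> i; case: (h i).
  by apply/permP => i; rewrite perm1; case: (h i).
pose a0 : {ffun 'I_n -> 'I_K} := [ffun=> Ordinal c1K].
rewrite /kuhn_degree (bigD1 a0) //= [X in _ + X]big1 ?addr0; last first.
  move=> a /eqP aa0; rewrite /cell_sign big1 // => s _.
  set x := label_sign _; have [->|nz] := eqVneq x 0; first by rewrite mulr0.
  have [_ ac] := key _ _ nz.
  case: aa0; apply/ffunP => i; apply/val_inj; have := ac i.
  by rewrite !ffunE.
rewrite /cell_sign (bigD1 1%g) //= [X in _ + X]big1 ?addr0; last first.
  move=> s s1.
  set x := label_sign _; have [->|nz] := eqVneq x 0; first by rewrite mulr0.
  have [sE _] := key _ _ nz.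
  by rewrite sE eqxx in s1.
rewrite odd_perm1 mul1r -[RHS](det1 _ n.+1); congr (\det _).
apply/matrixP => k j; rewrite !mxE; congr (_ == _)%:R.
apply/LP; split=> i; rewrite !ffunE perm1 /= => ik; rewrite ?ik ?ltnn; lia.
Qed.

End Combinatorial.

(** * Grid degree of a continuous map *)

Local Open Scope classical_set_scope.
Local Open Scope ring_scope.

Section Topology.
Variable R : realType.

Lemma row_normE n (x : 'rV[R]_n) :
  `|x| = \big[Num.max/0]_(ij : 'I_1 * 'I_n) `|x ij.1 ij.2|.
Proof. exact: mx_normrE. Qed.

Lemma mx_norm_leP n (x : 'rV[R]_n) (r : R) : 0 <= r ->
  (`|x| <= r) <-> (forall i, `|x ord0 i| <= r).
Proof.
move=> r0; rewrite row_normE; split=> [h i|h].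
  by apply: le_trans h; apply: (le_bigmax _ (fun ij => `|x ij.1 ij.2|) (ord0, i)).
by apply/bigmax_leP; split=> //= -[i j] _ /=; rewrite ord1.
Qed.

Lemma mx_norm_ltP n (x : 'rV[R]_n) (r : R) : 0 < r ->
  (`|x| < r) <-> (forall i, `|x ord0 i| < r).
Proof.
move=> r0; rewrite row_normE; split=> [h i|h].
  by apply: le_lt_trans h; apply: (le_bigmax _ (fun ij => `|x ij.1 ij.2|) (ord0, i)).
by apply/bigmax_ltP; split=> //= -[i j] _ /=; rewrite ord1.
Qed.

Lemma coord_le_norm n (x : 'rV[R]_n) i : `|x ord0 i| <= `|x|.
Proof. exact: (mx_norm_leP x (normr_ge0 x)).1. Qed.

Lemma near_inv_lt (e : R) : 0 < e -> \forall N \near \oo, N.+1%:R^-1 < e.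
Proof. by move=> e0; exact: (near_infty_natSinv_lt (PosNum e0)). Qed.

Lemma compact_lbound (T : topologicalType) (X : set T) (f : T -> R) :
  compact X -> continuous f -> (forall x, X x -> 0 < f x) ->
  exists2 e, 0 < e & forall x, X x -> e <= f x.
Proof.
move=> /compact_near_coveringP cX cf f0.
have [N _ NP] : \forall N \near \oo, X `<=` (fun x => N.+1%:R^-1 < f x).
  apply: cX => x Xx.
  have fx2 : f x / 2 < f x by have := f0 x Xx; lra.
  exists ([set x' | f x / 2 < f x'], [set N | N.+1%:R^-1 < f x / 2]) => /=.
    split; first by apply: cvgr_gt fx2; exact: cf.
    exact: near_inv_lt (divr_gt0 (f0 _ Xx) _).
  by move=> [x' N] [/= h1 h2]; exact: lt_trans h2 h1.
by exists N.+1%:R^-1 => // x Xx; apply/ltW/NP => /=.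
Qed.

Lemma continuous_distP (V W : normedModType R) (f : V -> W) :
  continuous f <-> forall x e, 0 < e -> exists2 d, 0 < d & forall y,
    `|x - y| < d -> `|f x - f y| < e.
Proof.
split=> [cf x e e0|h x].
  have := cf x => /cvgr_dist_lt/(_ _ e0) /nbhs_normP[d /= d0 dP].
  by exists d => // y xy; exact: dP.
apply/cvgrPdist_lt => e e0; have [d d0 dP] := h x e e0.
by apply/nbhs_normP; exists d.
Qed.

Section PointwiseContinuity.
Variables (T : topologicalType) (x : T).

Lemma ctsD (V : normedModType R) (f g : T -> V) :
  {for x, continuous f} -> {for x, continuous g} ->
  {for x, continuous (fun y => f y + g y)}.
Proof. exact: continuousD. Qed.

Lemma ctsB (V : normedModType R) (f g : T -> V) :
  {for x, continuous f} -> {for x, continuous g} ->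
  {for x, continuous (fun y => f y - g y)}.
Proof. exact: continuousB. Qed.

Lemma ctsZ (V : normedModType R) (s : T -> R) (f : T -> V) :
  {for x, continuous s} -> {for x, continuous f} ->
  {for x, continuous (fun y => s y *: f y)}.
Proof. exact: continuousZ. Qed.

Lemma ctsM (s t : T -> R) : {for x, continuous s} -> {for x, continuous t} ->
  {for x, continuous (fun y => s y * t y)}.
Proof. exact: continuousM. Qed.

Lemma ctsV (s : T -> R) : s x != 0 -> {for x, continuous s} ->
  {for x, continuous (fun y => (s y)^-1)}.
Proof. exact: continuousV. Qed.

Lemma cts_max (s t : T -> R) : {for x, continuous s} -> {for x, continuous t} ->
  {for x, continuous (fun y => Num.max (s y) (t y))}.
Proof. exact: continuous_max. Qed.

Lemma cts_cst (U : topologicalType) (c : U) : {for x, continuous (fun=> c : U)}.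
Proof. exact: cst_continuous. Qed.

Lemma cts_comp (U V : topologicalType) (f : T -> U) (g : U -> V) :
  {for x, continuous f} -> {for f x, continuous g} ->
  {for x, continuous (fun y => g (f y))}.
Proof. exact: continuous_comp. Qed.

Lemma cts_coord n (f : T -> 'rV[R]_n) i :
  {for x, continuous f} -> {for x, continuous (fun y => f y ord0 i)}.
Proof. by move=> cf; exact: (cts_comp cf (@coord_continuous R 1 n ord0 i (f x))). Qed.

Lemma cts_row n (f : T -> 'rV[R]_n) :
  (forall i, {for x, continuous (fun y => f y ord0 i)}) -> {for x, continuous f}.
Proof.
move=> cf; apply/cvgrPdist_lt => e e0.
have : \forall y \near x, forall i, `|f x ord0 i - f y ord0 i| < e.
  apply: filter_forall => i.
  by have := cf i => /cvgr_dist_lt/(_ _ e0).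
apply: filterS => y h; apply/mx_norm_ltP => // i; rewrite !mxE; exact: h.
Qed.

End PointwiseContinuity.

Lemma cts_id (T : topologicalType) (x : T) : {for x, continuous (fun y => y)}.
Proof. exact: cvg_id. Qed.

(** For a norm [nu] this is the radial retraction onto the ball of radius [r] about [p]. A map
    composed with it is constant on rays outside the ball, so an isolated zero becomes the only zero
    of a global map. *)
Definition retraction n (nu : 'rV[R]_n -> R) (p : 'rV[R]_n) (r : R) (x : 'rV[R]_n) :
  'rV[R]_n := p + (r / Num.max r (nu (x - p))) *: (x - p).

Lemma continuous_retraction n (nu : 'rV[R]_n -> R) p (r : R) : 0 < r -> continuous nu ->
  continuous (retraction nu p r).
Proof.
move=> r0 cnu x.
suff : {for x, continuous (fun y : 'rV[R]_n =>
    p + (r / Num.max r (nu (y - p))) *: (y - p))} by [].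
apply: ctsD; first exact: cts_cst.
have cxp : {for x, continuous (fun y : 'rV[R]_n => y - p)}.
  by apply: ctsB; [exact: cts_id|exact: cts_cst].
apply: ctsZ => //; apply: ctsM; first exact: cts_cst.
apply: ctsV; first by rewrite gt_eqF // lt_max r0.
by apply: cts_max; [exact: cts_cst|apply: cts_comp; [exact: cxp|exact: cnu]].
Qed.

Lemma continuous_norm_comp (T : topologicalType) n (f : T -> 'rV[R]_n) :
  continuous f -> continuous (fun x => `|f x|).
Proof. by move=> cf x; exact: (cvg_norm (cf x)). Qed.

Definition box n (M : R) : set 'rV[R]_n := [set x | `|x| <= M].
Definition sphere n (M : R) : set 'rV[R]_n := [set x | `|x| = M].

Lemma bounded_subset_box n (A : set 'rV[R]_n) M : A `<=` box M -> bounded_set A.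
Proof.
move=> AM; exists M; split; first by rewrite num_real.
by move=> M' MM' x Ax /=; apply: le_trans (ltW MM'); exact: AM.
Qed.

Lemma closed_box n M : closed (@box n M).
Proof.
by apply: (closed_comp _ (@closed_le _ M)) => x _; exact: norm_continuous.
Qed.

Lemma compact_box n M : compact (@box n M).
Proof.
apply: bounded_closed_compact; last exact: closed_box.
exact: (@bounded_subset_box _ _ M).
Qed.

Lemma compact_sphere n M : compact (@sphere n M).
Proof.
apply: bounded_closed_compact.
  by apply: (@bounded_subset_box _ _ M) => x; rewrite /box /= => ->.
by apply: (closed_comp _ (@closed_eq _ M)) => x _; exact: norm_continuous.
Qed.

Lemma near_dist n (x0 : 'rV[R]_n) d : 0 < d -> \forall x \near x0, `|x0 - x| < d.
Proof.
move=> d0; apply/nbhs_ballP; exists d => //= x.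
by rewrite mx_norm_ball.
Qed.

(** Only [x] is confined to [X]: a simplex may have one vertex in [X] and the others outside. The
    bound [N.+1%:R^-1] is the mesh of the grids below. *)
Lemma heine n k (X : set 'rV[R]_n) (phi : 'rV[R]_n -> 'rV[R]_k) (e : R) : compact X ->
  continuous phi -> 0 < e -> \forall N \near \oo, forall x x', X x ->
  `|x - x'| <= N.+1%:R^-1 -> `|phi x - phi x'| < e.
Proof.
move=> /compact_near_coveringP cX cphi e0.
suff : \forall N \near \oo, X `<=` (fun x => forall x',
    `|x - x'| <= N.+1%:R^-1 -> `|phi x - phi x'| < e).
  by apply: filterS => N NP x x' /NP; exact.
apply: cX => x0 Xx0.
have e20 : 0 < e / 2 by rewrite divr_gt0.
have := cphi x0 => /cvgr_dist_lt/(_ _ e20) /nbhs_normP[d /= d0 dP].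
have d20 : 0 < d / 2 by rewrite divr_gt0.
exists ([set x | `|x0 - x| < d / 2], [set N | N.+1%:R^-1 < d / 2]) => /=.
  split; last exact: near_inv_lt.
  exact: near_dist.
move=> [x N] [/= x0x Nd] x' /= xx'.
have h1 : `|phi x0 - phi x| < e / 2.
  by apply: dP => /=; apply: lt_trans x0x _; lra.
have h2 : `|phi x0 - phi x'| < e / 2.
  apply: dP => /=; rewrite -(subrK x x0) -addrA.
  apply: le_lt_trans (ler_normD _ _) _; rewrite (splitr d).
  by apply: ltrD => //; exact: le_lt_trans xx' Nd.
rewrite -(subrK (phi x0) (phi x)) -addrA; apply: le_lt_trans (ler_normD _ _) _.
by rewrite (distrC (phi x)) (splitr e); exact: ltrD.
Qed.

End Topology.

(** * Labels, grids on cubes and homotopy invariance *)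

Section Label.
Variables (R : realType) (m : nat).
Local Notation n := m.+1.

(** If no coordinate is negative, [find] returns the length of the list, which is the last label. *)
Definition label (y : 'rV[R]_n) : 'I_n.+1 :=
  inord (find (fun i => y ord0 i < 0) (enum 'I_n)).

Lemma labelP (y : 'rV[R]_n) (k : 'I_n.+1) : label y = k <->
  (forall i : 'I_n, (i < k)%N -> 0 <= y ord0 i) /\
  (forall i : 'I_n, val i = k -> y ord0 i < 0).
Proof.
set P := fun i => y ord0 i < 0.
have szn : size (enum 'I_n) = n by rewrite size_enum_ord.
have le_n : (find P (enum 'I_n) <= n)%N by have := find_size P (enum 'I_n); rewrite szn.
have lE : label y = find P (enum 'I_n) :> nat by rewrite inordK.
have nthE (i : 'I_n) : nth ord0 (enum 'I_n) i = i by rewrite nth_ord_enum.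
split=> [lk|[h1 h2]].
  split=> i ik.
    have := @before_find _ ord0 P (enum 'I_n) i; rewrite -lE lk => /(_ ik).
    by rewrite nthE /P => /negbT; rewrite -leNgt.
  have := @nth_find _ ord0 P (enum 'I_n); rewrite has_find -lE lk szn -ik.
  by rewrite ltn_ord nthE; exact.
apply/val_inj/eqP; rewrite /= lE eqn_leq; apply/andP; split.
  rewrite leqNgt; apply/negP => lt.
  have kn : (k < n)%N by exact: leq_trans lt le_n.
  have := before_find ord0 lt; rewrite (nthE (Ordinal kn)) /P.
  by rewrite (h2 (Ordinal kn)).
rewrite leqNgt; apply/negP => lt.
have fn : (find P (enum 'I_n) < n)%N by apply: leq_trans lt _; rewrite -ltnS.
have := @nth_find _ ord0 P (enum 'I_n); rewrite has_find szn => /(_ fn).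
by rewrite (nthE (Ordinal fn)) /P ltNge h1.
Qed.

(** Coordinate [i] is nonnegative at a point with the last label and negative at a point with label
    [i]; [c] is within [d] of both, so its coordinate [i] is smaller than [d]. *)
Lemma full_label_small (y : 'I_n.+1 -> 'rV[R]_n) (c : 'rV[R]_n) d :
  (forall k, `|c - y k| < d) -> (forall j, exists k, label (y k) = j) -> `|c| < d.
Proof.
move=> cy full.
have d0 : 0 < d by apply: le_lt_trans (cy ord0).
have {}cy k i : `|c ord0 i - y k ord0 i| < d.
  by have := (mx_norm_ltP _ d0).1 (cy k) i; rewrite !mxE.
apply/mx_norm_ltP => // i.
have [k /labelP[h _]] := full ord_max.
have [k' /labelP[_ h']] := full (widen_ord (leqnSn n) i).
have := h i (ltn_ord _); have := h' i erefl; have := cy k i; have := cy k' i.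
by rewrite !ltr_norml; lra.
Qed.

Definition grid_point (M N : nat) (a : {ffun 'I_n -> nat}) : 'rV[R]_n :=
  \row_i ((a i)%:R / N.+1%:R - M%:R).

Local Notation gsize M N := (2 * M * N.+1)%N.

Lemma norm_grid_point M N (a : {ffun 'I_n -> nat}) : (forall i, a i <= gsize M N)%N ->
  `|grid_point M N a| <= M%:R.
Proof.
move=> aK; apply/mx_norm_leP => // i; rewrite mxE ler_norml.
have h1 : 0 <= (a i)%:R / N.+1%:R :> R by rewrite divr_ge0.
have h2 : (a i)%:R / N.+1%:R <= 2 * M%:R :> R.
  by rewrite ler_pdivrMr // -!natrM ler_nat.
move: h1 h2; set q := _ / _ => h1 h2.
by apply/andP; split; lra.
Qed.

Lemma norm_grid_point_boundary M N (a : {ffun 'I_n -> nat}) j : (forall i, a i <= gsize M N)%N ->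
  (a j = 0 \/ a j = gsize M N)%N -> `|grid_point M N a| = M%:R.
Proof.
move=> aK aj; apply/eqP; rewrite eq_le norm_grid_point //=.
apply: le_trans (coord_le_norm _ j); rewrite mxE; case: aj => ->.
  by rewrite mul0r sub0r normrN ger0_norm.
rewrite natrM mulfK ?pnatr_eq0 // natrM ger0_norm; last by have := ler0n R M; lra.
by lra.
Qed.

Lemma grid_point_dist M N a s k k' :
  `|grid_point M N (kuhn_vertex a s k) - grid_point M N (kuhn_vertex a s k')|
    <= N.+1%:R^-1.
Proof.
apply/mx_norm_leP => [|i]; first by rewrite invr_ge0.
rewrite !mxE !ffunE opprB addrA subrK -mulrBl normrM.
rewrite (ger0_norm (_ : 0 <= N.+1%:R^-1)) ?invr_ge0 // ler_piMl ?invr_ge0 //.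
by case: (_ < k)%N; case: (_ < k')%N; rewrite ?addn0 ?addn1 -?natr1 ler_norml;
  apply/andP; split; lra.
Qed.

Definition grid_degree M N (phi : 'rV[R]_n -> 'rV[R]_n) : int :=
  kuhn_degree (gsize M N) (fun a => label (phi (grid_point M N a))).

(* Relabelling the boundary vertices by [psi] destroys or creates no fully
   labelled simplex, and the degree only depends on the boundary labels. *)
Lemma grid_degree_step M N phi psi (e : R) :
  (forall x, `|x| = M%:R -> e <= `|phi x|) ->
  (forall x x', `|x| = M%:R -> `|x'| <= M%:R -> `|x - x'| <= N.+1%:R^-1 ->
     `|phi x - phi x'| < e /\ `|phi x - psi x'| < e) ->
  grid_degree M N phi = grid_degree M N psi.
Proof.
move=> eP close; set K := gsize M N.
pose bd (a : {ffun 'I_n -> nat}) := [exists j, (a j == 0%N) || (a j == K)].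
pose L a := label ((if bd a then psi else phi) (grid_point M N a)).
transitivity (kuhn_degree K L); last first.
  apply: kuhn_degree_boundary => a j aj; rewrite /L.
  have -> // : bd a by apply/existsP; exists j; case: aj => ->; rewrite eqxx ?orbT.
apply: eq_bigr => a _; apply: eq_bigr => s _; congr (_ * _).
set v := fun k : 'I_n.+1 => kuhn_vertex [ffun i => val (a i)] s k.
have vK k i : (v k i <= K)%N.
  rewrite !ffunE.
  by case: (s i < k)%N; rewrite ?addn1 ?addn0 ?ltn_ord // ltnW ?ltn_ord.
case: (boolP [exists k, bd (v k)]) => [/existsP[k0 k0bd]|/existsPn nbd]; last first.
  by apply: eq_label_sign => k; rewrite /L (negPf (nbd k)).
pose c := phi (grid_point M N (v k0)).
have k0M : `|grid_point M N (v k0)| = M%:R.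
  move/existsP: k0bd => [j jP].
  by apply: (@norm_grid_point_boundary _ _ _ j) => //; case/orP: jP => /eqP; auto.
(* On a simplex that touches the boundary, every choice of [phi] or [psi] vertex by vertex stays
   within [e] of the value [c] at a boundary vertex. A full labelling would make [c] smaller than
   [e]. *)
have z (f : 'I_n.+1 -> 'rV[R]_n -> 'rV[R]_n) : (forall k, f k = phi \/ f k = psi) ->
    label_sign (fun k => label (f k (grid_point M N (v k)))) = 0.
  move=> fP; apply/eqP/negPn/negP => /label_sign_full full.
  have : `|c| < e.
    apply: full_label_small full => k.
    have [] := close (grid_point M N (v k0)) (grid_point M N (v k)) k0M.
    - exact: norm_grid_point.
    - exact: grid_point_dist.
    - by case: (fP k) => ->.
  by rewrite ltNge eP.
rewrite (z (fun=> phi)); last by left.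
rewrite -[LHS](z (fun k => if bd (v k) then psi else phi)) //.
by move=> k; case: (bd _); auto.
Qed.

(** A relation, so that no degree has to be constructed for a general map: values start from linear
    maps and are carried along by homotopy and additivity. *)
Definition has_degree M phi d := \forall N \near \oo, grid_degree M N phi = d.

Lemma has_degree_homotopy M (phi psi : 'rV[R]_n -> 'rV[R]_n) d :
  continuous phi -> continuous psi ->
  (forall (x : 'rV[R]_n) (t : R), `|x| = M%:R -> 0 <= t <= 1 -> (1 - t) *: phi x + t *: psi x != 0) ->
  has_degree M phi d -> has_degree M psi d.
Proof.
move=> cphi cpsi nz hphi.
pose H (p : 'rV[R]_n * R) := (1 - p.2) *: phi p.1 + p.2 *: psi p.1.
have cH : continuous H.
  move=> p; apply: cvgD; apply: cvgZ.
  - by apply: cvgB; [exact: cvg_cst|exact: cvg_snd].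
  - by apply: continuous_comp; [exact: cvg_fst|exact: cphi].
  - exact: cvg_snd.
  - by apply: continuous_comp; [exact: cvg_fst|exact: cpsi].
have [e e0 eP] : exists2 e, 0 < e & forall p,
    (sphere M%:R `*` `[0, 1]%classic) p -> e <= `|H p|.
  apply: (@compact_lbound R) => [||[x t] [/= Mx]].
  - by apply: compact_setX; [exact: compact_sphere|exact: segment_compact].
  - by move=> p; apply: cvg_norm; exact: cH.
  - by rewrite in_itv /= => t01; rewrite normr_gt0; exact: nz.
pose D (x : 'rV[R]_n) : 'rV[R]_n := phi x - psi x.
have cD : continuous D by move=> x; exact: (cvgB (cphi x) (cpsi x)).
have [C C0 CP] : exists2 C, 0 < C & forall x, box M%:R x -> `|D x| <= C.
  have [B [_ BP]] : bounded_set (D @` box M%:R).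
    apply: compact_bounded; apply: continuous_compact; last exact: compact_box.
    exact: continuous_subspaceT.
  exists (Num.max B 0 + 1); first by rewrite ltr_wpDl // le_max lexx orbT.
  move=> x Mx; apply: BP; last by exists x.
  by rewrite (le_lt_trans (_ : _ <= Num.max B 0)) ?le_max ?lexx ?ltrDl.
(* Time is cut into [T.+1] steps. One step moves a value by at most [C / T.+1], less than [e / 2];
   the mesh of the grid, through [e / 4] for each of the two maps, accounts for the other half. *)
have [T TP] : exists T : nat, C / T.+1%:R < e / 2.
  have [T _ TP] := @near_inv_lt R (e / 2 / C) (divr_gt0 (divr_gt0 e0 (ltr0n _ 2)) C0).
  by exists T; rewrite mulrC -ltr_pdivlMr //; exact: (TP T (leqnn T)).
have e4 : 0 < e / 4 by rewrite divr_gt0.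
have hu := heine (@compact_sphere R n M%:R) cphi e4.
have hv := heine (@compact_sphere R n M%:R) cpsi e4.
near=> N.
have hu' : forall x x', sphere M%:R x -> `|x - x'| <= N.+1%:R^-1 ->
  `|phi x - phi x'| < e / 4 by near: N.
have hv' : forall x x', sphere M%:R x -> `|x - x'| <= N.+1%:R^-1 ->
  `|psi x - psi x'| < e / 4 by near: N.
have hN : grid_degree M N phi = d by near: N.
pose tm (j : nat) : R := j%:R / T.+1%:R.
have step j : (j <= T.+1)%N -> grid_degree M N (fun x => H (x, tm j)) = d.
  elim: j => [_|j IH jT].
    rewrite -hN; congr (grid_degree M N _); apply/funext => x.
    by rewrite /H /tm /= mul0r subr0 scale1r scale0r addr0.
  rewrite -(IH (ltnW jT)); apply/esym; apply: (@grid_degree_step _ _ _ _ e).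
    move=> x Mx; apply: eP; split => //=; rewrite in_itv /= /tm divr_ge0 //=.
    by rewrite ler_pdivrMr // mul1r ler_nat ltnW.
  move=> x x' Mx Mx' xx'.
  have t01 : 0 <= tm j <= 1.
    by rewrite /tm divr_ge0 //= ler_pdivrMr // mul1r ler_nat ltnW.
  have E1 : H (x, tm j) - H (x', tm j) =
      (1 - tm j) *: (phi x - phi x') + tm j *: (psi x - psi x').
    rewrite /H /= !scalerBr opprD addrACA -scalerBr -[in RHS]scalerBr.
    by rewrite scalerBr [in RHS]scalerBr.
  have h1 : `|H (x, tm j) - H (x', tm j)| < e / 2.
    rewrite E1; apply: le_lt_trans (ler_normD _ _) _.
    rewrite normrZ [X in _ + X]normrZ.
    have [t0 t1] := andP t01.
    rewrite ger0_norm ?subr_ge0 // [X in _ + X * _]ger0_norm //.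
    have a1 : (1 - tm j) * `|phi x - phi x'| <= `|phi x - phi x'|.
      by rewrite ler_piMl //; lra.
    have a2 : tm j * `|psi x - psi x'| <= `|psi x - psi x'|.
      by rewrite ler_piMl //; lra.
    by have := hu' x x' Mx xx'; have := hv' x x' Mx xx'; lra.
  split; first by lra.
  have E2 : H (x', tm j) - H (x', tm j.+1) = T.+1%:R^-1 *: D x'.
    have -> : tm j.+1 = tm j + T.+1%:R^-1 by rewrite /tm -natr1 mulrDl mul1r.
    rewrite /H /D /=; apply/rowP => i; rewrite !mxE; ring.
  rewrite -(subrK (H (x', tm j)) (H (x, tm j))) -addrA E2.
  apply: le_lt_trans (ler_normD _ _) _; rewrite normrZ.
  rewrite (ger0_norm (_ : 0 <= T.+1%:R^-1)) ?invr_ge0 //.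
  have : T.+1%:R^-1 * `|D x'| <= C / T.+1%:R.
    by rewrite mulrC ler_pM2r ?invr_gt0 //; exact: CP.
  by move=> h; rewrite (splitr e); apply: ltrD => //; exact: le_lt_trans h TP.
have := step T.+1 (leqnn _); rewrite /tm divff ?pnatr_eq0 // => <-.
congr (grid_degree M N _); apply/funext => x.
by rewrite /H /= subrr scale0r scale1r add0r.
Unshelve. all: by end_near. Qed.

End Label.

Arguments grid_point {R m} M N a.

Section Finiteness.
Variable R : realType.

Lemma seq_uniform_radius (T : eqType) (s : seq T) (P : T -> R -> Prop) :
  (forall x r r', r' <= r -> P x r -> P x r') ->
  (forall x, x \in s -> exists2 r, 0 < r & P x r) ->
  exists2 r, 0 < r & forall x, x \in s -> P x r.
Proof.
move=> mono; elim: s => [|y s IH] h; first by exists 1.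
have [r r0 rP] := h y (mem_head _ _).
have [|r' r'0 r'P] := IH; first by move=> x xs; apply: h; rewrite in_cons xs orbT.
exists (Num.min r r'); first by rewrite lt_min r0.
move=> x; rewrite in_cons => /orP[/eqP->|/r'P].
  by apply: mono rP; rewrite ge_min lexx.
by apply: mono; rewrite ge_min lexx orbT.
Qed.

Lemma near_seq (T : eqType) (s : seq T) (P : T -> nat -> Prop) :
  (forall x, x \in s -> \forall N \near \oo, P x N) ->
  \forall N \near \oo, forall x, x \in s -> P x N.
Proof.
elim: s => [|y s IH] h; first by near=> N.
have h1 := h y (mem_head _ _).
have h2 : \forall N \near \oo, forall x, x \in s -> P x N.
  by apply: IH => x xs; apply: h; rewrite in_cons xs orbT.
near=> N => x; rewrite in_cons => /orP[/eqP->|]; first by near: N.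
by move: x; near: N.
Unshelve. all: by end_near. Qed.

End Finiteness.

(** * Additivity of the degree over isolated zeros *)

Section Additivity.
Variables (R : realType) (m : nat).
Local Notation n := m.+1.
Implicit Type phi : 'rV[R]_n -> 'rV[R]_n.

Local Notation csign phi M N := (cell_sign (fun a => label (phi (grid_point M N a)))).

Lemma kuhn_vertex0 (a : {ffun 'I_n -> nat}) s : kuhn_vertex a s 0 = a.
Proof. by apply/ffunP => i; rewrite !ffunE addn0. Qed.

Lemma cell_sign_eq0 phi (X : set 'rV[R]_n) M : compact X -> continuous phi ->
  (forall x, X x -> phi x != 0) ->
  \forall N \near \oo, forall a, X (grid_point M N a) -> csign phi M N a = 0.
Proof.
move=> cX cphi nz.
have [e e0 eP] : exists2 e, 0 < e & forall x, X x -> e <= `|phi x|.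
  apply: compact_lbound => // [|x Xx]; first exact: continuous_norm_comp.
  by rewrite normr_gt0 nz.
have h := heine cX cphi e0.
near=> N => a Xa.
rewrite /cell_sign big1 // => s _.
set x := label_sign _; suff -> : x = 0 by rewrite mulr0.
apply/eqP/negPn/negP => /label_sign_full full.
have : `|phi (grid_point M N a)| < e.
  apply: full_label_small full => k.
  have hN : forall x x', X x -> `|x - x'| <= N.+1%:R^-1 -> `|phi x - phi x'| < e.
    by near: N.
  by apply: hN => //; rewrite -{1}(kuhn_vertex0 a s); exact: grid_point_dist.
by rewrite ltNge eP.
Unshelve. all: by end_near. Qed.

Lemma eq_cell_sign phi psi p (r : R) M N a :
  (forall x, `|x - p| < r -> phi x = psi x) ->
  N.+1%:R^-1 < r / 2 -> `|grid_point M N a - p| < r / 2 ->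
  csign phi M N a = csign psi M N a.
Proof.
move=> pp Nr ar; apply: eq_bigr => s _; congr (_ * _).
apply: eq_label_sign => k; congr label; apply: pp.
rewrite -(subrK (grid_point M N a) (grid_point M N (kuhn_vertex a s k))) -addrA.
apply: le_lt_trans (ler_normD _ _) _; rewrite (splitr r); apply: ltrD => //.
apply: le_lt_trans Nr.
by rewrite -{2}(kuhn_vertex0 a s); exact: grid_point_dist.
Qed.

(** Each [f p] is a global map that isolates the zero [p]. On a fine grid a cell near [p] counts the
    same for [phi] and for [f p], and counts zero for the other [f p']; a cell far from [ps] counts
    zero for all of them. *)
Lemma has_degree_sum M phi (ps : seq 'rV[R]_n) (f : 'rV[R]_n -> 'rV[R]_n -> 'rV[R]_n)
    (dg : 'rV[R]_n -> int) :
  continuous phi -> uniq ps ->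
  (forall x, `|x| <= M%:R -> phi x = 0 -> x \in ps) ->
  (forall p, p \in ps -> [/\ continuous (f p),
     forall x, `|x| <= M%:R -> f p x = 0 -> x = p,
     exists2 r, 0 < r & forall x, `|x - p| < r -> phi x = f p x &
     has_degree M (f p) (dg p)]) ->
  has_degree M phi (\sum_(p <- ps) dg p).
Proof.
move=> cphi ups zphi fP.
have [r1 r10 r1P] : exists2 r, 0 < r & forall p, p \in ps ->
    forall x, `|x - p| < r -> phi x = f p x.
  apply: seq_uniform_radius => [p r r' rr' h x xr|p /fP[_ _ [r]]]; last by exists r.
  by apply: h; exact: lt_le_trans rr'.
have [r2 r20 r2P] : exists2 r, 0 < r & forall p, p \in ps ->
    forall p', p' \in ps -> p != p' -> r <= `|p' - p|.
  apply: seq_uniform_radius => [p r r' rr' h p' p's pp'|p _].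
    exact: le_trans rr' (h _ p's pp').
  apply: seq_uniform_radius => [p' r r' rr' h pp'|p' _].
    exact: le_trans rr' (h pp').
  have [->|pp'] := eqVneq p p'; first by exists 1.
  by exists `|p' - p| => //; rewrite normr_gt0 subr_eq0 eq_sym.
pose r := Num.min r1 r2; have r0 : 0 < r by rewrite lt_min r10.
have closed_far p : closed [set x : 'rV[R]_n | r / 2 <= `|x - p|].
  apply: (closed_comp _ (@closed_ge _ (r / 2))) => x _.
  by apply: continuous_norm_comp => {}x; exact: (cvgB cvg_id (cvg_cst p)).
pose X : set 'rV[R]_n := box M%:R `&`
  \bigcap_(p in [set` ps]) [set x | r / 2 <= `|x - p|].
have cX : compact X.
  apply: bounded_closed_compact; first by apply: (@bounded_subset_box _ _ _ M%:R) => x [].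
  by apply: closedI; [exact: closed_box|apply: closed_bigI => p _; exact: closed_far].
have hX := @cell_sign_eq0 phi X M cX cphi.
have {hX} hX : \forall N \near \oo, forall a, X (grid_point M N a) -> csign phi M N a = 0.
  apply: hX => x [Mx far]; apply/negP => /eqP /(zphi x Mx) xps.
  by have /= := far x xps; rewrite subrr normr0; lra.
have hp : \forall N \near \oo, forall p, p \in ps -> forall a, `|grid_point M N a| <= M%:R :> R ->
    r / 2 <= `|grid_point M N a - p| -> csign (f p) M N a = 0.
  apply: (@near_seq _ _ (fun p N => forall a, `|grid_point M N a| <= M%:R :> R ->
    r / 2 <= `|grid_point M N a - p| -> csign (f p) M N a = 0)) => p /fP[cf zf _ _].
  pose Y : set 'rV[R]_n := box M%:R `&` [set x | r / 2 <= `|x - p|].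
  have cY : compact Y.
    apply: bounded_closed_compact; first by apply: (@bounded_subset_box _ _ _ M%:R) => x [].
    by apply: closedI; [exact: closed_box|exact: closed_far].
  have : \forall N \near \oo, forall a, Y (grid_point M N a) -> csign (f p) M N a = 0.
    apply: cell_sign_eq0 => // x [Mx far]; apply/negP => /eqP /(zf x Mx) xp.
    by move: far; rewrite /= xp subrr normr0; lra.
  by apply: filterS => N h a aM ap; exact: h.
have hd : \forall N \near \oo, forall p, p \in ps -> grid_degree M N (f p) = dg p.
  by apply: (@near_seq _ _ (fun p N => grid_degree M N (f p) = dg p)) => p /fP[].
have hr : \forall N \near \oo, N.+1%:R^-1 < r / 2 by apply: near_inv_lt; rewrite divr_gt0.
rewrite /has_degree; near=> N.
have hXN : forall a, X (grid_point M N a) -> csign phi M N a = 0 by near: N.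
have hpN : forall p, p \in ps -> forall a, `|grid_point M N a| <= M%:R :> R ->
    r / 2 <= `|grid_point M N a - p| -> csign (f p) M N a = 0 by near: N.
have hdN : forall p, p \in ps -> grid_degree M N (f p) = dg p by near: N.
have hrN : N.+1%:R^-1 < r / 2 by near: N.
rewrite [RHS](eq_big_seq (fun p => grid_degree M N (f p))); last first.
  by move=> p /hdN.
rewrite /grid_degree /kuhn_degree [RHS]exchange_big /=; apply: eq_bigr => a0 _.
set a := [ffun i => val (a0 i)].
have aM : `|grid_point M N a| <= M%:R :> R.
  by apply: norm_grid_point => i; rewrite ffunE ltnW ?ltn_ord.
have [near_p|/hasPn far] := boolP (has (fun p => `|grid_point M N a - p| < r / 2) ps).
  have [p pps pa] := hasP near_p.
  rewrite (bigD1_seq p) //= big_seq_cond big1 ?addr0.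
    apply: (@eq_cell_sign _ _ p r) => // x xp; apply: r1P => //.
    by apply: lt_le_trans xp _; rewrite ge_min lexx.
  move=> p' /andP[p'ps p'p]; apply: hpN => //.
  have : r <= `|p' - p|.
    apply: le_trans (r2P _ pps _ p'ps _); last by rewrite eq_sym.
    by rewrite ge_min lexx orbT.
  move=> /le_trans/(_ (ler_distD (grid_point M N a) _ _)).
  by rewrite (distrC p'); move: pa; set u := `|_ - p|; set v := `|_ - p'|; lra.
rewrite hXN ?big_seq ?big1 // => [p pps|]; last first.
  split => // p /= pps; have := far p pps; rewrite -leNgt; exact.
by apply: hpN => //; have := far p pps; rewrite -leNgt.
Unshelve. all: by end_near. Qed.

End Additivity.

(** * Regular zeros *)

Section LinearDegree.
Variables (R : realType) (m : nat).
Local Notation n := m.+2.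

Lemma coord_mulmx_le (x : 'rV[R]_n) (B : 'M[R]_n) (C : R) :
  (forall i j, `|B i j| <= C) -> `|x *m B| <= n%:R * C * `|x|.
Proof.
move=> BC; have C0 : 0 <= C by apply: le_trans (BC 0 0).
apply/mx_norm_leP => [|j]; first by rewrite !mulr_ge0.
have h i : `|x ord0 i * B i j| <= C * `|x|.
  by rewrite normrM mulrC; apply: ler_pM => //; exact: coord_le_norm.
rewrite mxE; apply: le_trans (ler_norm_sum _ _ _) _.
apply: (@le_trans _ _ (\sum_(i < n) C * `|x|)); first by apply: ler_sum.
by rewrite sumr_const card_ord -[_ *+ _]mulr_natl mulrA.
Qed.

Lemma continuous_mulmx (B : 'M[R]_n) : continuous (fun x : 'rV[R]_n => x *m B).
Proof.
have [C CP] : exists C : R, forall i j, `|B i j| <= C.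
  exists `|B|; move=> i j.
  have := @mx_normrE R n n B; rewrite /Num.Def.normr /= => ->.
  exact: (le_bigmax _ (fun ij => `|B ij.1 ij.2|) (i, j)).
have C0 : 0 <= C by apply: le_trans (CP 0 0).
have k0 : 0 < n%:R * C + 1 by rewrite ltr_wpDl // mulr_ge0.
apply/continuous_distP => x e e0.
exists (e / (n%:R * C + 1)); first by rewrite divr_gt0.
move=> y; rewrite -mulmxBl ltr_pdivlMr // mulrC => /(le_lt_trans _); apply.
by apply: le_trans (coord_mulmx_le _ CP) _; rewrite ler_wpM2r // lerDl.
Qed.

Lemma continuous_affine (p : 'rV[R]_n) (B : 'M[R]_n) :
  continuous (fun x : 'rV[R]_n => (x - p) *m B).
Proof.
have -> : (fun x : 'rV[R]_n => (x - p) *m B) = (fun x => x *m B - p *m B).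
  by apply/funext => x; rewrite mulmxBl.
move=> x; apply: (@ctsB _ _ x _ (fun y => y *m B) (fun=> p *m B)).
  exact: continuous_mulmx.
exact: cts_cst.
Qed.

Variable M : nat.
Hypothesis M0 : (0 < M)%N.

Definition lin_deg (B : 'M[R]_n) := has_degree M (fun x => x *m B) (sgz (\det B)).

(** The grid index [M * N.+1] corresponds to the coordinate 0, so it is the cut for the identity
    map. *)
Lemma lin_deg1 : lin_deg 1%:M.
Proof.
near=> N; rewrite det1 sgz1.
rewrite /grid_degree (@kuhn_degree_id _ _ (M * N.+1)) // => [|a k].
  by rewrite muln_gt0 M0 /= -mulnA leq_pmull.
rewrite mulmx1; split=> [/labelP[h1 h2]|[h1 h2]].
  split=> i ik; [have := h1 i ik|have := h2 i ik]; rewrite mxE.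
    by rewrite subr_ge0 ler_pdivlMr // -natrM ler_nat.
  by rewrite subr_lt0 ltr_pdivrMr // -natrM ltr_nat.
apply/labelP; split=> i ik; [have := h1 i ik|have := h2 i ik]; rewrite mxE.
  by rewrite subr_ge0 ler_pdivlMr // -natrM ler_nat.
by rewrite subr_lt0 ltr_pdivrMr // -natrM ltr_nat.
Unshelve. all: by end_near. Qed.

Lemma lin_deg_perm t B : lin_deg B -> lin_deg (perm_mx t *m B).
Proof.
apply: filterS => N; rewrite det_mulmx det_perm sgzM.
have -> : sgz ((-1) ^+ (t : bool) : R) = (-1) ^+ t.
  by case: (odd_perm t); rewrite ?expr1 ?expr0 ?sgzN ?sgz1.
move=> <-; rewrite -odd_permV -kuhn_degree_perm; apply: eq_kuhn_degree => a _.
congr label; rewrite mulmxA; congr (_ *m _).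
by rewrite -{1}(invgK t) -col_permE; apply/rowP => j; rewrite !mxE ffunE.
Qed.

Lemma mulmx_eq0_det (A : 'M[R]_n) : (forall x : 'rV[R]_n, x *m A = 0 -> x = 0) ->
  forall B : 'M[R]_n, \det B != 0 -> forall x : 'rV[R]_n, x *m (A *m B) = 0 -> x = 0.
Proof.
move=> A0 B B0 x; have uB : B \in unitmx by rewrite unitmxE unitfE.
by rewrite mulmxA => /(congr1 (mulmxr (invmx B))) /=; rewrite mulmxK // mul0mx => /A0.
Qed.

(** The factor [B] is carried along so that a product of elementary matrices can be treated one
    factor at a time. *)
Lemma lin_deg_segment (E E' B : 'M[R]_n) : \det B != 0 ->
  (forall t : R, 0 <= t <= 1 -> forall x : 'rV[R]_n,
     x *m ((1 - t) *: E + t *: E') = 0 -> x = 0) ->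
  sgz (\det E) = sgz (\det E') -> lin_deg (E *m B) -> lin_deg (E' *m B).
Proof.
move=> B0 inj sEE; rewrite /lin_deg !det_mulmx !sgzM sEE.
apply: has_degree_homotopy; try exact: continuous_mulmx.
move=> x t xM t01; apply/negP => /eqP xt.
have x0 : x = 0.
  apply: (mulmx_eq0_det (inj t t01) B0).
  by rewrite mulmxDl !mulmxDr -!scalemxAl -!scalemxAr.
by move: xM; rewrite x0 normr0 => /esym/eqP; rewrite pnatr_eq0; lia.
Qed.

Lemma det_mulmx_inj (A : 'M[R]_n) : \det A != 0 ->
  forall x : 'rV[R]_n, x *m A = 0 -> x = 0.
Proof.
move=> A0 x; have uA : A \in unitmx by rewrite unitmxE unitfE.
by move=> /(congr1 (mulmxr (invmx A))) /=; rewrite mulmxK // mul0mx.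
Qed.

Definition flips (l : seq 'I_n) : 'M[R]_n := diag_mx (\row_i (-1) ^+ (i \in l)).

Lemma det_flips l : \det (flips l) != 0.
Proof.
rewrite det_diag prodf_seq_neq0; apply/allP => i _.
by rewrite mxE signr_eq0.
Qed.

Lemma flips_cons j l : j \notin l -> flips (j :: l) = flips [:: j] *m flips l.
Proof.
move=> jl; rewrite /flips mulmx_diag; congr diag_mx; apply/rowP => i.
rewrite !mxE !in_cons in_nil orbF; case: (eqVneq i j) => [->|_]; last by rewrite mul1r.
by rewrite (negPf jl) mulr1.
Qed.

Lemma det_flip1 j : \det (flips [:: j]) = -1.
Proof.
rewrite det_diag (bigD1 j) //= big1 ?mulr1 ?mxE ?mem_head // => i ij.
by rewrite mxE in_cons (negPf ij).
Qed.

(* The segment from a transposition matrix to the reflection of one coordinate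
   stays invertible. *)
Lemma lin_deg_flip j B : \det B != 0 -> lin_deg B -> lin_deg (flips [:: j] *m B).
Proof.
move=> B0 hB.
(* Dimension at least two enters here: the reflection is reached from a transposition with a second
   coordinate. *)
have [i ij] : exists i : 'I_n, i != j.
  by exists (if j == 0 then 1 else 0); case: (eqVneq j 0) => [->|//]; rewrite eq_sym.
apply: (@lin_deg_segment (tperm_mx i j)) => //; last exact: lin_deg_perm.
  move=> t /andP[t0 t1] x /rowP xE.
  have E k : (x *m ((1 - t) *: tperm_mx i j + t *: flips [:: j])) ord0 k =
     (1 - t) * x ord0 (tperm i j k) + t * (x ord0 k * (-1) ^+ (k == j)).
    have -> : tperm_mx i j = perm_mx (tperm i j)^-1 :> 'M[R]_n by rewrite tpermV.
    by rewrite mulmxDr -!scalemxAr -col_permE mul_mx_diag !mxE inE.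
  have {E} h k : (1 - t) * x ord0 (tperm i j k) + t * (x ord0 k * (-1) ^+ (k == j)) = 0.
    by rewrite -E xE mxE.
  have hi := h i; rewrite tpermL (negPf ij) expr0 mulr1 in hi.
  have hj := h j; rewrite tpermR eqxx expr1 mulrN1 in hj.
  (* Up to sign, the determinant of the block of the segment on the coordinates [i] and [j]. *)
  have pos : 0 < (1 - t) ^+ 2 + t ^+ 2.
    by rewrite !expr2; nra.
  have xi : x ord0 i = 0.
    apply/eqP; rewrite -(mulIr_eq0 _ (mulIf (lt0r_neq0 pos))); apply/eqP.
    transitivity (t * ((1 - t) * x ord0 j + t * x ord0 i) +
      (1 - t) * ((1 - t) * x ord0 i + t * - x ord0 j)); first by ring.
    by rewrite hi hj !mulr0 addr0.
  have xj : x ord0 j = 0.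
    apply/eqP; rewrite -(mulIr_eq0 _ (mulIf (lt0r_neq0 pos))); apply/eqP.
    transitivity ((1 - t) * ((1 - t) * x ord0 j + t * x ord0 i) -
      t * ((1 - t) * x ord0 i + t * - x ord0 j)); first by ring.
    by rewrite hi hj !mulr0 subr0.
  apply/rowP => k; rewrite mxE.
  have [->//|ki] := eqVneq k i; have [->//|kj] := eqVneq k j.
  have := h k; rewrite (negPf kj) expr0 mulr1 tpermD 1?eq_sym //.
  by rewrite -mulrDl subrK mul1r.
by rewrite det_flip1 det_perm odd_tperm ij expr1.
Qed.

Lemma lin_deg_flips l : uniq l -> lin_deg (flips l).
Proof.
elim: l => [_|j l IH /= /andP[jl ul]].
  suff -> : flips [::] = 1%:M by exact: lin_deg1.
  by apply/matrixP => i j; rewrite !mxE.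
by rewrite flips_cons //; apply: lin_deg_flip; [exact: det_flips|exact: IH].
Qed.

Lemma det_upper (A : 'M[R]_n) : (forall i j : 'I_n, (j < i)%N -> A i j = 0) ->
  \det A = \prod_i A i i.
Proof.
move=> Au; rewrite -det_tr det_trig; last first.
  by apply/is_trig_mxP => i j ij; rewrite mxE Au.
by apply: eq_bigr => i _; rewrite mxE.
Qed.

Lemma det_unitriangular (A : 'M[R]_n) :
  (forall i j : 'I_n, (i <= j)%N -> A i j = (i == j)%:R) -> \det A = 1.
Proof.
move=> Al; rewrite det_trig; last first.
  apply/is_trig_mxP => i j ij; rewrite Al 1?ltnW // -val_eqE /=.
  by rewrite (negPf (_ : i != j :> nat)) // neq_ltn ij.
by rewrite big1 // => i _; rewrite Al // eqxx.
Qed.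

(** The segment from the diagonal of signs of [U] to [U] stays upper triangular, and its diagonal
    entries keep their signs. *)
Lemma lin_deg_upper (U : 'M[R]_n) : (forall i j : 'I_n, (j < i)%N -> U i j = 0) ->
  \det U != 0 -> lin_deg U.
Proof.
move=> Uu U0.
pose l := [seq i <- enum 'I_n | U i i < 0].
have ul : uniq l by rewrite filter_uniq // enum_uniq.
have Ui i : U i i != 0.
  by move: U0; rewrite det_upper // => /prodf_neq0/(_ i isT).
have lE i : (i \in l) = (U i i < 0) by rewrite mem_filter mem_enum andbT.
rewrite -[U]mulmx1; apply: (@lin_deg_segment (flips l)); last first.
- by rewrite mulmx1; exact: lin_deg_flips.
- have -> : \det U = \prod_i U i i by exact: det_upper.
  rewrite det_diag; apply: (big_ind2 (fun x y => sgz x = sgz y)) => //.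
    by move=> x1 x2 y1 y2 h1 h2; rewrite !sgzM h1 h2.
  move=> i _; rewrite mxE lE; case: ltgtP (Ui i) => // h _.
    by rewrite expr1 sgzN1 ltr0_sgz.
  by rewrite expr0 sgz1 gtr0_sgz.
- move=> t /andP[t0 t1]; apply: det_mulmx_inj.
  rewrite det_upper; last first.
    move=> i j ji; rewrite !mxE Uu // mulr0 addr0.
    by rewrite (negPf (_ : i != j)) ?mulr0n ?mulr0 // neq_ltn ji orbT.
  apply/prodf_neq0 => i _; rewrite !mxE eqxx mulr1n lE.
  case: ltgtP (Ui i) => // h _; rewrite ?expr1 ?expr0.
    by rewrite lt_eqF //; nra.
  by rewrite gt_eqF //; nra.
- by rewrite det1 oner_eq0.
Qed.

(** An LUP decomposition makes the path in the linear group explicit: the unitriangular factor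
    shrinks linearly to the identity, the permutation contributes its sign, and an upper triangular
    matrix remains. *)
Lemma lin_deg_unit (A : 'M[R]_n) : \det A != 0 -> lin_deg A.
Proof.
move=> A0.
have := cormen_lup_correct A; have := cormen_lup_perm A; have := cormen_lup_detL A.
have := @cormen_lup_lower _ _ A; have := @cormen_lup_upper _ _ A.
case: (cormen_lup A) => [[P L] U] /= Uu Ll detL /is_perm_mxP[s ->] PA.
have AE : A = perm_mx s^-1 *m (L *m U).
  by rewrite -[L *m U]PA mulmxA -perm_mxM mulVg perm_mx1 mul1mx.
have U0 : \det U != 0.
  by move: A0; rewrite AE !det_mulmx detL mul1r mulf_eq0 negb_or => /andP[].
rewrite AE; apply: lin_deg_perm.
apply: (@lin_deg_segment 1%:M) => //; last by rewrite mul1mx; exact: lin_deg_upper.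
  move=> t _; apply: det_mulmx_inj; rewrite det_unitriangular ?oner_eq0 // => i j ij.
  by rewrite !mxE Ll // -mulrDl subrK mul1r.
by rewrite det1 detL.
Qed.

Lemma has_degree_affine (A : 'M[R]_n) p : \det A != 0 -> `|p| < M%:R ->
  has_degree M (fun x => (x - p) *m A) (sgz (\det A)).
Proof.
move=> A0 pM; have := lin_deg_unit A0; apply: has_degree_homotopy.
- exact: continuous_mulmx.
- exact: continuous_affine.
move=> x t xM /andP[t0 t1]; apply/negP => /eqP xt.
have : (x - t *: p) *m A = 0.
  rewrite -xt !mulmxBl scalerBr -scalemxAl addrA -scalerDl subrK scale1r //.
move=> /(det_mulmx_inj A0)/eqP; rewrite subr_eq0 => /eqP xp.
move: xM; rewrite xp normrZ ger0_norm // => h.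
have : t * `|p| <= `|p| by rewrite ler_piMl.
by rewrite h leNgt pM.
Qed.

Lemma mulmx_lbound (A : 'M[R]_n) : \det A != 0 ->
  exists2 c, 0 < c & forall x : 'rV[R]_n, c * `|x| <= `|x *m A|.
Proof.
move=> A0.
have [c c0 cP] : exists2 c, 0 < c & forall x, sphere 1 x -> c <= `|x *m A|.
  apply: compact_lbound; first exact: compact_sphere.
    by apply: continuous_norm_comp; exact: continuous_mulmx.
  move=> x x1; rewrite normr_gt0; apply/negP => /eqP/(det_mulmx_inj A0) x0.
  by move: x1; rewrite /sphere /= x0 normr0 => /esym/eqP; rewrite oner_eq0.
exists c => // x; have [->|x0] := eqVneq x 0; first by rewrite mul0mx !normr0 mulr0.
have nx : 0 < `|x| by rewrite normr_gt0.
have := cP (`|x|^-1 *: x); rewrite /sphere /= -scalemxAl !normrZ normfV normr_id.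
by rewrite mulVf ?gt_eqF // => /(_ erefl); rewrite ler_pdivlMl // mulrC.
Qed.

Local Notation ball_retraction := (retraction (fun y : 'rV[R]_n => `|y|)).

Definition differentiable_with (phi : 'rV[R]_n -> 'rV[R]_n) p (A : 'M[R]_n) :=
  forall e, 0 < e -> exists2 r, 0 < r & forall x, `|x - p| < r ->
    `|phi x - phi p - (x - p) *m A| <= e * `|x - p|.

(** About each zero a ball is chosen on which the remainder is at most half of the lower bound
    [c * |x - p|] for the linear part. Composed with the retraction onto this ball, [phi] has no
    other zero and is homotopic to its affine approximation. *)
Lemma has_degree_regular (phi : 'rV[R]_n -> 'rV[R]_n) (ps : seq 'rV[R]_n) (A : 'rV[R]_n -> 'M[R]_n) :
  continuous phi -> uniq ps ->
  (forall x, `|x| <= M%:R -> phi x = 0 -> x \in ps) ->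
  (forall p, p \in ps -> [/\ `|p| < M%:R, phi p = 0, \det (A p) != 0 &
     differentiable_with phi p (A p)]) ->
  has_degree M phi (\sum_(p <- ps) sgz (\det (A p))).
Proof.
move=> cphi ups zphi psP.
have [r rP] : exists r : 'rV[R]_n -> R, forall p, p \in ps -> 0 < r p /\
    exists2 c, 0 < c & forall x, `|x - p| <= r p ->
    c * `|x - p| <= `|(x - p) *m A p| /\
    `|phi x - (x - p) *m A p| <= c / 2 * `|x - p|.
  suff /choice[r rP] : forall p : 'rV[R]_n, exists r : R, p \in ps -> 0 < r /\
    exists2 c, 0 < c & forall x, `|x - p| <= r ->
    c * `|x - p| <= `|(x - p) *m A p| /\
    `|phi x - (x - p) *m A p| <= c / 2 * `|x - p| by exists r.
  move=> p; have [pps|] := boolP (p \in ps); last by exists 1.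
  have [pM php A0 dA] := psP p pps.
  have [c c0 cP] := mulmx_lbound A0.
  have [r r0 rP] := dA (c / 2) (divr_gt0 c0 (ltr0n _ 2)).
  exists (r / 2) => _; split; first by rewrite divr_gt0.
  exists c => // x xr; split; first exact: cP.
  have := rP x; rewrite php subr0; apply.
  by apply: le_lt_trans xr _; rewrite ltr_pdivrMr // mulr_natr mulr2n ltrDl.
apply: (@has_degree_sum _ _ _ _ _ (fun p x => phi (ball_retraction p (r p) x))) => //.
move=> p pps; have [pM php A0 _] := psP p pps; have [r0 [c c0 cP]] := rP p pps.
set s := r p in r0 cP *.
have mx0 (x : 'rV[R]_n) : 0 < Num.max s `|x - p| by rewrite lt_max r0.
pose lam (x : 'rV[R]_n) := s / Num.max s `|x - p|.
have lam0 x : 0 < lam x by rewrite divr_gt0.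
have lam1 x : lam x <= 1 by rewrite ler_pdivrMr // mul1r le_max lexx.
have br x : ball_retraction p s x - p = lam x *: (x - p).
  by rewrite /retraction addrAC subrr add0r.
have brs x : `|ball_retraction p s x - p| <= s.
  rewrite br normrZ gtr0_norm // /lam mulrAC ler_pdivrMr //.
  by rewrite ler_pM2l // le_max lexx orbT.
have cbr : continuous (fun x => phi (ball_retraction p s x)).
  have cr : continuous (ball_retraction p s).
    by apply: continuous_retraction => //; exact: norm_continuous.
  by move=> x; exact: (cts_comp (cr x) (cphi _)).
split => //.
- move=> x _ phx; have [h1 h2] := cP _ (brs x).
  rewrite phx sub0r normrN in h2.
  have {h1 h2} h := le_trans h1 h2.
  have : `|ball_retraction p s x - p| = 0.
    apply/eqP; rewrite eq_le normr_ge0 andbT -(pmulr_rle0 _ c0).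
    by move: h; lra.
  move/eqP; rewrite normr_eq0 br scaler_eq0 gt_eqF //= subr_eq0 => /eqP //.
- exists s => // x xs; congr phi; rewrite /retraction max_l ?ltW //.
  by rewrite divff ?gt_eqF // scale1r addrC subrK.
have := has_degree_affine A0 pM; apply: has_degree_homotopy => //.
  exact: continuous_affine.
move=> x t xM /andP[t0 t1]; have [h1 h2] := cP _ (brs x).
have xp : 0 < `|x - p|.
  rewrite normr_gt0 subr_eq0; apply/negP => /eqP xp.
  by move: pM; rewrite -xp xM ltxx.
set y := ball_retraction p s x in h1 h2 *.
apply/negP => /eqP E.
have yp : `|y - p| = lam x * `|x - p| by rewrite /y br normrZ gtr0_norm.
(* The linear part at [y] is the positive multiple [lam x] of the one at [x]. They cannot cancel,
   and a zero of the segment would have to come from the remainder, which is at most half the linear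
   part at [y]. *)
have E2 : (1 - t) * c * `|x - p| + t * (c / 2) * `|y - p| <= 0.
  set v := (x - p) *m A p in E.
  have vE : (y - p) *m A p = lam x *: v by rewrite /y br -scalemxAl.
  have E1 : ((1 - t) + t * lam x) *: v = - t *: (phi y - lam x *: v).
    apply/eqP; rewrite -subr_eq0 scaleNr opprK -E; apply/eqP.
    by rewrite scalerBr scalerDl scalerA addrACA addrC !addrA subrr add0r addrC.
  have := congr1 (fun z => `|z|) E1.
  rewrite !normrZ normrN (ger0_norm t0) ger0_norm; last first.
    by rewrite addr_ge0 ?subr_ge0 // mulr_ge0 // ltW.
  rewrite vE in h2 => E3.
  have h3 : c * `|x - p| <= `|v|.
    by rewrite -(ler_pM2l (lam0 x)) mulrCA -yp; move: h1; rewrite vE normrZ gtr0_norm.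
  have h4 : ((1 - t) + t * lam x) * (c * `|x - p|) <= t * (c / 2 * `|y - p|).
    apply: le_trans (_ : _ <= ((1 - t) + t * lam x) * `|v|) _.
      by rewrite ler_wpM2l // addr_ge0 ?subr_ge0 // mulr_ge0 // ltW.
    by rewrite E3 ler_wpM2l.
  have E5 : ((1 - t) + t * lam x) * (c * `|x - p|) =
      (1 - t) * c * `|x - p| + t * c * `|y - p| by rewrite yp; ring.
  move: h4; rewrite E5; lra.
have : 0 < (1 - t) * c * `|x - p| + t * (c / 2) * `|y - p|.
  rewrite yp; have : 0 < lam x * `|x - p| by rewrite mulr_gt0.
  move: (lam0 x) => l0 h; have [->|tn] := eqVneq t 0.
    by rewrite subr0 !mul0r mul1r addr0 mulr_gt0.
  have tp : 0 < t by rewrite lt_neqAle eq_sym tn.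
  apply: ltr_wpDl.
    by rewrite mulr_ge0 // mulr_ge0 ?subr_ge0 // ltW.
  by apply: mulr_gt0 => //; apply: mulr_gt0 => //; rewrite divr_gt0.
by move=> /lt_le_trans/(_ E2); rewrite ltxx.
Qed.

End LinearDegree.

(** * Functions of class C^{1,1} *)

Section C11.
Variables (R : realType) (n : nat).
Local Notation V := 'rV[R]_n.
Implicit Types (f g : V -> R) (a b : V -> V) (x : V).

Definition dot (u v : V) : R := \sum_i u ord0 i * v ord0 i.

Lemma dot_le u v : `|dot u v| <= n%:R * `|u| * `|v|.
Proof.
apply: le_trans (ler_norm_sum _ _ _) _.
apply: (@le_trans _ _ (\sum_(i < n) `|u| * `|v|)).
  by apply: ler_sum => i _; rewrite normrM; apply: ler_pM => //; exact: coord_le_norm.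
by rewrite sumr_const card_ord -[_ *+ _]mulr_natl mulrA.
Qed.

Lemma dotDl u u' v : dot (u + u') v = dot u v + dot u' v.
Proof. by rewrite -big_split /=; apply: eq_bigr => i _; rewrite mxE mulrDl. Qed.

Lemma dotZl c u v : dot (c *: u) v = c * dot u v.
Proof. by rewrite mulr_sumr; apply: eq_bigr => i _; rewrite mxE mulrA. Qed.

Lemma dotZr c u v : dot u (c *: v) = c * dot u v.
Proof. by rewrite mulr_sumr; apply: eq_bigr => i _; rewrite mxE mulrCA. Qed.

Lemma dot_delta i v : dot (delta_mx ord0 i) v = v ord0 i.
Proof.
rewrite /dot (bigD1 i) //= big1 ?addr0 ?mxE ?eqxx ?mul1r // => j ji.
by rewrite mxE (negPf ji) andbF mul0r.
Qed.

(* [f] is C^{1,1} around [x], with gradient [a]. *)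
Definition C11 f a x := exists C d, [/\ 0 <= C, 0 < d &
  forall y z, `|y - x| < d -> `|z - x| < d ->
    `|a y| <= C /\ `|f z - f y - dot (a y) (z - y)| <= C * `|z - y| ^+ 2].

(** One constant for the size, the Lipschitz bound and the remainder, so that the estimates for two
    functions can be merged by enlarging [C] and shrinking [d]. *)
Definition C11_bounds f a x C d := forall y z, `|y - x| < d -> `|z - x| < d ->
  [/\ `|f y| <= C, `|a y| <= C, `|f z - f y| <= C * `|z - y| &
      `|f z - f y - dot (a y) (z - y)| <= C * `|z - y| ^+ 2].

Lemma C11_boundsP f a x : C11 f a x -> exists2 C, 0 <= C &
  exists2 d, 0 < d & forall C' d', C <= C' -> d' <= d -> C11_bounds f a x C' d'.
Proof.
move=> [C [d [C0 d0 h]]].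
pose d1 := Num.min d 1; have d10 : 0 < d1 by rewrite lt_min d0 ltr01.
have d1d : d1 <= d by rewrite ge_min lexx.
have d11 : d1 <= 1 by rewrite ge_min lexx orbT.
pose L := n%:R * C + C * 2.
have L0 : 0 <= L by rewrite addr_ge0 ?mulr_ge0.
have lip y z : `|y - x| < d1 -> `|z - x| < d1 -> `|f z - f y| <= L * `|z - y|.
  move=> yd zd; have [h1 h2] := h y z (lt_le_trans yd d1d) (lt_le_trans zd d1d).
  have zy : `|z - y| <= 2.
    have -> : z - y = (z - x) - (y - x) by rewrite opprB addrA subrK.
    by apply: le_trans (ler_normB _ _) _; move: yd zd d11; lra.
  rewrite -(subrK (dot (a y) (z - y)) (f z - f y)).
  apply: le_trans (ler_normD _ _) _; rewrite /L mulrDl addrC; apply: lerD.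
    apply: le_trans (dot_le _ _) _; rewrite ler_wpM2r // ler_wpM2l //.
  apply: le_trans h2 _; rewrite -mulrA ler_wpM2l // expr2 ler_wpM2r //.
exists (`|f x| + L + C); first by rewrite addr_ge0 // addr_ge0.
exists d1 => // C' d' CC' dd y z yd zd.
have yd1 := lt_le_trans yd dd; have zd1 := lt_le_trans zd dd.
have [h1 h2] := h y z (lt_le_trans yd1 d1d) (lt_le_trans zd1 d1d).
have xd1 : `|x - x| < d1 by rewrite subrr normr0.
have fx0 := normr_ge0 (f x).
split.
- rewrite -(subrK (f x) (f y)); apply: le_trans (ler_normD _ _) _.
  have := lip x y xd1 yd1 => l1.
  have : L * `|y - x| <= L by rewrite ler_piMr // (le_trans (ltW yd1)).
  by move: l1 CC'; lra.
- by apply: le_trans h1 _; move: CC'; lra.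
- by apply: le_trans (lip _ _ yd1 zd1) _; rewrite ler_wpM2r //; move: CC'; lra.
- by apply: le_trans h2 _; rewrite ler_wpM2r ?exprn_ge0 //; move: CC'; lra.
Qed.

Lemma C11_bounds2 f a g b x : C11 f a x -> C11 g b x -> exists2 C, 1 <= C &
  exists2 d, 0 < d & C11_bounds f a x C d /\ C11_bounds g b x C d.
Proof.
move=> /C11_boundsP[C C0 [d d0 h]] /C11_boundsP[C' C'0 [d' d'0 h']].
exists (C + C' + 1); first by rewrite lerDr addr_ge0.
exists (Num.min d d'); first by rewrite lt_min d0.
by split; [apply: h|apply: h']; rewrite ?ge_min ?lexx ?orbT //; lra.
Qed.

Lemma C11_cst c x : C11 (fun=> c) (fun=> 0) x.
Proof.
exists 0, 1; split => // y z _ _; rewrite normr0; split => //.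
rewrite subrr sub0r normrN; apply: le_trans (dot_le _ _) _.
by rewrite normr0 mulr0 !mul0r.
Qed.

Lemma C11_coord i x : C11 (fun y => y ord0 i) (fun=> delta_mx ord0 i) x.
Proof.
exists `|delta_mx ord0 i : V|, 1; split => // y z _ _; split => //.
by rewrite dot_delta !mxE subrr normr0 mulr_ge0 // exprn_ge0.
Qed.

Lemma C11D f a g b x : C11 f a x -> C11 g b x ->
  C11 (fun y => f y + g y) (fun y => a y + b y) x.
Proof.
move=> hf hg; have [C C1 [d d0 [{}hf {}hg]]] := C11_bounds2 hf hg.
exists (C + C), d; split => //; first by lra.
move=> y z yd zd; have [_ ay _ fy] := hf y z yd zd; have [_ by_ _ gy] := hg y z yd zd.
split; first by apply: le_trans (ler_normD _ _) _; exact: lerD.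
rewrite mulrDl; apply: le_trans (lerD fy gy); apply: le_trans (ler_normD _ _).
by rewrite dotDl le_eqVlt; apply/orP; left; apply/eqP; congr `|_|; ring.
Qed.

Lemma C11M f a g b x : C11 f a x -> C11 g b x ->
  C11 (fun y => f y * g y) (fun y => f y *: b y + g y *: a y) x.
Proof.
move=> hf hg; have [C C1 [d d0 [{}hf {}hg]]] := C11_bounds2 hf hg.
have C0 : 0 <= C by lra.
pose D := C * C + C * C + n%:R * C * C.
have CC : 0 <= C * C by rewrite mulr_ge0.
have nCC : 0 <= n%:R * C * C by rewrite !mulr_ge0.
exists D, d; split => //; first by rewrite /D !addr_ge0.
move=> y z yd zd; have [f1 f2 f3 f4] := hf y z yd zd.
have [g1 g2 g3 g4] := hg y z yd zd; have [f1' _ _ _] := hf z y zd yd.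
split.
  apply: le_trans (ler_normD _ _) _; rewrite !normrZ.
  have : `|f y| * `|b y| <= C * C by exact: ler_pM.
  have : `|g y| * `|a y| <= C * C by exact: ler_pM.
  by rewrite /D; lra.
rewrite dotDl !dotZl; set h := z - y in f3 f4 g3 g4 *.
have -> : f z * g z - f y * g y - (f y * dot (b y) h + g y * dot (a y) h) =
  f z * (g z - g y - dot (b y) h) + g y * (f z - f y - dot (a y) h)
  + (f z - f y) * dot (b y) h by ring.
apply: le_trans (ler_normD _ _) _; rewrite /D [leRHS]mulrDl; apply: lerD.
  apply: le_trans (ler_normD _ _) _; rewrite [leRHS]mulrDl !normrM.
  by apply: lerD; rewrite -mulrA; exact: ler_pM.
rewrite normrM expr2.
have -> : n%:R * C * C * (`|h| * `|h|) = (C * `|h|) * (n%:R * C * `|h|) by ring.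
apply: ler_pM => //; apply: le_trans (dot_le _ _) _.
by rewrite ler_wpM2r // ler_wpM2l.
Qed.

Lemma C11_cvg f a x : C11 f a x -> forall e, 0 < e ->
  exists2 d, 0 < d & forall y, `|y - x| < d -> `|f y - f x| < e.
Proof.
move=> /C11_boundsP[C C0 [d d0 h]] e e0.
have C10 : 0 < C + 1 by lra.
exists (Num.min d (e / (C + 1))); first by rewrite lt_min d0 divr_gt0.
move=> y; rewrite lt_min => /andP[yd]; rewrite ltr_pdivlMr // mulrC => ye.
have xd : `|x - x| < d by rewrite subrr normr0.
have [_ _ h3 _] := h C d (lexx _) (lexx _) x y xd yd.
apply: le_lt_trans h3 _; apply: le_lt_trans ye.
by rewrite ler_wpM2r // lerDl.
Qed.

(** Common to the reciprocal and the square root, whose remainders are explicit up to sign: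
    [(t - s)^2 / (t s^2)] and [(t - s)^2 / (2 u (u + v)^2)] with [u], [v] the roots of [s], [t]. *)
Lemma C11_post (k k' : R -> R) f a x (K d0 : R) : C11 f a x -> 0 < d0 -> 0 <= K ->
  (forall s t, `|s - f x| < d0 -> `|t - f x| < d0 ->
    `|k' s| <= K /\ `|k t - k s - k' s * (t - s)| <= K * `|t - s| ^+ 2) ->
  C11 (fun y => k (f y)) (fun y => k' (f y) *: a y) x.
Proof.
move=> hf d00 K0 hk; have [e e0 he] := C11_cvg hf d00.
have [C C0 [d dp h]] := C11_boundsP hf.
exists (K * C + K * C ^+ 2), (Num.min d e); split.
- by rewrite addr_ge0 // mulr_ge0 // exprn_ge0.
- by rewrite lt_min dp.
move=> y z; rewrite !lt_min => /andP[yd ye] /andP[zd ze].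
have [f1 f2 f3 f4] := h C d (lexx _) (lexx _) y z yd zd.
have [k1 k2] := hk (f y) (f z) (he _ ye) (he _ ze).
have KC2 : 0 <= K * C ^+ 2 by rewrite mulr_ge0 // exprn_ge0.
split.
  rewrite normrZ; apply: le_trans (_ : _ <= K * C) _; first exact: ler_pM.
  by rewrite lerDl.
rewrite dotZl; set v := z - y in f3 f4 *.
have -> : k (f z) - k (f y) - k' (f y) * dot (a y) v =
  k' (f y) * (f z - f y - dot (a y) v) + (k (f z) - k (f y) - k' (f y) * (f z - f y)).
  by ring.
apply: le_trans (ler_normD _ _) _; rewrite [leRHS]mulrDl; apply: lerD.
  by rewrite normrM -mulrA; exact: ler_pM.
apply: le_trans k2 _; rewrite -mulrA ler_wpM2l // -exprMn.
by rewrite lerXn2r // ?nnegrE ?mulr_ge0.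
Qed.

Lemma C11V f a x : C11 f a x -> f x != 0 ->
  C11 (fun y => (f y)^-1) (fun y => (- (f y) ^- 2) *: a y) x.
Proof.
move=> hf fx0; have nfx : 0 < `|f x| by rewrite normr_gt0.
pose c := `|f x| / 2; have c0 : 0 < c by rewrite divr_gt0.
have far s : `|s - f x| < c -> c <= `|s|.
  have := ler_normD (f x - s) s; rewrite subrK (distrC (f x)) /c; lra.
apply: (@C11_post (fun s => s^-1) (fun s => - s ^- 2) f a x (c ^- 2 + c ^- 3) c) => //.
  by rewrite addr_ge0 // invr_ge0 exprn_ge0 // ltW.
move=> s t /far sc /far tc.
have s0 : s != 0 by rewrite -normr_gt0 (lt_le_trans c0).
have t0 : t != 0 by rewrite -normr_gt0 (lt_le_trans c0).
have c20 : 0 < c ^+ 2 by rewrite exprn_gt0.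
have c30 : 0 < c ^+ 3 by rewrite exprn_gt0.
have ic2 : 0 <= c ^- 2 by rewrite invr_ge0 ltW.
have ic3 : 0 <= c ^- 3 by rewrite invr_ge0 ltW.
split.
  rewrite normrN normfV normrX; apply: le_trans (_ : _ <= c ^- 2) _; last by lra.
  by rewrite lef_pV2 ?posrE ?exprn_gt0 ?normr_gt0 // lerXn2r ?nnegrE ?(ltW c0) ?normr_ge0.
have -> : t^-1 - s^-1 - - s ^- 2 * (t - s) = (t - s) ^+ 2 / (t * s ^+ 2).
  by field; rewrite s0 t0.
rewrite normrM normfV normrX mulrC ler_wpM2r ?exprn_ge0 //.
apply: le_trans (_ : _ <= c ^- 3) _; last by lra.
rewrite lef_pV2 ?posrE // ?normr_gt0 ?mulf_neq0 ?expf_neq0 // normrM normrX exprS.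
by apply: ler_pM; rewrite ?exprn_ge0 ?(ltW c0) // lerXn2r ?nnegrE ?(ltW c0) ?normr_ge0.
Qed.

Lemma C11_sqrt f a x : C11 f a x -> 0 < f x ->
  C11 (fun y => Num.sqrt (f y)) (fun y => (2 * Num.sqrt (f y))^-1 *: a y) x.
Proof.
move=> hf fx0.
pose c := f x / 2; have c0 : 0 < c by rewrite divr_gt0.
have far s : `|s - f x| < c -> c <= s by rewrite /c ltr_norml; lra.
pose q := Num.sqrt c; have q0 : 0 < q by rewrite sqrtr_gt0.
have q30 : 0 <= q ^- 3 by rewrite invr_ge0 exprn_ge0 // ltW.
have q10 : 0 <= q^-1 by rewrite invr_ge0 ltW.
apply: (@C11_post Num.sqrt (fun s => (2 * Num.sqrt s)^-1) f a x (q^-1 + q ^- 3) c) => //.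
  by rewrite addr_ge0.
move=> s t /far sc /far tc.
have s0 : 0 < s by exact: lt_le_trans c0 sc.
have t0 : 0 < t by exact: lt_le_trans c0 tc.
have qs : q <= Num.sqrt s by exact: ler_wsqrtr.
have qt : q <= Num.sqrt t by exact: ler_wsqrtr.
set u := Num.sqrt s in qs *; set v := Num.sqrt t in qt *.
have u0 : 0 < u by exact: lt_le_trans q0 qs.
have v0 : 0 < v by exact: lt_le_trans q0 qt.
have sE : s = u ^+ 2 by rewrite sqr_sqrtr // ltW.
have tE : t = v ^+ 2 by rewrite sqr_sqrtr // ltW.
split.
  rewrite normfV ger0_norm ?mulr_ge0 ?(ltW u0) //.
  apply: le_trans (_ : _ <= q^-1) _; last by lra.
  by rewrite lef_pV2 ?posrE ?mulr_gt0 //; move: qs u0; lra.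
have -> : v - u - (2 * u)^-1 * (t - s) = - ((t - s) ^+ 2 / (2 * u * (u + v) ^+ 2)).
  rewrite sE tE; by field; rewrite !lt0r_neq0 // addr_gt0.
rewrite normrN normrM normfV normrX mulrC ler_wpM2r ?exprn_ge0 //.
apply: le_trans (_ : _ <= q ^- 3) _; last by lra.
have p1 : 0 < 2 * u * (u + v) ^+ 2 by rewrite !mulr_gt0 ?exprn_gt0 ?addr_gt0.
rewrite (gtr0_norm p1) lef_pV2 ?posrE ?exprn_gt0 // exprS.
apply: ler_pM; rewrite ?exprn_ge0 ?(ltW q0) //; first by move: qs u0; lra.
by rewrite lerXn2r // ?nnegrE ?addr_ge0 ?(ltW q0) ?(ltW u0) ?(ltW v0) //; lra.
Qed.

Lemma eq_C11 f g a b x : f =1 g -> a =1 b -> C11 f a x -> C11 g b x.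
Proof. by move=> /funext -> /funext ->. Qed.

Lemma C11_comp f a (h : V -> V) (p : 'I_n -> V -> V) x :
  C11 f a (h x) -> (forall i, C11 (fun y => h y ord0 i) (p i) x) ->
  C11 (fun y => f (h y)) (fun y => \sum_i a (h y) ord0 i *: p i y) x.
Proof.
move=> hf hh.
have [C C0 [d d0 {}hf]] := C11_boundsP hf.
have [K K0 [e e0 hK]] : exists2 K, 0 <= K & exists2 e, 0 < e &
    forall i, C11_bounds (fun y => h y ord0 i) (p i) x K e.
  have h1 i : exists c : R * R, [/\ 0 <= c.1, 0 < c.2 & forall C' d',
    c.1 <= C' -> d' <= c.2 -> C11_bounds (fun y => h y ord0 i) (p i) x C' d'].
    by have [c c0 [s s0 sP]] := C11_boundsP (hh i); exists (c, s).
  have [c cP] := choice h1.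
  exists (\sum_i (c i).1); first by apply: sumr_ge0 => i _; case: (cP i).
  have [e e0 eP] : exists2 e, 0 < e & forall i, i \in enum 'I_n -> e <= (c i).2.
    apply: seq_uniform_radius => [i r r' rr' /(le_trans rr')//|i _].
    by exists (c i).2 => //; case: (cP i).
  exists e => // i; case: (cP i) => _ _; apply; last by rewrite eP ?mem_enum.
  rewrite (bigD1 i) //= lerDl; apply: sumr_ge0 => j _; by case: (cP j).
have hlip y z : `|y - x| < e -> `|z - x| < e -> `|h z - h y| <= K * `|z - y|.
  move=> ye ze; apply/mx_norm_leP => [|i]; first by rewrite mulr_ge0.
  by rewrite !mxE; case: (hK i y z ye ze).
pose e' := Num.min e (d / (K + 1)).
have K10 : 0 < K + 1 by lra.
have e'0 : 0 < e' by rewrite lt_min e0 divr_gt0.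
have hd y : `|y - x| < e' -> `|h y - h x| < d.
  rewrite lt_min => /andP[ye]; rewrite ltr_pdivlMr // mulrC => yd.
  have xx : `|x - x| < e by rewrite subrr normr0.
  apply: le_lt_trans (hlip _ _ xx ye) _; apply: le_lt_trans yd.
  by rewrite ler_wpM2r // lerDl.
exists (n%:R * (C * K) + (n%:R * (C * K) + C * K ^+ 2)), e'; split => //.
  by rewrite !addr_ge0 ?mulr_ge0 ?exprn_ge0.
move=> y z yd zd.
have ye : `|y - x| < e by move: yd; rewrite lt_min => /andP[].
have ze : `|z - x| < e by move: zd; rewrite lt_min => /andP[].
have [f1 f2 f3 f4] := hf C d (lexx _) (lexx _) _ _ (hd y yd) (hd z zd).
have p1 : 0 <= n%:R * (C * K) by rewrite !mulr_ge0.
have p2 : 0 <= C * K ^+ 2 by rewrite mulr_ge0 ?exprn_ge0.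
split.
  apply: (@le_trans _ _ (\sum_(i < n) C * K)).
    apply: le_trans (ler_norm_sum _ _ _) _; apply: ler_sum => i _.
    rewrite normrZ; have [_ h2 _ _] := hK i y z ye ze.
    by apply: ler_pM => //; apply: le_trans (coord_le_norm _ _) f2.
  by rewrite sumr_const card_ord -[_ *+ _]mulr_natl lerDl addr_ge0.
have dotS : dot (\sum_i a (h y) ord0 i *: p i y) (z - y) =
    \sum_i a (h y) ord0 i * dot (p i y) (z - y).
  elim/big_ind2: _ => [|u1 u2 v1 v2 <- <-|i _]; last by rewrite dotZl.
    by rewrite /dot big1 // => i _; rewrite mxE mul0r.
  by rewrite dotDl.
have -> : f (h z) - f (h y) - dot (\sum_i a (h y) ord0 i *: p i y) (z - y) =
   \sum_i a (h y) ord0 i * (h z ord0 i - h y ord0 i - dot (p i y) (z - y)) +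
   (f (h z) - f (h y) - dot (a (h y)) (h z - h y)).
  rewrite dotS /dot.
  under [X in _ = X + _]eq_bigr do rewrite mulrBr.
  rewrite sumrB.
  under [X in _ = _ + (_ - X)]eq_bigr do rewrite !mxE.
  ring.
apply: le_trans (ler_normD _ _) _; rewrite [leRHS]mulrDl.
apply: (@le_trans _ _ ((n%:R * (C * K) + C * K ^+ 2) * `|z - y| ^+ 2)); last first.
  by rewrite mulrDl [leRHS]addrA lerD2r -mulrDl ler_wpM2r ?exprn_ge0 // lerDl.
rewrite [leRHS]mulrDl; apply: lerD.
  apply: (@le_trans _ _ (\sum_(i < n) C * (K * `|z - y| ^+ 2))).
    apply: le_trans (ler_norm_sum _ _ _) _; apply: ler_sum => i _.
    rewrite normrM; have [_ _ _ h4] := hK i y z ye ze.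
    by apply: ler_pM => //; apply: le_trans (coord_le_norm _ _) f2.
  by rewrite sumr_const card_ord -[_ *+ _]mulr_natl !mulrA.
apply: le_trans f4 _; rewrite -mulrA ler_wpM2l // -exprMn.
by rewrite lerXn2r // ?nnegrE ?mulr_ge0 // hlip.
Qed.

End C11.

(** * Sard's theorem *)

Section Sard.
Variables (R : realType) (m : nat).
Local Notation n := m.+1.
Local Notation V := 'rV[R]_n.

(** Gradients are columns, because differentials act on row vectors from the right; this is the
    transpose of the usual Jacobian matrix. *)
Definition jacobian (a : 'I_n -> V -> V) (x : V) : 'M[R]_n :=
  \matrix_(i, j) a j x ord0 i.

Lemma mulmx_jacobian a x (h : V) j : (h *m jacobian a x) ord0 j = dot (a j x) h.
Proof. by rewrite mxE; apply: eq_bigr => i _; rewrite mxE mulrC. Qed.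

(** By compactness a single integer [K] serves both as the constant and, through [K.+1%:R^-1], as
    the radius. *)
Lemma C11_uniform (X : set V) (L : V -> V) (a : 'I_n -> V -> V) : compact X ->
  (forall x, X x -> forall j, C11 (fun y => L y ord0 j) (a j) x) ->
  \forall K \near \oo, forall x y j, X x -> `|y - x| < K.+1%:R^-1 ->
    `|a j x| <= K%:R /\
    `|L y ord0 j - L x ord0 j - dot (a j x) (y - x)| <= K%:R * `|y - x| ^+ 2.
Proof.
move=> /compact_near_coveringP cX hL.
suff : \forall K \near \oo, X `<=` (fun x => forall y j, `|y - x| < K.+1%:R^-1 ->
    `|a j x| <= K%:R /\
    `|L y ord0 j - L x ord0 j - dot (a j x) (y - x)| <= K%:R * `|y - x| ^+ 2).
  by apply: filterS => K h x y j Xx; exact: h.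
apply: cX => x0 Xx0.
have h1 (j : 'I_n) : exists c : R * R, [/\ 0 <= c.1, 0 < c.2 &
  forall y z, `|y - x0| < c.2 -> `|z - x0| < c.2 -> `|a j y| <= c.1 /\
  `|L z ord0 j - L y ord0 j - dot (a j y) (z - y)| <= c.1 * `|z - y| ^+ 2].
  by have [C [d h]] := hL x0 Xx0 j; exists (C, d).
have [c cP] := choice h1.
pose C := \sum_j (c j).1.
have Cj j : (c j).1 <= C.
  by rewrite /C (bigD1 j) //= lerDl; apply: sumr_ge0 => i _; case: (cP i).
have [e e0 eP] : exists2 e, 0 < e & forall i, i \in enum 'I_n -> e <= (c i).2.
  apply: seq_uniform_radius => [i r r' rr' /(le_trans rr')//|i _].
  by exists (c i).2 => //; case: (cP i).
have e20 : 0 < e / 2 by rewrite divr_gt0.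
exists ([set x | `|x0 - x| < e / 2], [set K | C <= K%:R /\ K.+1%:R^-1 < e / 2]) => /=.
  split; first exact: near_dist.
  have h2 := near_inv_lt e20; near=> K; split; last by near: K.
  by near: K; exact: nbhs_infty_ger.
move=> [x K] [/= xe [CK Ke]] y j yK.
have xj : `|x - x0| < (c j).2.
  rewrite distrC; apply: lt_le_trans xe (le_trans _ (eP j _)); last by rewrite mem_enum.
  by rewrite ler_pdivrMr // mulr_natr mulr2n lerDl ltW.
have yj : `|y - x0| < (c j).2.
  apply: lt_le_trans (eP j _); last by rewrite mem_enum.
  apply: le_lt_trans (ler_distD x _ _) _; rewrite (splitr e) (distrC x).
  by apply: ltrD => //; exact: lt_trans yK Ke.
have [c0 _ h] := cP j; have [h2 h3] := h x y xj yj.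
split; first exact: le_trans h2 (le_trans (Cj j) CK).
by apply: le_trans h3 _; rewrite ler_wpM2r ?exprn_ge0 // (le_trans (Cj j) CK).
Unshelve. all: by end_near. Qed.

(** A linear form that vanishes on the image of [A], scaled so that its largest coefficient is 1, at
    the index [w.2]. Near a critical point it makes coordinate [w.2] of the value almost a function
    of the other coordinates. *)
Lemma kernel_vector (A : 'M[R]_n) : \det A = 0 ->
  exists w : V * 'I_n, [/\ w.1 ord0 w.2 = 1, forall j, `|w.1 ord0 j| <= 1 &
    forall h : V, \sum_j w.1 ord0 j * (h *m A) ord0 j = 0].
Proof.
move=> A0.
have /det0P[v v0 vA] : \det A^T == 0 by rewrite det_tr A0.
have [i vi] : exists i, `|v| = `|v ord0 i|.
  have /mx_norm_neq0[[i j] /= vij] : `|v| != 0 by rewrite normr_eq0.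
  by exists j; rewrite [LHS]vij (ord1 i).
have vi0 : v ord0 i != 0 by rewrite -normr_eq0 -vi normr_eq0.
exists ((v ord0 i)^-1 *: v, i); split => /= [|j|h].
- by rewrite mxE mulVf.
- by rewrite mxE normrM normfV -vi mulrC ler_pdivrMr ?normr_gt0 // mul1r coord_le_norm.
under eq_bigr do rewrite mxE -mulrA; rewrite -mulr_sumr.
suff -> : \sum_j v ord0 j * (h *m A) ord0 j = 0 by rewrite mulr0.
transitivity ((v *m (A^T *m h^T)) ord0 ord0); last by rewrite mulmxA vA mul0mx mxE.
by rewrite [RHS]mxE; apply: eq_bigr => j _; rewrite -trmx_mul [in RHS]mxE.
Qed.

(* Pigeonhole: with cells of side 1/N the critical image is covered by about
   N^(2n-1) cubes of side 1/N^2, too few for a ball. *)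
Lemma sard (X : set V) (L : V -> V) (a : 'I_n -> V -> V) (c : V) (r : R) :
  compact X -> (forall x, X x -> forall j, C11 (fun y => L y ord0 j) (a j) x) ->
  0 < r -> exists2 y, `|y - c| < r & forall x, X x -> L x = y -> \det (jacobian a x) != 0.
Proof.
move=> cX hL r0; apply: contrapT => nex.
have surj y : `|y - c| < r -> exists2 x, X x & L x = y /\ \det (jacobian a x) = 0.
  move=> yr; apply: contrapT => nx; apply: nex; exists y => // x Xx Lx.
  by apply/negP => /eqP dx; apply: nx; exists x.
have [K hK] : exists K : nat, (0 < K)%N /\ forall x y j, X x -> `|y - x| < K.+1%:R^-1 ->
    `|a j x| <= K%:R /\
    `|L y ord0 j - L x ord0 j - dot (a j x) (y - x)| <= K%:R * `|y - x| ^+ 2.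
  have [K0 _ K0P] := C11_uniform cX hL; exists K0.+1; split => //.
  exact: (K0P K0.+1 (leqnSn K0)).
case: hK => Kp hK.
have [B [Bp hB]] : exists B : nat, (0 < B)%N /\ forall x, X x -> `|x| <= B%:R.
  have [B [_ hB]] := compact_bounded cX.
  exists (Num.truncn `|B|).+1; split => // x Xx.
  apply: hB => //; rewrite (le_lt_trans (ler_norm _)) //.
  by rewrite truncnS_gt.
pose k3 : R := 3 * n%:R * K%:R.
have k30 : 0 < k3 by rewrite /k3 !mulr_gt0 // ltr0n.
have [T [TK Tr]] : exists T : nat, (K < T)%N /\ k3 / T%:R < r.
  exists (K + (Num.truncn (k3 / r)).+1)%N; split; first by lia.
  rewrite ltr_pdivrMr; last by rewrite ltr0n; lia.
  rewrite mulrC -ltr_pdivrMr // natrD.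
  have : k3 / r < (Num.truncn (k3 / r)).+1%:R by rewrite truncnS_gt.
  by move=> /lt_le_trans; apply; rewrite lerDr.
have Tp : (0 < T)%N by lia.
(* With [N = T u] and [M = T u^2] there are at most [3^(2m+1) B^n (T u)^(2m+1)] codes for
   [M^n = T^n u^(2m+2)] targets; [u] exceeds the quotient of the constants. *)
have [u uE] : exists u, u = (3 ^ (2 * m + 1) * B ^ n * T ^ m).+1 by eexists.
have [N NE] : exists N, N = (T * u)%N by eexists.
have [M ME] : exists M, M = (T * u ^ 2)%N by eexists.
have up : (0 < u)%N by rewrite uE.
have Np : (0 < N)%N by rewrite NE muln_gt0 Tp.
have NR : 0 < N%:R :> R by rewrite ltr0n.
have Mp : (0 < M)%N by rewrite ME muln_gt0 Tp expn_gt0 up.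
(* The spacing of the targets is three times the error [n K / N^2] of a value along the kernel form,
   so the errors of two values cannot add up to a full step. *)
pose eta : R := k3 / (N%:R ^+ 2).
have eta0 : 0 < eta by rewrite divr_gt0 // exprn_gt0.
have etaM : eta * M%:R < r.
  rewrite (_ : eta * M%:R = k3 / T%:R) // /eta ME NE !natrM.
  by field; rewrite !pnatr_eq0; lia.
pose yy (s : {ffun 'I_n -> 'I_M}) : V := \row_j (c ord0 j + eta * (s j)%:R).
have yc s : `|yy s - c| < r.
  apply/mx_norm_ltP => // j; rewrite !mxE addrC addKr ger0_norm; last first.
    by rewrite mulr_ge0 // ltW.
  by apply: le_lt_trans etaM; rewrite ler_pM2l // ler_nat ltnW.
have /choice[xx xxP] : forall s : {ffun 'I_n -> 'I_M}, exists x,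
    [/\ X x, L x = yy s & \det (jacobian a x) = 0].
  by move=> s; have [x Xx [Lx dx]] := surj _ (yc s); exists x.
pose cell (s : {ffun 'I_n -> 'I_M}) : {ffun 'I_n -> 'I_(2 * B * N).+1} :=
  [ffun j => inord (Num.truncn ((xx s ord0 j + B%:R) * N%:R))].
have cell_close s t : cell s = cell t -> `|xx s - xx t| <= N%:R^-1.
  move=> /ffunP st; apply/mx_norm_leP => [|j]; first by rewrite invr_ge0.
  have pos q : 0 <= (xx q ord0 j + B%:R) * N%:R.
    rewrite mulr_ge0 //; have := coord_le_norm (xx q) j; have [/hB] := xxP q.
    by move=> h1 _ _ h2; have := le_trans h2 h1; rewrite ler_norml; lra.
  have bd q : (Num.truncn ((xx q ord0 j + B%:R) * N%:R)%R < (2 * B * N).+1)%N.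
    rewrite ltnS truncn_le_nat; apply: le_lt_trans (_ : _ <= (2 * B * N)%:R) _; last first.
      by rewrite ltr_nat.
    rewrite !natrM ler_pM2r //; have := coord_le_norm (xx q) j; have [/hB] := xxP q.
    by move=> h1 _ _ h2; have := le_trans h2 h1; rewrite ler_norml; lra.
  have := congr1 (@nat_of_ord _) (st j); rewrite !ffunE (inordK (bd s)) (inordK (bd t)) => E.
  have := truncn_itv (pos s); have := truncn_itv (pos t); rewrite E -natr1.
  set k := (Num.truncn _)%:R => h1 h2.
  rewrite !mxE -(ler_pM2r NR) mulVf ?gt_eqF //.
  have -> : `|xx s ord0 j - xx t ord0 j| * N%:R =
      `|(xx s ord0 j + B%:R) * N%:R - (xx t ord0 j + B%:R) * N%:R|.
    by rewrite -mulrBl normrM (ger0_norm (ltW NR)) opprD addrACA subrr addr0.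
  by move: h1 h2; rewrite ler_norml => /andP[h1 h2] /andP[h3 h4]; apply/andP; split; lra.
pose s0 : {ffun 'I_n -> 'I_M} := [ffun=> Ordinal Mp].
pose rep k := odflt s0 [pick s | cell s == k].
have repP s : cell (rep (cell s)) = cell s.
  by rewrite /rep; case: pickP => [t /eqP//|/(_ s)]; rewrite eqxx.
have u2 : (1 < u)%N by rewrite uE ltnS !muln_gt0 !expn_gt0 Bp Tp.
have KN : (K.+1 < N)%N by rewrite NE; apply: leq_trans (leq_mul TK u2); lia.
have NK s t : cell s = cell t -> `|xx s - xx t| < K.+1%:R^-1.
  move=> /cell_close/le_lt_trans; apply.
  by rewrite ltf_pV2 ?posrE ?ltr0n // ltr_nat; lia.
have N1 : N%:R^-1 <= 1 :> R by rewrite invf_le1 // ler1n.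
have /choice[w wP] : forall s : {ffun 'I_n -> 'I_M}, exists w : V * 'I_n,
   [/\ w.1 ord0 w.2 = 1, forall j, `|w.1 ord0 j| <= 1 &
    forall h : V, \sum_j w.1 ord0 j * dot (a j (xx s)) h = 0].
  move=> s; have [_ _ dx] := xxP s; have [w [w1 w2 w3]] := kernel_vector dx.
  exists w; split => // h; rewrite -[RHS](w3 h).
  by apply: eq_bigr => j _; rewrite mulmx_jacobian.
(* Two targets with preimages in one cell differ by the first order term, of size [1/N], plus a
   remainder of size [1/N^2]; the kernel form annihilates the first order term. *)
have close s : let t := rep (cell s) in
   (forall j, `|yy s ord0 j - yy t ord0 j| <= 2 * n%:R * K%:R / N%:R) /\
   `|\sum_j (w t).1 ord0 j * (yy s ord0 j - yy t ord0 j)| <= n%:R * K%:R / N%:R ^+ 2.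
  move=> t; have st : cell s = cell t by rewrite repP.
  have h := cell_close _ _ st; have hd := NK _ _ st.
  have [Xt Lt _] := xxP t; have [_ Ls _] := xxP s.
  have kP j := hK (xx t) (xx s) j Xt hd.
  have rem j : `|yy s ord0 j - yy t ord0 j - dot (a j (xx t)) (xx s - xx t)| <=
      K%:R / N%:R ^+ 2.
    have [_] := kP j; rewrite Ls Lt => /le_trans; apply.
    by rewrite ler_wpM2l // -exprVn lerXn2r ?nnegrE ?invr_ge0.
  split=> [j|].
    rewrite -(subrK (dot (a j (xx t)) (xx s - xx t)) (yy s ord0 j - yy t ord0 j)).
    apply: le_trans (ler_normD _ _) _.
    have h1 : `|dot (a j (xx t)) (xx s - xx t)| <= n%:R * K%:R / N%:R.
      apply: le_trans (dot_le _ _) _; apply: ler_pM => //; rewrite ?mulr_ge0 //.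
      by rewrite ler_wpM2l //; case: (kP j).
    have h2 : K%:R / N%:R ^+ 2 <= n%:R * K%:R / N%:R :> R.
      rewrite expr2 invfM mulrA ler_wpM2r ?invr_ge0 //.
      apply: le_trans (_ : _ <= K%:R) _; first by rewrite ler_piMr.
      by rewrite ler_peMl // ler1n.
    by have := rem j; move: h1 h2; rewrite -!mulrA; lra.
  have [_ w1 w2] := wP t.
  have -> : \sum_j (w t).1 ord0 j * (yy s ord0 j - yy t ord0 j) =
    \sum_j (w t).1 ord0 j *
      (yy s ord0 j - yy t ord0 j - dot (a j (xx t)) (xx s - xx t)).
    under [RHS]eq_bigr do rewrite mulrBr.
    by rewrite sumrB w2 subr0.
  apply: (@le_trans _ _ (\sum_(j < n) K%:R / N%:R ^+ 2)); last first.
    by rewrite sumr_const card_ord -[_ *+ _]mulr_natl mulrA.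
  apply: le_trans (ler_norm_sum _ _ _) _; apply: ler_sum => j _.
  by rewrite normrM -[leRHS]mul1r; apply: ler_pM.
(* The code of a target is the cell of its chosen preimage, with its offset from the representative
   of that cell in all coordinates but [w.2]. Offsets are at most [N] in absolute value; adding [N]
   keeps the subtraction from being truncated. *)
pose code s : {ffun 'I_n -> 'I_(2 * B * N).+1} * {ffun 'I_m -> 'I_(2 * N).+1} :=
  (cell s, [ffun k => inord (s (lift (w (rep (cell s))).2 k) + N
                             - rep (cell s) (lift (w (rep (cell s))).2 k))]).
have yyE s t j : yy s ord0 j - yy t ord0 j = eta * ((s j)%:R - (t j)%:R).
  by rewrite !mxE; ring.
have near_rep (s : {ffun 'I_n -> 'I_M}) j : ((s j <= rep (cell s) j + N) && (rep (cell s) j <= s j + N))%N.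
  have [/(_ j) h _] := close s; move: h; rewrite yyE normrM (gtr0_norm eta0).
  rewrite mulrC -ler_pdivlMr // => h.
  have : `|(s j)%:R - (rep (cell s) j)%:R| <= N%:R :> R.
    apply: le_trans h _; rewrite /eta /k3.
    have E (p q z : R) : p != 0 -> q != 0 -> z != 0 ->
        2 * p * q / z / (3 * p * q / z ^+ 2) = 2 / 3 * z.
      by move=> p0 q0 z0; field; rewrite p0 q0 z0.
    by rewrite E ?pnatr_eq0 -?lt0n //; move: NR; lra.
  rewrite ler_norml => /andP[h1 h2]; rewrite -!(ler_nat R) !natrD.
  by apply/andP; split; lra.
have code_inj : injective code.
  move=> s t [st]; rewrite -st; set q := rep (cell s) => /ffunP E.
  set i0 := (w q).2 in E.
  have E1 k : s (lift i0 k) = t (lift i0 k).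
    have := congr1 (@nat_of_ord _) (E k); rewrite !ffunE.
    have /andP[h1 h2] := near_rep s (lift i0 k).
    have /andP[h3 h4] := near_rep t (lift i0 k).
    move: h1 h2 h3 h4; rewrite -st -/q; move=> h1 h2 h3 h4.
    rewrite !inordK; last by lia.
      by move=> E1; apply/val_inj => /=; lia.
    by lia.
  apply/ffunP => j; case: (unliftP i0 j) => [k ->//|->].
  have [_ hs] := close s; have [_ ht] := close t.
  rewrite -st in ht; rewrite -/q in hs ht.
  have : `|\sum_j (w q).1 ord0 j * (yy s ord0 j - yy t ord0 j)| < eta.
    have -> : \sum_j (w q).1 ord0 j * (yy s ord0 j - yy t ord0 j) =
      \sum_j (w q).1 ord0 j * (yy s ord0 j - yy q ord0 j) -
      \sum_j (w q).1 ord0 j * (yy t ord0 j - yy q ord0 j).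
      by rewrite -sumrB; apply: eq_bigr => k _; rewrite -mulrBr; congr (_ * _); ring.
    apply: le_lt_trans (ler_normB _ _) _.
    have -> : eta = 3 * (n%:R * K%:R / N%:R ^+ 2) by rewrite /eta /k3; ring.
    have : 0 < n%:R * K%:R / N%:R ^+ 2 :> R by rewrite !mulr_gt0 ?invr_gt0 ?exprn_gt0 ?ltr0n.
    by move: hs ht; set p := n%:R * K%:R / _; lra.
  rewrite (bigD1 i0) //= big1 ?addr0; last first.
    move=> k ki; case: (unliftP i0 k) ki => [k' ->|->]; last by rewrite eqxx.
    by rewrite yyE E1 subrr !mulr0.
  have [-> _ _] := wP q; rewrite mul1r yyE normrM (gtr0_norm eta0).
  rewrite gtr_pMr // => h.
  move: h; rewrite ltr_norml => /andP[h1 h2].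
  apply/val_inj => /=; case: (ltngtP (s i0) (t i0)) => // lt.
    by move: lt; rewrite -(ler_nat R) -natr1 => lt; exfalso; lra.
  by move: lt; rewrite -(ler_nat R) -natr1 => lt; exfalso; lra.
have := leq_card _ code_inj.
rewrite card_prod !card_ffun !card_ord.
apply/negP; rewrite -ltnNge.
have h1 : ((2 * B * N).+1 <= 3 * B * N)%N by nia.
have h2 : ((2 * N).+1 <= 3 * N)%N by lia.
have pw k l e : (k <= l)%N -> (k ^ e <= l ^ e)%N.
  by move=> kl; elim: e => // e IH; rewrite !expnS leq_mul.
apply: leq_ltn_trans (leq_mul (pw _ _ n h1) (pw _ _ m h2)) _.
have -> : ((3 * B * N) ^ n * (3 * N) ^ m =
    3 ^ (2 * m + 1) * B ^ n * T ^ m * (T ^ n * u ^ (2 * m + 1)))%N.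
  rewrite NE !expnMn (_ : (2 * m + 1)%N = (n + m)%N); last by lia.
  by rewrite !expnD; ring.
have -> : (M ^ n = u * (T ^ n * u ^ (2 * m + 1)))%N.
  rewrite ME expnMn -expnM (_ : (2 * n)%N = (2 * m + 1).+1); last by lia.
  by rewrite (expnS u) mulnCA.
rewrite ltn_pmul2r; last by rewrite muln_gt0 !expn_gt0 Tp up.
by rewrite [ltnRHS]uE.
Qed.

End Sard.

(** * Local intersection numbers *)

Lemma cts_dist (R : realType) (V W : normedModType R) (f : V -> W) x :
  (forall e, 0 < e -> exists2 d, 0 < d & forall y, `|y - x| < d -> `|f y - f x| < e) ->
  {for x, continuous f}.
Proof.
move=> h; apply/cvgrPdist_lt => e e0; have [d d0 dP] := h e e0.
apply/nbhs_normP; exists d => //= y /=; rewrite /ball_ /= distrC => /dP.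
by rewrite distrC.
Qed.

Section Derivative.
Variables (R : realType) (m : nat).
Local Notation n := m.+1.
Local Notation V := 'rV[R]_n.

Lemma C11_derive (f : V -> V) (a : 'I_n -> V -> V) (x v : V) :
  (forall j, C11 (fun y => f y ord0 j) (a j) x) -> 'D_v f x = v *m jacobian a x.
Proof.
move=> hf.
have hX : \forall K \near \oo, forall x' y j, [set x] x' -> `|y - x'| < K.+1%:R^-1 ->
    `|a j x'| <= K%:R /\
    `|f y ord0 j - f x' ord0 j - dot (a j x') (y - x')| <= K%:R * `|y - x'| ^+ 2.
  by apply: C11_uniform; [exact: compact_set1|move=> _ ->].
have [K _ /(_ K (leqnn K)) KP] := hX.
apply: cvg_lim; first exact: norm_hausdorff.
apply/cvgrPdist_lt => e e0.
have v0 := normr_ge0 v.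
pose d1 := K.+1%:R^-1 / (`|v| + 1); pose d2 := e / (K%:R * `|v| ^+ 2 + 1).
have vp : 0 < `|v| + 1 by rewrite ltr_wpDl.
have Kp : 0 < K%:R * `|v| ^+ 2 + 1 by rewrite ltr_wpDl // mulr_ge0 // exprn_ge0.
have d0 : 0 < Num.min d1 d2 by rewrite lt_min !divr_gt0 ?invr_gt0.
near=> t.
have t0 : t != 0 by near: t; exact: nbhs_dnbhs_neq.
have : `|t| < Num.min d1 d2 by near: t; exact: dnbhs0_lt.
rewrite lt_min /d1 /d2 !ltr_pdivlMr // => /andP[td1 td2].
have nt : 0 < `|t| by rewrite normr_gt0.
apply/mx_norm_ltP => // j; rewrite !mxE.
have tv : `|(t *: v + x) - x| < K.+1%:R^-1.
  rewrite addrK normrZ; apply: le_lt_trans td1.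
  by rewrite ler_pM2l // lerDl.
have [_] := KP x (t *: v + x) j erefl tv; rewrite addrK dotZr /=.
rewrite -mulmx_jacobian [in X in X -> _]mxE.
set s := \sum_i _ => h.
have -> : s - t^-1 * (f (t *: v + x) ord0 j + - f x ord0 j) =
   - t^-1 * (f (t *: v + x) ord0 j - f x ord0 j - t * s) by field.
rewrite normrM normrN normfV mulrC ltr_pdivrMr //.
apply: le_lt_trans h _; rewrite normrZ exprMn mulrCA expr2 -mulrA.
rewrite [ltRHS]mulrC ltr_pM2l //; apply: le_lt_trans td2.
by rewrite ler_pM2l // lerDl.
Unshelve. all: by end_near. Qed.

Lemma C11_differentiable_with (f : V -> V) (a : 'I_n -> V -> V) (x : V) :
  (forall j, C11 (fun y => f y ord0 j) (a j) x) -> forall e, 0 < e ->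
  exists2 r, 0 < r & forall y, `|y - x| < r ->
    `|f y - f x - (y - x) *m jacobian a x| <= e * `|y - x|.
Proof.
move=> hf e e0.
have hX : \forall K \near \oo, forall x' y j, [set x] x' -> `|y - x'| < K.+1%:R^-1 ->
    `|a j x'| <= K%:R /\
    `|f y ord0 j - f x' ord0 j - dot (a j x') (y - x')| <= K%:R * `|y - x'| ^+ 2.
  by apply: C11_uniform; [exact: compact_set1|move=> _ ->].
have [K _ /(_ K (leqnn K)) KP] := hX.
have K0 : 0 < K.+1%:R :> R by rewrite ltr0n.
exists (Num.min K.+1%:R^-1 (e / K.+1%:R)).
  by rewrite lt_min invr_gt0 K0 divr_gt0.
move=> y; rewrite lt_min => /andP[y1 y2].
apply/mx_norm_leP => [|j]; first by rewrite mulr_ge0 // ltW.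
rewrite 2!mxE [X in _ + X]mxE mulmx_jacobian [X in _ + X - _]mxE.
have [_ h] := KP x y j erefl y1; apply: le_trans h _.
rewrite expr2 mulrA ler_wpM2r //.
move: y2; rewrite ltr_pdivlMr // mulrC => /ltW; apply: le_trans.
by rewrite ler_wpM2r // ler_nat.
Qed.

Lemma C11_continuous (f : V -> V) (a : 'I_n -> V -> V) (x : V) :
  (forall j, C11 (fun y => f y ord0 j) (a j) x) -> {for x, continuous f}.
Proof.
by move=> hf; apply: cts_row => j; apply: cts_dist => e; exact: C11_cvg.
Qed.

Lemma C11_sum (I : finType) (f : I -> V -> R) (a : I -> V -> V) x :
  (forall i, C11 (f i) (a i) x) -> C11 (fun y => \sum_i f i y) (fun y => \sum_i a i y) x.
Proof.
move=> h.
suff : forall s : seq I, C11 (fun y => \sum_(i <- s) f i y) (fun y => \sum_(i <- s) a i y) x.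
  exact.
elim=> [|i s IH].
  by apply: eq_C11 (@C11_cst _ _ 0 x) => y; rewrite big_nil.
by apply: eq_C11 (C11D (h i) IH) => y; rewrite big_cons.
Qed.

End Derivative.

Lemma det_rank_one (F : fieldType) n (u : 'cV[F]_n) (v : 'rV[F]_n) :
  \det (1%:M + u *m v) = 1 + (v *m u) ord0 ord0.
Proof.
pose B := block_mx (1%:M : 'M[F]_1) (- v) u (1%:M : 'M[F]_n).
have E1 : B = block_mx 1%:M 0 u 1%:M *m block_mx 1%:M (- v) 0 (1%:M + u *m v).
  rewrite mulmx_block ?mul1mx ?mul0mx ?mulmx0 ?mulmx1 ?addr0.
  by rewrite mulmxN addrCA addNr addr0.
have E2 : B = block_mx (1%:M + v *m u) (- v) 0 1%:M *m block_mx 1%:M 0 u 1%:M.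
  rewrite mulmx_block ?mulmx1 ?mulmx0 ?mul0mx ?mul1mx ?add0r.
  by rewrite mulNmx addrK.
have := congr1 determinant E1; rewrite E2 !det_mulmx !det_ublock !det_lblock !det1.
by rewrite !mul1r !mulr1 => <-; rewrite det_mx11 !mxE eqxx.
Qed.

Section Euclidean.
Variable R : realType.
Local Notation V := 'rV[R]_4.

Lemma sumsq_ge0 (x : V) : 0 <= \sum_(j < 4) x ord0 j ^+ 2.
Proof. by apply: sumr_ge0 => j _; rewrite sqr_ge0. Qed.

Lemma sqr_enorm (x : V) : enorm x ^+ 2 = \sum_(j < 4) x ord0 j ^+ 2.
Proof. by rewrite sqr_sqrtr // sumsq_ge0. Qed.

Lemma enorm_ge0 (x : V) : 0 <= enorm x.
Proof. exact: sqrtr_ge0. Qed.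

Lemma norm_le_enorm (x : V) : `|x| <= enorm x.
Proof.
apply/mx_norm_leP => [|i]; first exact: enorm_ge0.
rewrite -[leLHS]sqrtr_sqr; apply: ler_wsqrtr; rewrite (bigD1 i) //=.
by rewrite lerDl; apply: sumr_ge0 => j _; rewrite sqr_ge0.
Qed.

Lemma enorm_le_norm (x : V) : enorm x <= 2 * `|x|.
Proof.
rewrite -[leRHS]ger0_norm ?mulr_ge0 // -sqrtr_sqr; apply: ler_wsqrtr.
apply: (@le_trans _ _ (\sum_(j < 4) `|x| ^+ 2)).
  apply: ler_sum => j _; rewrite -real_normK ?num_real //.
  by rewrite lerXn2r ?nnegrE // coord_le_norm.
by rewrite sumr_const card_ord exprMn -natrX mulr_natl.
Qed.

Lemma enorm_eq0 (x : V) : (enorm x == 0) = (x == 0).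
Proof.
apply/idP/idP => [/eqP x0|/eqP->].
  by rewrite -normr_eq0 eq_le normr_ge0 andbT -x0 norm_le_enorm.
by rewrite eq_le enorm_ge0 andbT; have := enorm_le_norm (0 : V); rewrite normr0 mulr0.
Qed.

Lemma enorm_gt0 (x : V) : (0 < enorm x) = (x != 0).
Proof. by rewrite lt_neqAle enorm_ge0 andbT eq_sym enorm_eq0. Qed.

Lemma enormZ c (x : V) : enorm (c *: x) = `|c| * enorm x.
Proof.
rewrite /enorm -[`|c|]sqrtr_sqr -sqrtrM ?sqr_ge0 //; congr Num.sqrt.
by rewrite mulr_sumr; apply: eq_bigr => j _; rewrite mxE exprMn.
Qed.

Lemma C11_enorm (f : V -> V) (a : 'I_4 -> V -> V) x :
  (forall j, C11 (fun y => f y ord0 j) (a j) x) -> f x != 0 ->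
  C11 (fun y => enorm (f y))
    (fun y => (enorm (f y))^-1 *: \sum_j f y ord0 j *: a j y) x.
Proof.
move=> hf fx0.
have h : C11 (fun y => \sum_(j < 4) f y ord0 j ^+ 2)
  (fun y => \sum_(j < 4) (f y ord0 j *: a j y + f y ord0 j *: a j y)) x.
  by apply: C11_sum => j; apply: eq_C11 (C11M (hf j) (hf j)).
have fx : 0 < \sum_(j < 4) f x ord0 j ^+ 2.
  by rewrite -sqr_enorm exprn_gt0 // enorm_gt0.
apply: eq_C11 (C11_sqrt h fx) => // y.
rewrite -/(enorm (f y)) -[X in _ *: X = _](_ : 2 *: \sum_j f y ord0 j *: a j y = _).
  by rewrite scalerA invfM mulrC mulrA divff ?mul1r // pnatr_eq0.
by rewrite scaler_sumr; apply: eq_bigr => j _; rewrite scaler_nat mulr2n.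
Qed.

Lemma continuous_enorm : continuous (@enorm R).
Proof.
move=> x; apply: (@cts_comp _ x _ _ (fun y : V => \sum_(j < 4) y ord0 j ^+ 2) Num.sqrt).
  have -> : (fun y : V => \sum_(j < 4) y ord0 j ^+ 2) =
    (fun y : V => y ord0 0 ^+ 2 + y ord0 1 ^+ 2 + y ord0 2 ^+ 2 + y ord0 3 ^+ 2).
    apply/funext => y; rewrite !big_ord_recl big_ord0 addr0 !addrA.
    by congr (_ + _ + _ + _); congr (y _ _ ^+ 2); apply/val_inj.
  have c i : {for x, continuous (fun y : V => y ord0 i ^+ 2)}.
    have ci : {for x, continuous (fun y : V => y ord0 i)} by apply: cts_coord; exact: cts_id.
    exact: (ctsM ci ci).
  by apply: ctsD => //; apply: ctsD => //; apply: ctsD.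
exact: sqrt_continuous.
Qed.

End Euclidean.

(** On the left is the differential of the cone: [M] on the tangent directions, and [c y] on the
    unit normal [n]. On the right appears the matrix from [sphere_det], with a rank one
    correction. *)
Lemma cone_matrix (R : realType) (M : 'M[R]_4) (n y : 'rV[R]_4) (c : R) :
  \matrix_(j, i) (M j i - (\sum_k M j k * n ord0 k) * n ord0 i +
    c * y ord0 j * n ord0 i) = M + (y^T - M *m n^T) *m n + (c - 1) *: y^T *m n.
Proof.
apply/matrixP => j i; rewrite !mxE !big_ord1 !mxE.
under [X in _ = _ + (_ - X) * _ + _]eq_bigr do rewrite mxE.
by ring.
Qed.

(** * The cone over a sphere map and its degree *)

Section LocalDegree.
Variable R : realType.
Local Notation V := 'rV[R]_4.
Variables (phi : V -> V) (a : 'I_4 -> V -> V) (p : V) (eps : R).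
Hypothesis C11_phi : forall j x, C11 (fun y => phi y ord0 j) (a j) x.
Hypothesis eps0 : 0 < eps.
Hypothesis zero_phi : forall v, enorm (v - p) <= eps -> phi v = 0 -> v = p.

Lemma enorm0 : enorm (0 : V) = 0.
Proof. by apply/eqP; rewrite enorm_eq0. Qed.

Let psi (v : V) : V := (enorm (phi v))^-1 *: phi v.
Let rad (x : V) : R := enorm (x - p).
Let dir (x : V) : V := (rad x)^-1 *: (x - p).
Let prj (x : V) : V := p + eps *: dir x.
(** Away from [p] its Euclidean norm is [rad x / eps], so for a unit vector [y] the equation
    [cone x = y] has solutions only on the sphere, where [cone] is [psi]. *)
Let cone (x : V) : V := (rad x / eps) *: psi (prj x).

Let rad_gt0 x : x != p -> 0 < rad x.
Proof. by move=> xp; rewrite enorm_gt0 subr_eq0. Qed.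

Let enorm_dir x : x != p -> enorm (dir x) = 1.
Proof.
move=> /rad_gt0 r0; rewrite enormZ gtr0_norm ?invr_gt0 // mulVf //.
by rewrite gt_eqF.
Qed.

Let rad_prj x : x != p -> rad (prj x) = eps.
Proof.
by move=> xp; rewrite /rad /prj addrAC subrr add0r enormZ gtr0_norm // enorm_dir // mulr1.
Qed.

Let phi_prj x : x != p -> phi (prj x) != 0.
Proof.
move=> xp; apply/negP => /eqP /zero_phi; rewrite -/(rad _) rad_prj // => /(_ (lexx _)) E.
have := rad_prj xp; rewrite E /rad subrr => /eqP.
by rewrite enorm0 eq_sym gt_eqF.
Qed.

Let prj_sphere x : rad x = eps -> prj x = x.
Proof. by move=> xe; rewrite /prj /dir xe scalerA divff ?gt_eqF // scale1r addrC subrK. Qed.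

Let enorm_psi z : phi z != 0 -> enorm (psi z) = 1.
Proof.
by rewrite -enorm_gt0 => z0; rewrite enormZ gtr0_norm ?invr_gt0 // mulVf // gt_eqF.
Qed.

Let enorm_cone x : x != p -> enorm (cone x) = rad x / eps.
Proof.
move=> xp; rewrite enormZ enorm_psi ?phi_prj // mulr1 gtr0_norm //.
by rewrite divr_gt0 // rad_gt0.
Qed.

Let b (j : 'I_4) (y : V) : V := (enorm (phi y))^-1 *: a j y +
  phi y ord0 j *: ((- (enorm (phi y)) ^- 2) *:
    ((enorm (phi y))^-1 *: \sum_i phi y ord0 i *: a i y)).

Let C11_psi j x : phi x != 0 -> C11 (fun y => psi y ord0 j) (b j) x.
Proof.
move=> x0; have h := C11_enorm (fun j => C11_phi j x) x0.
have x1 : enorm (phi x) != 0 by rewrite enorm_eq0.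
have := C11M (C11V h x1) (C11_phi j x); apply: eq_C11 => y; last by [].
by rewrite mxE.
Qed.

Let C11_rad x : x != p -> C11 rad dir x.
Proof.
move=> xp.
have h j : C11 (fun y : V => (y - p) ord0 j) (fun=> delta_mx ord0 j) x.
  have := C11D (C11_coord j x) (C11_cst (- p ord0 j) x).
  by apply: eq_C11 => y; rewrite ?mxE ?addr0.
have := C11_enorm h; rewrite subr_eq0 => /(_ xp); apply: eq_C11 => // y.
by congr (_ *: _); rewrite -row_sum_delta.
Qed.

Let gprj (i : 'I_4) (y : V) : V :=
  (eps / rad y) *: (delta_mx ord0 i - dir y ord0 i *: dir y).

Let C11_prj i x : x != p -> C11 (fun y => prj y ord0 i) (gprj i) x.
Proof.
move=> xp; have rx : rad x != 0 by rewrite gt_eqF // rad_gt0.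
have h := C11D (C11_coord i x) (C11_cst (- p ord0 i) x).
have := C11D (C11_cst (p ord0 i) x)
  (C11M (C11_cst eps x) (C11M (C11V (C11_rad xp) rx) h)).
apply: eq_C11 => y; first by rewrite !mxE.
apply/rowP => k; rewrite /gprj /dir !mxE -exprVn; ring.
Qed.

Let gcone (j : 'I_4) (y : V) : V :=
  (rad y / eps) *: (\sum_i b j (prj y) ord0 i *: gprj i y) +
  psi (prj y) ord0 j *: (eps^-1 *: dir y).

Let C11_cone j x : x != p -> C11 (fun y => cone y ord0 j) (gcone j) x.
Proof.
move=> xp.
have h1 := C11_comp (C11_psi j (phi_prj xp)) (fun i => C11_prj i xp).
have := C11M (C11M (C11_rad xp) (C11_cst eps^-1 x)) h1.
apply: eq_C11 => y; first by rewrite !mxE.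
by apply/rowP => k; rewrite !mxE; ring.
Qed.

Let jac4_psi x : phi x != 0 -> jac4 psi x = (jacobian b x)^T.
Proof.
move=> x0; apply/matrixP => i j; rewrite !mxE.
rewrite (C11_derive _ (fun k => C11_psi k x0)) mulmx_jacobian.
by rewrite /dot (bigD1 j) //= big1 ?addr0 => [|k kj]; rewrite !mxE ?eqxx ?mulr1 //
  (negPf kj) andbF mulr0.
Qed.

(** By homogeneity the differential at [x] is the one at [prj x]. It differs from the matrix of
    [sphere_det] only in the normal direction, which is multiplied by [eps^-1]; hence the signs
    agree. *)
Let det_cone x : x != p ->
  \det (jacobian gcone x) = eps^-1 * sphere_det psi p eps (prj x).
Proof.
move=> xp; have rx : rad x != 0 by rewrite gt_eqF // rad_gt0.
have nE : eps^-1 *: (prj x - p) = dir x.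
  by rewrite /prj addrAC subrr add0r scalerA mulVf ?scale1r // gt_eqF.
rewrite /sphere_det nE jac4_psi ?phi_prj //.
set n := dir x; set M := (jacobian b (prj x))^T; set y := psi (prj x).
have nn : n *m n^T = 1%:M.
  rewrite [LHS]mx11_scalar; congr (_%:M); rewrite mxE.
  have := enorm_dir xp => /(congr1 (fun z => z ^+ 2)); rewrite sqr_enorm expr1n => <-.
  by apply: eq_bigr => j _; rewrite [n^T _ _]mxE expr2.
set S := M + _.
have Sn : S *m n^T = y^T.
  by rewrite mulmxDl -mulmxA nn mulmx1 addrC subrK.
have det1n : \det (1%:M + ((eps^-1 - 1) *: n^T) *m n) = eps^-1.
  by rewrite det_rank_one -scalemxAr nn !mxE eqxx mulr1n mulr1 addrC subrK.
rewrite -{1}det1n mulrC -det_mulmx -[LHS]det_tr; congr (\det _).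
rewrite mulmxDr mulmx1 mulmxA -(scalemxAr _ S) Sn /S -cone_matrix.
apply/matrixP => j i; rewrite [LHS]mxE [LHS]mxE [RHS]mxE.
have Mk k : M j k = b j (prj x) ord0 k by rewrite [LHS]mxE mxE.
have E k : (b j (prj x) ord0 k *: gprj k x) ord0 i = eps / rad x *
    (M j k * (k == i)%:R - M j k * n ord0 k * n ord0 i).
  have gE (v : V) (c : R) :
      (c *: (delta_mx ord0 k - v ord0 k *: v)) ord0 i =
      c * ((k == i)%:R - v ord0 k * v ord0 i) by rewrite !mxE eqxx /= eq_sym.
  by rewrite [LHS]mxE Mk /gprj gE -/n mulrCA mulrBr mulrA.
rewrite /gcone [LHS]mxE [X in X + _]mxE summxE; under eq_bigr do rewrite E.
rewrite -mulr_sumr sumrB (bigD1 i) //= [X in _ + X - _]big1 ?addr0; last first.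
  by move=> k /negPf ->; rewrite mulr0.
rewrite eqxx mulr1 -mulr_suml mulrA.
have -> : rad x / eps * (eps / rad x) = 1 by field; rewrite rx gt_eqF.
rewrite mul1r; congr (_ + _).
by rewrite [LHS]mxE [X in _ * X = _]mxE mulrCA mulrA.
Qed.

Let continuous_cone : continuous cone.
Proof.
move=> x; have [->|xp] := eqVneq x p; last first.
  by apply: (C11_continuous (a := gcone)) => j; exact: C11_cone.
apply: cts_dist => e e0; exists (e * eps / 2); first by rewrite !mulr_gt0 ?invr_gt0.
move=> y yp.
have -> : cone p = 0.
  by rewrite /cone /rad subrr enorm0 mul0r scale0r.
rewrite subr0; have [->|ynp] := eqVneq y p.
  by rewrite /cone /rad subrr enorm0 mul0r scale0r normr0.
apply: le_lt_trans (norm_le_enorm _) _; rewrite enorm_cone // ltr_pdivrMr //.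
apply: le_lt_trans (enorm_le_norm _) _.
by move: yp; rewrite ltr_pdivlMr // mulrC.
Qed.

(** Sard is applied to the cone on a shell that avoids the apex, near a basis vector; by homogeneity
    the regular value [z] can be scaled to a unit vector. A distance below 1/4 in the maximum norm
    puts [enorm z] between 3/4 and 5/2, so its preimages lie in the shell between [eps / 2] and
    [3 * eps]. *)
Let regular_value : exists2 y : V, enorm y = 1 &
  forall x, on_sphere p eps x -> psi x = y -> sphere_det psi p eps x != 0.
Proof.
pose X : set V := [set x | eps / 2 <= rad x <= 3 * eps].
have Xp x : X x -> x != p.
  move=> /andP[h _]; apply/negP => /eqP xp; move: h; rewrite /rad xp subrr.
  by rewrite enorm0 leNgt divr_gt0.
have crad : continuous rad.
  move=> x; apply: (@cts_comp _ x _ _ (fun y => y - p) (@enorm R)).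
    by apply: ctsB; [exact: cts_id|exact: cts_cst].
  exact: continuous_enorm.
have cX : compact X.
  apply: bounded_closed_compact.
    apply: (@bounded_subset_box _ _ _ (`|p| + 3 * eps)) => x /andP[_ h].
    rewrite /box /= -(subrK p x) addrC; apply: le_trans (ler_normD _ _) _.
    by rewrite lerD2l; apply: le_trans (norm_le_enorm _) h.
  have -> : X = (rad @^-1` [set r | eps / 2 <= r]) `&` (rad @^-1` [set r | r <= 3 * eps]).
    by apply/seteqP; split=> x /= => [/andP[]|[h1 h2]] //; apply/andP.
  apply: closedI.
    by apply: (closed_comp _ (@closed_ge _ (eps / 2))) => x _; exact: crad.
  by apply: (closed_comp _ (@closed_le _ (3 * eps))) => x _; exact: crad.
have q0 : 0 < 4^-1 :> R by rewrite invr_gt0.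
have [z zc zX] := sard (delta_mx ord0 0) cX (fun x Xx j => C11_cone j (Xp x Xx)) q0.
pose s := enorm z.
have z34 : 3 / 4 <= s.
  apply: le_trans (norm_le_enorm _); apply: le_trans (coord_le_norm _ 0).
  have h : `|z ord0 0 - 1| < 4^-1.
    by apply: le_lt_trans zc; have := coord_le_norm (z - delta_mx ord0 0) 0; rewrite !mxE.
  by have := ler_norm (z ord0 0); move: h; rewrite ltr_norml; lra.
have z52 : s <= 5 / 2.
  apply: le_trans (enorm_le_norm _) _.
  have d1 : `|delta_mx ord0 0 : V| <= 1.
    apply/mx_norm_leP => // i; rewrite mxE normr_nat; by case: (_ && _).
  have := ler_normD (z - delta_mx ord0 0) (delta_mx ord0 0); rewrite subrK.
  by move: zc d1; lra.
have s0 : 0 < s by lra.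
exists (s^-1 *: z); first by rewrite enormZ gtr0_norm ?invr_gt0 // mulVf // gt_eqF.
move=> x; rewrite /on_sphere -/(rad x) => xe xy.
pose x' := p + s *: (x - p).
have x'p : x' - p = s *: (x - p) by rewrite /x' addrAC subrr add0r.
have rx' : rad x' = s * eps by rewrite /rad x'p enormZ gtr0_norm // -/(rad x) xe.
have Xx' : X x' by rewrite /X /= rx' ler_pM2r // [eps / 2]mulrC ler_pM2r //; lra.
have prx' : prj x' = x.
  rewrite /prj /dir rx' x'p !scalerA.
  have -> : eps * (s * eps)^-1 * s = 1 by field; rewrite !gt_eqF.
  by rewrite scale1r addrC subrK.
have cx' : cone x' = z.
  rewrite /cone prx' rx' xy mulfK ?gt_eqF // scalerA divff ?gt_eqF //.
  by rewrite scale1r.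
have := zX x' Xx' cx'.
by rewrite det_cone ?Xp // prx' mulf_eq0 negb_or => /andP[].
Qed.

(** At a regular value [y] the degree of [cone - y] is the signed count on the sphere. On the
    boundary of the cube the cone has norm above 1, so [y] can be moved to 0; there the map [phi]
    after the retraction is a positive multiple of the cone. *)
Lemma local_degree (d : int) (M : nat) :
  sphere_map_degree psi p eps d -> `|p| + eps < M%:R ->
  has_degree M (fun x => phi (retraction (@enorm R) p eps x)) d.
Proof.
move=> hd pM; have M0 : (0 < M)%N.
  by rewrite -(ltr_nat R); apply: le_lt_trans pM; rewrite addr_ge0 // ltW.
have [y y1 yreg] := regular_value.
have [s [us sP sd]] := hd y y1 yreg.
have far x : `|x| = M%:R -> eps < rad x.
  move=> xM; rewrite ltNge; apply/negP => h.
  have : `|x| <= `|p| + eps.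
    rewrite -(subrK p x) addrC; apply: le_trans (ler_normD _ _) _.
    by rewrite lerD2l; apply: le_trans (norm_le_enorm _) h.
  by rewrite xM leNgt pM.
have far_p x : `|x| = M%:R -> x != p.
  move=> /far; apply: contraTneq => ->; rewrite /rad subrr.
  by rewrite enorm0 -leNgt ltW.
have csub : continuous (fun x => cone x - y).
  by move=> x; apply: ctsB; [exact: continuous_cone|exact: cts_cst].
have h1 : has_degree M (fun x => cone x - y) d.
  have -> : d = \sum_(x <- s) sgz (\det (jacobian gcone x)).
    rewrite -sd; apply: eq_big_seq => x; rewrite -sP => -[xe xy].
    have xp : x != p.
      apply/negP => /eqP xp; move: xe; rewrite /on_sphere xp subrr => /eqP.
      by rewrite enorm0 eq_sym gt_eqF.
    rewrite det_cone // prj_sphere // sgzM (gtr0_sgz (_ : 0 < eps^-1)) ?invr_gt0 //.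
    rewrite mul1r; have := yreg x xe xy.
    by case: ltgtP => // h _; rewrite ?(gtr0_sgz h) ?(ltr0_sgz h).
  apply: has_degree_regular => //.
    move=> x _ /eqP; rewrite subr_eq0 => /eqP xy; apply/sP.
    have xp : x != p.
      apply/negP => /eqP xp; move: xy y1; rewrite xp /cone /rad subrr.
      rewrite enorm0 mul0r scale0r => <-.
      by move=> /eqP; rewrite enorm0 eq_sym oner_eq0.
    have xe : rad x = eps.
      have := enorm_cone xp; rewrite xy y1 => E.
      by rewrite -[rad x](divfK (lt0r_neq0 eps0)) -E mul1r.
    split => //; move: xy; rewrite /cone xe divff ?gt_eqF // scale1r.
    by rewrite prj_sphere.
  move=> x; rewrite -sP => -[xe xy].
  have xp : x != p.
    apply/negP => /eqP xp; move: xe; rewrite /on_sphere xp subrr => /eqP.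
    by rewrite enorm0 eq_sym gt_eqF.
  have xr : rad x = eps by [].
  split.
  - apply: le_lt_trans pM; rewrite -{1}(subrK p x) addrC.
    apply: le_trans (ler_normD _ _) _; rewrite lerD2l -xe; exact: norm_le_enorm.
  - by rewrite /cone xr divff ?gt_eqF // scale1r prj_sphere // xy subrr.
  - rewrite det_cone // prj_sphere // mulf_neq0 //; last exact: yreg.
    by rewrite invr_eq0 lt0r_neq0.
  - move=> e e0; have [r r0 rP] := C11_differentiable_with (fun j => C11_cone j xp) e0.
    exists r => // z zr; have := rP z zr.
    by rewrite [in X in _ -> X]opprB addrA subrK.
have h2 : has_degree M cone d.
  apply: (has_degree_homotopy csub continuous_cone _ h1).
  move=> x t xM /andP[t0 t1]; apply/negP => /eqP E.
  have {}E : cone x = (1 - t) *: y.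
    apply/eqP; rewrite -subr_eq0 -E; apply/eqP; rewrite scalerBr addrAC.
    by rewrite -scalerDl subrK scale1r.
  have := enorm_cone (far_p x xM); rewrite E enormZ y1 mulr1 ger0_norm ?subr_ge0 // => E2.
  have : 1 < rad x / eps by rewrite ltr_pdivlMr // mul1r far.
  by rewrite -E2; lra.
apply: (has_degree_homotopy continuous_cone _ _ h2).
  have cr := @continuous_retraction _ _ (@enorm R) p eps eps0 (@continuous_enorm R).
  move=> x; apply: (cts_comp (cr x)).
  by apply: (C11_continuous (a := a)) => j.
move=> x t xM /andP[t0 t1]; have xp := far_p x xM.
have rE : retraction (@enorm R) p eps x = prj x.
  rewrite /retraction max_r; last by rewrite -/(rad x) ltW // far.
  by rewrite /prj /dir scalerA.
have pE : phi (prj x) = enorm (phi (prj x)) *: psi (prj x).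
  by rewrite scalerA divff ?scale1r // enorm_eq0 phi_prj.
rewrite rE pE /cone scalerA scalerA -scalerDl scaler_eq0 negb_or.
apply/andP; split; last by rewrite -enorm_gt0 enorm_psi ?phi_prj.
have u0 : 0 < rad x / eps by rewrite divr_gt0 // rad_gt0.
have v0 : 0 < enorm (phi (prj x)) by rewrite enorm_gt0 phi_prj.
apply: lt0r_neq0; have [->|tn] := eqVneq t 0; first by rewrite subr0 mul1r mul0r addr0.
have tp : 0 < t by rewrite lt_neqAle eq_sym tn.
apply: ltr_wpDl; last exact: mulr_gt0.
by apply: mulr_ge0; [rewrite subr_ge0|exact: ltW].
Qed.

End LocalDegree.

(** * Mixed polynomials *)

Local Open Scope complex_scope.

Section ComplexParts.
Variable R : realType.
Local Notation C := (R[i]).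
Local Notation Re := (@complex.Re R).
Local Notation Im := (@complex.Im R).

Lemma Re_add (x y : C) : Re (x + y) = Re x + Re y. Proof. by case: x; case: y. Qed.
Lemma Im_add (x y : C) : Im (x + y) = Im x + Im y. Proof. by case: x; case: y. Qed.
Lemma Re_mul (x y : C) : Re (x * y) = Re x * Re y - Im x * Im y.
Proof. by case: x; case: y. Qed.
Lemma Im_mul (x y : C) : Im (x * y) = Re x * Im y + Im x * Re y.
Proof. by case: x => a b; case: y => c d. Qed.

Lemma eq_complexP (x y : C) : x = y <-> Re x = Re y /\ Im x = Im y.
Proof. by split=> [->//|]; case: x => a b; case: y => c d /= [-> ->]. Qed.

End ComplexParts.

Section FunctionAlgebra.
Variables (R : realType) (T : Type) (P : (T -> R) -> Prop).
Local Notation C := (R[i]).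
Hypothesis Pcst : forall c, P (fun=> c).
Hypothesis PD : forall f g, P f -> P g -> P (fun x => f x + g x).
Hypothesis PM : forall f g, P f -> P g -> P (fun x => f x * g x).

(** Used with two classes [P]: the C^{1,1} functions on [V], and the continuous functions on
    [R * V], where [X0] is a further real variable. *)
Definition on_parts (z : T -> C) :=
  P (fun x => complex.Re (z x)) /\ P (fun x => complex.Im (z x)).

Lemma on_parts_cst c : on_parts (fun=> c).
Proof. by split; exact: Pcst. Qed.

Lemma on_partsD z w : on_parts z -> on_parts w -> on_parts (fun x => z x + w x).
Proof.
move=> [z1 z2] [w1 w2]; split.
  by rewrite (_ : (fun x => _) = (fun x => complex.Re (z x) + complex.Re (w x)));
    [exact: PD|apply/funext => x; rewrite Re_add].
by rewrite (_ : (fun x => _) = (fun x => complex.Im (z x) + complex.Im (w x)));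
    [exact: PD|apply/funext => x; rewrite Im_add].
Qed.

Lemma on_partsM z w : on_parts z -> on_parts w -> on_parts (fun x => z x * w x).
Proof.
move=> [z1 z2] [w1 w2]; split.
  rewrite (_ : (fun x => _) = (fun x => complex.Re (z x) * complex.Re (w x) +
    (-1) * (complex.Im (z x) * complex.Im (w x)))); last first.
    by apply/funext => x; rewrite Re_mul mulN1r.
  by apply: PD; [exact: PM|apply: PM; [exact: Pcst|exact: PM]].
rewrite (_ : (fun x => _) = (fun x => complex.Re (z x) * complex.Im (w x) +
    complex.Im (z x) * complex.Re (w x))); last first.
  by apply/funext => x; rewrite Im_mul.
by apply: PD; exact: PM.
Qed.

Lemma on_parts_conj z : on_parts z -> on_parts (fun x => conjc (z x)).
Proof.
move=> [z1 z2]; split.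
  by rewrite (_ : (fun x => _) = (fun x => complex.Re (z x)));
    [|apply/funext => x; case: (z x)].
rewrite (_ : (fun x => _) = (fun x => (-1) * complex.Im (z x))); last first.
  by apply/funext => x; case: (z x) => a b; rewrite mulN1r.
by apply: PM; [exact: Pcst|].
Qed.

Lemma on_partsX z k : on_parts z -> on_parts (fun x => z x ^+ k).
Proof.
move=> hz; elim: k => [|k IH]; first by apply: on_parts_cst.
by rewrite (_ : (fun x => _) = (fun x => z x * z x ^+ k));
  [exact: on_partsM|apply/funext => x; rewrite exprS].
Qed.

Lemma on_parts_mp_eval F (x0 x1 x2 : T -> C) :
  on_parts x0 -> on_parts x1 -> on_parts x2 ->
  on_parts (fun x => mp_eval F (x0 x) (x1 x) (x2 x)).
Proof.
move=> h0 h1 h2; rewrite /mp_eval; elim: (undup _) => [|k s IH].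
  by rewrite (_ : (fun x => _) = (fun=> 0));
    [exact: on_parts_cst|apply/funext => x; rewrite big_nil].
rewrite (_ : (fun x => _) = (fun x => mp_coef F k * x0 x ^+ k.1.1.1 * x1 x ^+ k.1.1.2
   * x2 x ^+ k.1.2 * (conjc (x0 x)) ^+ k.2.1.1 * (conjc (x1 x)) ^+ k.2.1.2
   * (conjc (x2 x)) ^+ k.2.2 + \sum_(m <- s) mp_coef F m
     * x0 x ^+ m.1.1.1 * x1 x ^+ m.1.1.2 * x2 x ^+ m.1.2
     * (conjc (x0 x)) ^+ m.2.1.1 * (conjc (x1 x)) ^+ m.2.1.2 * (conjc (x2 x)) ^+ m.2.2));
  last by apply/funext => x; rewrite big_cons.
apply: on_partsD => //; do 6?[apply: on_partsM => //]; try exact: on_parts_cst.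
all: apply: on_partsX => //; exact: on_parts_conj.
Qed.

End FunctionAlgebra.

Section Vec.
Variable R : realType.
Local Notation C := (R[i]).
Local Notation V := 'rV[R]_4.

Definition vec (f g : C) : V := \row_(j < 4)
    (if j == 0 :> nat then complex.Re f else if j == 1 :> nat then complex.Im f
     else if j == 2 :> nat then complex.Re g else complex.Im g).

Lemma vecK1 f g : z1_of (vec f g) = f.
Proof. by rewrite /z1_of !mxE; case: f. Qed.
Lemma vecK2 f g : z2_of (vec f g) = g.
Proof. by rewrite /z2_of !mxE; case: g. Qed.

Lemma vecE v : vec (z1_of v) (z2_of v) = v.
Proof.
apply/rowP => j; rewrite mxE.
by case: j => -[|[|[|[|//]]]] ij /=; congr (v _ _); apply/val_inj.
Qed.

Lemma vec0 : vec 0 0 = 0.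
Proof. by apply/rowP => j; rewrite !mxE; do 3?case: ifP. Qed.

Lemma vec_eq0 f g : vec f g = 0 <-> f = 0 /\ g = 0.
Proof.
split=> [h|[-> ->]]; last exact: vec0.
have h1 := congr1 (@z1_of R) h; have h2 := congr1 (@z2_of R) h.
by move: h1 h2; rewrite -vec0 !vecK1 !vecK2.
Qed.

Lemma vec_lin (s t : R) f g f' g' :
  s *: vec f g + t *: vec f' g' = vec (s%:C * f + t%:C * f') (s%:C * g + t%:C * g').
Proof.
apply/rowP => j; rewrite !mxE !Re_add !Im_add !Re_mul !Im_mul /= !mul0r !subr0 !addr0.
by do 3?case: ifP.
Qed.

Definition smooth (f : V -> R) := exists a, forall x, C11 f a x.

Lemma smooth_cst c : smooth (fun=> c).
Proof. by exists (fun=> 0) => x; exact: C11_cst. Qed.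
Lemma smoothD f g : smooth f -> smooth g -> smooth (fun x => f x + g x).
Proof. by move=> [a fa] [b gb]; eexists => x; exact: C11D. Qed.
Lemma smoothM f g : smooth f -> smooth g -> smooth (fun x => f x * g x).
Proof. by move=> [a fa] [b gb]; eexists => x; exact: C11M. Qed.

Local Notation csmooth := (on_parts smooth).

Lemma csmooth_cst c : csmooth (fun=> c).
Proof. exact: (on_parts_cst smooth_cst). Qed.
Lemma csmooth_z1 : csmooth (@z1_of R).
Proof. by split; eexists => x; exact: C11_coord. Qed.
Lemma csmooth_z2 : csmooth (@z2_of R).
Proof. by split; eexists => x; exact: C11_coord. Qed.

Lemma csmooth_mp_eval F (x0 x1 x2 : V -> C) :
  csmooth x0 -> csmooth x1 -> csmooth x2 ->
  csmooth (fun x => mp_eval F (x0 x) (x1 x) (x2 x)).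
Proof. exact: (on_parts_mp_eval smooth_cst smoothD smoothM). Qed.

Lemma C11_vec (f g : V -> C) : csmooth f -> csmooth g ->
  exists a : 'I_4 -> V -> V, forall j x, C11 (fun y => vec (f y) (g y) ord0 j) (a j) x.
Proof.
move=> [[a fa] [b fb]] [[c gc] [d gd]].
exists (fun j => if j == 0 :> nat then a else if j == 1 :> nat then b
     else if j == 2 :> nat then c else d) => j x.
rewrite (_ : (fun y => _) = (fun y => if j == 0 :> nat then complex.Re (f y)
    else if j == 1 :> nat then complex.Im (f y)
     else if j == 2 :> nat then complex.Re (g y) else complex.Im (g y))); last first.
  by apply/funext => y; rewrite mxE.
by do 3?case: ifP.
Qed.

Lemma continuous_vec (f g : V -> C) : csmooth f -> csmooth g ->
  continuous (fun x => vec (f x) (g x)).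
Proof. by move=> hf hg x; have [a ha] := C11_vec hf hg; exact: C11_continuous. Qed.

Lemma vec_homotopy (M : nat) (f g f' g' : V -> C) d :
  csmooth f -> csmooth g -> csmooth f' -> csmooth g' ->
  (forall x (t : R), `|x| = M%:R -> 0 <= t <= 1 ->
     (1 - t)%:C * f x + t%:C * f' x = 0 -> (1 - t)%:C * g x + t%:C * g' x = 0 -> False) ->
  has_degree M (fun x => vec (f x) (g x)) d ->
  has_degree M (fun x => vec (f' x) (g' x)) d.
Proof.
move=> hf hg hf' hg' nz; apply: has_degree_homotopy; try exact: continuous_vec.
move=> x t xM t01; rewrite vec_lin; apply/negP => /eqP/vec_eq0[h1 h2].
exact: nz h1 h2.
Qed.

End Vec.

Section Homogeneity.
Variable R : realType.
Local Notation C := (R[i]).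

(** The radial and polar degrees together determine the holomorphic degree [p] and the
    antiholomorphic degree [q] of every monomial. For the zero polynomial any [p], [q] with the
    right difference will do. *)
Lemma polar_homogeneity (F : mixed_poly R) dr d : strongly_polar_homogeneous F dr d ->
  exists p q : nat, p%:Z - q%:Z = d /\ forall l x0 x1 x2 : C,
    mp_eval F (l * x0) (l * x1) (l * x2) = l ^+ p * conjc l ^+ q * mp_eval F x0 x1 x2.
Proof.
move=> hF.
have [[k kF]|none] := pselect (exists k, mp_coef F k != 0); last first.
  have z x0 x1 x2 : mp_eval F x0 x1 x2 = 0.
    rewrite /mp_eval big1 // => k _.
    have [->|kF] := eqVneq (mp_coef F k) 0; first by rewrite !mul0r.
    by case: none; exists k.
  case: d hF => n _; [exists n, 0%N|exists 0%N, n.+1]; split.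
  - by rewrite subr0.
  - by move=> *; rewrite !z mulr0.
  - by rewrite sub0r NegzE.
  - by move=> *; rewrite !z mulr0.
have [k1 k2] := hF k kF.
exists (nu_deg k), (mu_deg k); split => // l x0 x1 x2.
rewrite /mp_eval mulr_sumr; apply: eq_bigr => j _.
have [->|jF] := eqVneq (mp_coef F j) 0; first by rewrite !mul0r mulr0.
have [j1 j2] := hF j jF.
have -> : nu_deg k = nu_deg j by lia.
have -> : mu_deg k = mu_deg j by lia.
rewrite !rmorphM /= !exprMn /nu_deg /mu_deg !exprD.
by ring.
Qed.

End Homogeneity.

Section MixedPower.
Variable R : realType.
Local Notation C := (R[i]).

Definition mpow (p q : nat) (z : C) : C := z ^+ p * conjc z ^+ q.

Lemma mpowM p q z w : mpow p q (z * w) = mpow p q z * mpow p q w.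
Proof. by rewrite /mpow rmorphM !exprMn; ring. Qed.

Lemma mpow_eq0 p q z : mpow p q z = 0 -> z = 0.
Proof.
move=> /eqP; rewrite /mpow mulf_eq0 !expf_eq0 => /orP[] /andP[_ /eqP] //.
by move/eqP; rewrite conjc_eq0 => /eqP.
Qed.

End MixedPower.

(** * Reduction to the leading part on a large sphere *)

Section AtInfinity.
Variables (R : realType) (F G : mixed_poly R) (p q p' q' : nat).
Local Notation C := (R[i]).
Local Notation V := 'rV[R]_4.
Hypothesis homF : forall l x0 x1 x2 : C,
  mp_eval F (l * x0) (l * x1) (l * x2) = mpow p q l * mp_eval F x0 x1 x2.
Hypothesis homG : forall l x0 x1 x2 : C,
  mp_eval G (l * x0) (l * x1) (l * x2) = mpow p' q' l * mp_eval G x0 x1 x2.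
Hypothesis no_zero : forall x1 x2 : C, (x1, x2) != (0, 0) ->
  ~ (mp_eval F 0 x1 x2 = 0 /\ mp_eval G 0 x1 x2 = 0).

Let f0 := mp_eval F 0.
Let g0 := mp_eval G 0.

Let no_zero_v (v : V) : v != 0 -> f0 (z1_of v) (z2_of v) = 0 ->
  g0 (z1_of v) (z2_of v) = 0 -> False.
Proof.
move=> v0 fz gz; apply: (no_zero (x1 := z1_of v) (x2 := z2_of v)); last by [].
apply: contraNneq v0 => E; rewrite -(vecE v).
by rewrite (congr1 fst E : z1_of v = 0) (congr1 snd E : z2_of v = 0) vec0.
Qed.

Let H (e : R * V) : V := vec (mp_eval F e.1%:C (z1_of e.2) (z2_of e.2))
                             (mp_eval G e.1%:C (z1_of e.2) (z2_of e.2)).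

Let continuous_H : continuous H.
Proof.
pose P := fun h : R * V -> R => continuous h.
have Pcst c : P (fun=> c) by move=> x; exact: cts_cst.
have PD f g : P f -> P g -> P (fun x => f x + g x) by move=> cf cg x; apply: ctsD; [exact: cf|exact: cg].
have PM f g : P f -> P g -> P (fun x => f x * g x) by move=> cf cg x; apply: ctsM; [exact: cf|exact: cg].
have c1 : on_parts P (fun e : R * V => e.1%:C).
  by split; [move=> x; exact: cvg_fst|exact: Pcst].
have cc i : P (fun e : R * V => e.2 ord0 i).
  by move=> x; apply: (@cts_coord R _ x 4 (fun e : R * V => e.2)); exact: cvg_snd.
have c2 : on_parts P (fun e : R * V => z1_of e.2) by split; exact: cc.
have c3 : on_parts P (fun e : R * V => z2_of e.2) by split; exact: cc.
have [hF1 hF2] := on_parts_mp_eval Pcst PD PM F c1 c2 c3.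
have [hG1 hG2] := on_parts_mp_eval Pcst PD PM G c1 c2 c3.
move=> x; apply: cts_row => i.
rewrite (_ : (fun y => _) = (fun e => if i == 0 :> nat then
    complex.Re (mp_eval F e.1%:C (z1_of e.2) (z2_of e.2))
  else if i == 1 :> nat then complex.Im (mp_eval F e.1%:C (z1_of e.2) (z2_of e.2))
  else if i == 2 :> nat then complex.Re (mp_eval G e.1%:C (z1_of e.2) (z2_of e.2))
  else complex.Im (mp_eval G e.1%:C (z1_of e.2) (z2_of e.2)))); last first.
  by apply/funext => e; rewrite mxE.
case: (nat_of_ord i == 0%N); first exact: hF1.
case: (nat_of_ord i == 1%N); first exact: hF2.
by case: (nat_of_ord i == 2%N); [exact: hG1|exact: hG2].
Qed.

(** Write [x = N.+1 u] with [u] on the unit sphere. By homogeneity each equation is, up to its own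
    nonzero factor, the same equation at [u] with [X0 = 1/N.+1] in place of 1. For large [N] this is
    uniformly close to the value at [X0 = 0], which is bounded away from 0. *)
Lemma homotopy_at_infinity : \forall N \near \oo, forall (x : V) (t : R),
  `|x| = N.+1%:R -> 0 <= t <= 1 ->
  (1 - t)%:C * mp_eval F 1 (z1_of x) (z2_of x) + t%:C * f0 (z1_of x) (z2_of x) = 0 ->
  (1 - t)%:C * mp_eval G 1 (z1_of x) (z2_of x) + t%:C * g0 (z1_of x) (z2_of x) = 0 ->
  False.
Proof.
have cH0 : continuous (fun u : V => H (0, u)).
  have hF := csmooth_mp_eval F (csmooth_cst 0%:C) (@csmooth_z1 R) (@csmooth_z2 R).
  have hG := csmooth_mp_eval G (csmooth_cst 0%:C) (@csmooth_z1 R) (@csmooth_z2 R).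
  exact: (continuous_vec hF hG).
have [e e0 eP] : exists2 e, 0 < e & forall u, sphere 1 u -> e <= `|H (0, u)|.
  apply: compact_lbound; first exact: compact_sphere.
    exact: continuous_norm_comp cH0.
  move=> u u1; rewrite normr_gt0; apply/negP => /eqP/vec_eq0[h1 h2].
  apply: (@no_zero_v u) => //; rewrite -normr_eq0; apply/negP => /eqP E.
  by move: u1; rewrite /sphere /= E => /eqP; rewrite eq_sym oner_eq0.
have e20 : 0 < e / 2 by rewrite divr_gt0.
have near0 : \forall N \near \oo,
    sphere 1 `<=` (fun u : V => `|H (N.+1%:R^-1, u) - H (0, u)| < e).
  have := @compact_sphere R 4 1 => /compact_near_coveringP; apply => u0 _.
  have := @continuous_H (0, u0) => /cvgr_dist_lt/(_ _ e20)[[A B] /= [nA nB] AB].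
  have [d d0 dA] : exists2 d, 0 < d & forall s : R, `|s| < d -> A s.
    move: nA => /nbhs_normP[d /= d0 dA]; exists d => // s sd.
    by apply: dA; rewrite /ball_ /= sub0r normrN.
  exists (B, [set N | N.+1%:R^-1 < d]) => /=; first by split; [|exact: near_inv_lt].
  move=> [u N] [/= Bu Nd].
  have A0 : A 0 by apply: dA; rewrite normr0.
  have AN : A N.+1%:R^-1 by apply: dA; rewrite ger0_norm.
  have h1 : `|H (0, u0) - H (0, u)| < e / 2 by exact: (AB (0, u)).
  have h2 : `|H (0, u0) - H (N.+1%:R^-1, u)| < e / 2 by exact: (AB (N.+1%:R^-1, u)).
  apply: le_lt_trans (ler_distD (H (0, u0)) _ _) _; rewrite (splitr e).
  by apply: ltrD; [rewrite distrC; exact: h2|exact: h1].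
near=> N => x t xN /andP[t0 t1] hf hg.
have hN : sphere 1 `<=` (fun u : V => `|H (N.+1%:R^-1, u) - H (0, u)| < e).
  by near: N; exact: near0.
have N0 : 0 < N.+1%:R :> R by rewrite ltr0n.
have Nn : N.+1%:R != 0 :> R by rewrite pnatr_eq0.
pose u := N.+1%:R^-1 *: x.
have u1 : sphere 1 u.
  by rewrite /sphere /= normrZ xN ger0_norm ?invr_ge0 // mulVf.
have xE : x = N.+1%:R *: u by rewrite scalerA divff ?scale1r.
have z1E : z1_of x = N.+1%:R%:C * z1_of u.
  by apply/eq_complexP; rewrite Re_mul Im_mul xE /z1_of !mxE /= !mul0r subr0 addr0.
have z2E : z2_of x = N.+1%:R%:C * z2_of u.
  by apply/eq_complexP; rewrite Re_mul Im_mul xE /z2_of !mxE /= !mul0r subr0 addr0.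
have oneE : 1 = N.+1%:R%:C * (N.+1%:R^-1)%:C :> C by rewrite -rmorphM /= divff.
have lz : N.+1%:R%:C != 0 :> C by apply/negP => /eqP/eq_complexP[/= /eqP]; rewrite (negPf Nn).
have key (Q : mixed_poly R) a b : (forall l x0 x1 x2 : C,
    mp_eval Q (l * x0) (l * x1) (l * x2) = mpow a b l * mp_eval Q x0 x1 x2) ->
  (1 - t)%:C * mp_eval Q 1 (z1_of x) (z2_of x) + t%:C * mp_eval Q 0 (z1_of x) (z2_of x) = 0 ->
  (1 - t)%:C * mp_eval Q (N.+1%:R^-1)%:C (z1_of u) (z2_of u) +
    t%:C * mp_eval Q 0 (z1_of u) (z2_of u) = 0.
  move=> homQ.
  have -> : mp_eval Q 0 (z1_of x) (z2_of x) =
      mpow a b N.+1%:R%:C * mp_eval Q 0 (z1_of u) (z2_of u).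
    by rewrite z1E z2E -homQ mulr0.
  have -> : mp_eval Q 1 (z1_of x) (z2_of x) =
      mpow a b N.+1%:R%:C * mp_eval Q (N.+1%:R^-1)%:C (z1_of u) (z2_of u).
    by rewrite z1E z2E -homQ -oneE.
  rewrite !(mulrCA _ (mpow _ _ _)) -mulrDr => /eqP; rewrite mulf_eq0 => /orP[|/eqP//].
  by move=> /eqP/mpow_eq0 lE; case/eqP: lz.
have E : (1 - t) *: H (N.+1%:R^-1, u) + t *: H (0, u) = 0.
  by rewrite vec_lin; apply/vec_eq0; split; [exact: key homF _|exact: key homG _].
have E2 : H (0, u) = (1 - t) *: (H (0, u) - H (N.+1%:R^-1, u)).
  have gen (v w : V) : (1 - t) *: v + t *: w = 0 -> w = (1 - t) *: (w - v).
    move=> h; apply/rowP => i; have := congr1 (fun v : V => v ord0 i) h; rewrite !mxE => h'.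
    by apply/eqP; rewrite -subr_eq0; apply/eqP; rewrite -h'; ring.
  exact: gen E.
have gen (v w : V) : v = (1 - t) *: (v - w) -> `|v| <= `|w - v|.
  move=> {1}->; rewrite normrZ ger0_norm ?subr_ge0 // distrC.
  by rewrite ler_piMl // lerBlDr lerDl.
by have := le_lt_trans (le_trans (eP u u1) (gen _ _ E2)) (hN u u1); rewrite ltxx.
Unshelve. all: by end_near. Qed.

End AtInfinity.

(** * Generic coefficients and deformation to monomials *)

Section Generic.
Variable R : realType.
Local Notation C := (R[i]).
Local Notation V := 'rV[R]_4.

(** The last basis vector lies in the kernel of every differential, so all values are critical. Sard
    on compact cubes shows that each image of a cube has a dense open complement, and Baire handles
    all cubes at once. *)
Lemma cylinder_image (L : V -> V) (a : 'I_4 -> V -> V) :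
  (forall j x, C11 (fun y => L y ord0 j) (a j) x) ->
  (forall x t, L (x + t *: delta_mx ord0 3) = L x) ->
  forall c r, 0 < r -> exists2 y, `|y - c| < r & forall x, L x <> y.
Proof.
move=> ha cyl c r r0; set v : V := delta_mx ord0 3.
have v0 : v != 0.
  by apply/eqP => /rowP/(_ 3); rewrite !mxE eqxx => /eqP; rewrite oner_eq0.
have vp : 0 < `|v| by rewrite normr_gt0.
have detL x : \det (jacobian a x) = 0.
  apply/eqP/negPn/negP => /det_mulmx_inj inj.
  suff /inj/eqP : v *m jacobian a x = 0 by rewrite (negPf v0).
  apply/eqP; rewrite -normr_eq0 eq_le normr_ge0 andbT; apply/ler_addgt0Pr => e e0.
  rewrite add0r.
  have e'0 : 0 < e / `|v| by rewrite divr_gt0.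
  have [d d0 dP] := C11_differentiable_with (fun j => ha j x) e'0.
  pose t := d / (2 * `|v|); have t0 : 0 < t by rewrite divr_gt0 // mulr_gt0.
  have tv : `|t *: v| = d / 2.
    by rewrite normrZ gtr0_norm // /t; field; rewrite gt_eqF.
  have := dP (x + t *: v); rewrite [x + _]addrC addrK tv => /(_ _).
  rewrite [_ + x]addrC cyl subrr sub0r normrN -scalemxAl normrZ gtr0_norm //.
  have -> : e / `|v| * (d / 2) = t * e by rewrite /t; field; rewrite gt_eqF.
  rewrite ler_pM2l //; apply; lra.
have cL : continuous L by move=> x; apply: (C11_continuous (a := a)) => j.
pose O (k : nat) : set V := ~` (L @` box k%:R).
have dense_O : dense (\bigcap_k O k).
  pose U : completeNormedModType R := HB.pack V.
  apply: (@Baire R U) => k; split.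
    apply: closed_openC; apply: compact_closed; first exact: norm_hausdorff.
    apply: continuous_compact; last exact: compact_box.
    exact: continuous_subspaceT.
  move=> Q [c' Qc'] oQ.
  have /nbhs_normP[s /= s0 sQ] : nbhs (c' : V) Q by exact: open_nbhs_nbhs.
  have [y yc yP] := sard c' (@compact_box R 4 k%:R) (fun x _ j => ha j x) s0.
  exists y; split; first by apply: sQ; rewrite /ball_ /= distrC.
  by move=> [x xk Lx]; have := yP x xk Lx; rewrite detL eqxx.
have ob : open [set y : V | `|y - c| < r].
  have -> : [set y : V | `|y - c| < r] = ball c r.
    by rewrite mx_norm_ball; apply/seteqP; split => y /=; rewrite /ball_ /= distrC.
  exact: ball_open.
have [|y [yr yO]] := dense_O [set y : V | `|y - c| < r] _ ob.
  by exists c; rewrite /= subrr normr0.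
exists y => // x Lx.
apply: (yO (Num.truncn `|x|).+1 I); exists x => //.
by rewrite /box /= ltW // truncnS_gt.
Qed.

Variables (F G : mixed_poly R) (p q p' q' : nat).
Hypothesis homF : forall l x0 x1 x2 : C,
  mp_eval F (l * x0) (l * x1) (l * x2) = mpow p q l * mp_eval F x0 x1 x2.
Hypothesis homG : forall l x0 x1 x2 : C,
  mp_eval G (l * x0) (l * x1) (l * x2) = mpow p' q' l * mp_eval G x0 x1 x2.
Hypothesis no_zero : forall x1 x2 : C, (x1, x2) != (0, 0) ->
  ~ (mp_eval F 0 x1 x2 = 0 /\ mp_eval G 0 x1 x2 = 0).

Local Notation f0 := (mp_eval F 0).
Local Notation g0 := (mp_eval G 0).

Lemma csmooth_mpow a b (z : V -> C) : on_parts (@smooth R) z ->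
  on_parts (@smooth R) (fun x => mpow a b (z x)).
Proof.
move=> hz; apply: (on_partsM (@smooth_cst R) (@smoothD R) (@smoothM R)).
  exact: (on_partsX (@smooth_cst R) (@smoothD R) (@smoothM R)).
apply: (on_partsX (@smooth_cst R) (@smoothD R) (@smoothM R)).
exact: (on_parts_conj (@smooth_cst R) (@smoothM R)).
Qed.

(* One of the half planes [Im > 0], [Im < 0] misses the ray spanned by [- c]. *)
Lemma half_plane_avoids (c : C) : exists2 s : R, `|s| = 1 &
  forall al : C, `|complex.Im al - s| < 1 -> complex.Im al != 0 /\
    forall t : R, 0 <= t -> al <> - t%:C * c.
Proof.
have [c0|c0] := leP 0 (complex.Im c); [exists 1|exists (-1)].
- by rewrite normr1.
- move=> al; rewrite ltr_norml => /andP[h1 h2]; split.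
    by apply: lt0r_neq0; lra.
  move=> t t0 /(congr1 (@complex.Im R)); rewrite Im_mul /= oppr0 mul0r addr0 => E.
  by have := mulr_ge0 t0 c0; move: h1; rewrite E; lra.
- by rewrite normrN1.
- move=> al; rewrite ltr_norml => /andP[h1 h2]; split.
    by rewrite lt_eqF //; lra.
  move=> t t0 /(congr1 (@complex.Im R)); rewrite Im_mul /= oppr0 mul0r addr0 => E.
  by have := mulr_ge0_le0 t0 (ltW c0); move: h2; rewrite E; lra.
Qed.

(* Scaling by [|w^p' (conj w)^q'|^2] turns the bad set into the image of a
   polynomial map that does not depend on the last coordinate. *)
Lemma generic_pair : exists al be : C, [/\ complex.Im al != 0, complex.Im be != 0,
  forall t : R, 0 <= t -> al <> - t%:C * f0 1 0,
  forall t : R, 0 <= t -> be <> - t%:C * g0 0 1 &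
  forall (w : C) (t : R), w != 0 -> al = - t%:C * f0 1 w ->
    be * mpow p' q' w = - t%:C * g0 1 w -> False].
Proof.
have [s1 s11 s1P] := half_plane_avoids (f0 1 0).
have [s2 s21 s2P] := half_plane_avoids (g0 0 1).
pose w (x : V) : C := z1_of x.
pose k (x : V) : C := mpow p' q' (w x).
pose s (x : V) : C := (x ord0 2)%:C.
pose A (x : V) : C := s x * k x * conjc (k x) * f0 1 (w x).
pose B (x : V) : C := s x * g0 1 (w x) * conjc (k x).
have hs : on_parts (@smooth R) s.
  by split; [eexists => x; exact: C11_coord|exact: smooth_cst].
have hk : on_parts (@smooth R) k by apply: csmooth_mpow; exact: csmooth_z1.
have hck := on_parts_conj (@smooth_cst R) (@smoothM R) hk.
have hf : on_parts (@smooth R) (fun x => f0 1 (w x)).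
  exact: (csmooth_mp_eval F (csmooth_cst 0) (csmooth_cst 1) (@csmooth_z1 R)).
have hg : on_parts (@smooth R) (fun x => g0 1 (w x)).
  exact: (csmooth_mp_eval G (csmooth_cst 0) (csmooth_cst 1) (@csmooth_z1 R)).
have PM := on_partsM (@smooth_cst R) (@smoothD R) (@smoothM R).
have hA : on_parts (@smooth R) A by exact: PM (PM _ _ (PM _ _ hs hk) hck) hf.
have hB : on_parts (@smooth R) B by exact: PM (PM _ _ hs hg) hck.
have [a ha] := C11_vec hA hB.
(* The centre [(i s1, i s2)] and the radius 1 are those of [half_plane_avoids]: they keep both
   coefficients off the real axis and off the two forbidden rays. *)
have [|y yc yP] := cylinder_image ha _ (vec (Complex 0 s1) (Complex 0 s2)) ltr01.
  move=> x t.
  have E i : i != 3 -> (x + t *: delta_mx ord0 3) ord0 i = x ord0 i.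
    by move=> i3; rewrite !mxE (negPf i3) andbF mulr0 addr0.
  by rewrite /A /B /s /k /w /z1_of !E.
have h1 : complex.Im (z1_of y) != 0 /\ forall t : R, 0 <= t -> z1_of y <> - t%:C * f0 1 0.
  apply: s1P; apply: le_lt_trans yc.
  by have := coord_le_norm (y - vec (Complex 0 s1) (Complex 0 s2)) 1; rewrite !mxE.
have h2 : complex.Im (z2_of y) != 0 /\ forall t : R, 0 <= t -> z2_of y <> - t%:C * g0 0 1.
  apply: s2P; apply: le_lt_trans yc.
  by have := coord_le_norm (y - vec (Complex 0 s1) (Complex 0 s2)) 3; rewrite !mxE.
case: h1 => h11 h12; case: h2 => h21 h22.
exists (z1_of y), (z2_of y); split => // u t u0 E1 E2.
pose kap := mpow p' q' u.
have kap0 : kap != 0 by apply/eqP => /mpow_eq0/eqP; rewrite (negPf u0).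
pose n2 := complex.Re kap ^+ 2 + complex.Im kap ^+ 2.
have n2E : kap * conjc kap = n2%:C.
  by rewrite /n2; case: (kap) => a1 b1; apply/eq_complexP; split => /=; ring.
have n20 : n2 != 0.
  apply/eqP => n2z; move/eqP: n2E; rewrite n2z mulf_eq0 conjc_eq0.
  by rewrite (negPf kap0).
(* The real parameter of the polynomial map: it absorbs the factor [kap * conjc kap], which replaces
   the division by [kap]. *)
pose t' := - t / n2.
have t'E : t'%:C * n2%:C = - t%:C.
  by rewrite -rmorphM /= /t' mulfVK // rmorphN.
pose x : V := vec u t'%:C.
apply: (yP x).
have xw : w x = u by rewrite /w vecK1.
have xs : s x = t'%:C by rewrite /s !mxE.
rewrite -[RHS]vecE; congr vec.
  by rewrite /A /k xw xs E1 -t'E -n2E /kap; ring.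
rewrite /B /k xw xs -[RHS](mulfK kap0) E2 -t'E -n2E -/kap.
by field.
Qed.

(** A zero of the segment reduces by homogeneity to [(0, 1)], [(1, 0)] or [(1, w)] with
    [w = z2 / z1], and each case is excluded by a clause of [generic_pair]. As [al] and [be] are not
    real, the segments from them to 1 avoid 0, which removes the coefficients. *)
Lemma deform_to_monomials (M : nat) d : (0 < M)%N ->
  has_degree M (fun x : V => vec (f0 (z1_of x) (z2_of x)) (g0 (z1_of x) (z2_of x))) d ->
  has_degree M (fun x : V => vec (mpow p q (z1_of x)) (mpow p' q' (z2_of x))) d.
Proof.
move=> M0 h0; have [al [be [al0 be0 al1 be1 albe]]] := generic_pair.
have PM := on_partsM (@smooth_cst R) (@smoothD R) (@smoothM R).
have hk1 : on_parts (@smooth R) (fun x : V => mpow p q (z1_of x)).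
  by apply: csmooth_mpow; exact: csmooth_z1.
have hk2 : on_parts (@smooth R) (fun x : V => mpow p' q' (z2_of x)).
  by apply: csmooth_mpow; exact: csmooth_z2.
have hf : on_parts (@smooth R) (fun x => f0 (z1_of x) (z2_of x)).
  exact: (csmooth_mp_eval F (csmooth_cst 0) (@csmooth_z1 R) (@csmooth_z2 R)).
have hg : on_parts (@smooth R) (fun x => g0 (z1_of x) (z2_of x)).
  exact: (csmooth_mp_eval G (csmooth_cst 0) (@csmooth_z1 R) (@csmooth_z2 R)).
have hak := PM _ _ (csmooth_cst al) hk1; have hbk := PM _ _ (csmooth_cst be) hk2.
have nzx (x : V) : `|x| = M%:R -> (z1_of x, z2_of x) != (0, 0).
  move=> xM; apply/negP => /eqP E; move: xM; rewrite -(vecE x).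
  rewrite (congr1 fst E : z1_of x = 0) (congr1 snd E : z2_of x = 0) vec0 normr0.
  by move=> /esym/eqP; rewrite pnatr_eq0; lia.
have hF0 l z1 z2 : f0 (l * z1) (l * z2) = mpow p q l * f0 z1 z2.
  by rewrite -homF mulr0.
have hG0 l z1 z2 : g0 (l * z1) (l * z2) = mpow p' q' l * g0 z1 z2.
  by rewrite -homG mulr0.
have h1 := vec_homotopy hf hg hak hbk _ h0.
have {h1} h1 : has_degree M (fun x : V => vec (al * mpow p q (z1_of x))
    (be * mpow p' q' (z2_of x))) d.
  apply: h1 => x t /nzx; set z1 := z1_of x; set z2 := z2_of x => nz /andP[t0 t1] E1 E2.
  have [tz|tn] := eqVneq t 0.
    move: E1 E2; rewrite tz subr0 !mul1r !mul0r !addr0 => E1 E2.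
    exact: no_zero nz (conj E1 E2).
  pose u := (1 - t) / t.
  have u0 : 0 <= u by rewrite divr_ge0 // subr_ge0.
  have tu : (1 - t)%:C = t%:C * u%:C.
    by rewrite -rmorphM /= /u mulrC divfK.
  have tC : t%:C != 0 by apply/negP => /eqP/eq_complexP[/= /eqP]; rewrite (negPf tn).
  have red (y k : C) : (1 - t)%:C * y + t%:C * k = 0 -> k = - u%:C * y.
    rewrite tu -mulrA -mulrDr => /eqP; rewrite mulf_eq0 (negPf tC) /=.
    by rewrite addrC addr_eq0 => /eqP->; rewrite mulNr.
  move/red: E1 => E1; move/red: E2 => E2.
  have [z10|z10] := eqVneq z1 0.
    have z20 : z2 != 0 by apply: contraNneq nz => ->; rewrite z10.
    apply: (be1 u u0); apply: (mulIf (_ : mpow p' q' z2 != 0)).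
      by apply/eqP => /mpow_eq0/eqP; rewrite (negPf z20).
    rewrite E2 z10 -[X in _ = - _ * _ * X]mul1r.
    have := hG0 z2 0 1; rewrite mulr0 mulr1 => ->; ring.
  have k10 : mpow p q z1 != 0 by apply/eqP => /mpow_eq0/eqP; rewrite (negPf z10).
  have k10' : mpow p' q' z1 != 0 by apply/eqP => /mpow_eq0/eqP; rewrite (negPf z10).
  have [z20|z20] := eqVneq z2 0.
    apply: (al1 u u0); apply: (mulIf k10); rewrite E1 z20.
    have := hF0 z1 1 0; rewrite mulr0 mulr1 => ->; ring.
  apply: (albe (z2 / z1) u).
  - by rewrite mulf_neq0 // invr_eq0.
  - apply: (mulIf k10); rewrite E1.
    have := hF0 z1 1 (z2 / z1); rewrite mulr1 mulrCA divff // mulr1 => ->; ring.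
  - apply: (mulIf k10'); rewrite -mulrA -mpowM divfK // E2.
    have := hG0 z1 1 (z2 / z1); rewrite mulr1 mulrCA divff // mulr1 => ->; ring.
apply: (vec_homotopy hak hbk hk1 hk2 _ h1) => x t /nzx nz /andP[t0 t1].
have nz1 (c : C) : complex.Im c != 0 -> (1 - t)%:C * c + t%:C != 0.
  move=> c0; apply/eqP => /eq_complexP[]; rewrite Re_add Im_add Re_mul Im_mul /=.
  rewrite !mul0r subr0 !addr0 => Er /eqP; rewrite mulf_eq0 (negPf c0) orbF => /eqP t1'.
  by move: Er; rewrite t1' mul0r add0r; lra.
move=> E1 E2; case/eqP: nz.
have -> : z1_of x = 0.
  apply: (@mpow_eq0 _ p q); apply/eqP; move/eqP: E1; rewrite mulrA -mulrDl mulf_eq0.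
  by rewrite (negPf (nz1 _ al0)).
have -> // : z2_of x = 0.
apply: (@mpow_eq0 _ p' q'); apply/eqP; move/eqP: E2; rewrite mulrA -mulrDl mulf_eq0.
by rewrite (negPf (nz1 _ be0)).
Qed.

End Generic.

Section Determinants.
Variable R : comRingType.

Lemma det_mx22 (A : 'M[R]_2) : \det A = A 0 0 * A 1 1 - A 0 1 * A 1 0.
Proof.
rewrite (expand_det_row _ ord0) !big_ord_recl big_ord0 /cofactor !det_mx11 !mxE.
rewrite /= addr0 expr0 mul1r expr1 mulN1r mulrN.
by congr (_ * _ - _ * _); congr (A _ _); apply/val_inj.
Qed.

Lemma det_block4 (A : 'M[R]_4) :
  A 0 2 = 0 -> A 0 3 = 0 -> A 1 2 = 0 -> A 1 3 = 0 ->
  \det A = (A 0 0 * A 1 1 - A 0 1 * A 1 0) * (A 2 2 * A 3 3 - A 2 3 * A 3 2).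
Proof.
move=> h1 h2 h3 h4.
pose B : 'M[R]_(2 + 2) := A.
rewrite -[\det A]/(\det B) -[B]submxK.
have -> : ursubmx B = 0.
  apply/matrixP => i j; rewrite !mxE.
  case: i => -[|[|//]] ii; case: j => -[|[|//]] jj; rewrite /B.
  - by rewrite -h1; congr (A _ _); apply/val_inj.
  - by rewrite -h2; congr (A _ _); apply/val_inj.
  - by rewrite -h3; congr (A _ _); apply/val_inj.
  - by rewrite -h4; congr (A _ _); apply/val_inj.
rewrite det_lblock !det_mx22 !mxE /B.
by congr ((_ * _ - _ * _) * (_ * _ - _ * _)); congr (A _ _); apply/val_inj.
Qed.

End Determinants.

(** * The degree of a pair of mixed monomials *)

Section MonomialDegree.
Variable R : realType.
Local Notation C := (R[i]).
Local Notation V := 'rV[R]_4.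
Local Notation Re := (@complex.Re R).
Local Notation Im := (@complex.Im R).

Definition sqnorm (z : C) : R := Re z ^+ 2 + Im z ^+ 2.

Lemma sqnorm_ge0 z : 0 <= sqnorm z.
Proof. by rewrite addr_ge0 // sqr_ge0. Qed.

Lemma sqnormM z w : sqnorm (z * w) = sqnorm z * sqnorm w.
Proof. by rewrite /sqnorm Re_mul Im_mul; ring. Qed.

Lemma sqnormX z k : sqnorm (z ^+ k) = sqnorm z ^+ k.
Proof.
elim: k => [|k IH]; first by rewrite !expr0 /sqnorm /= expr0n addr0 expr1n.
by rewrite !exprS sqnormM IH.
Qed.

Lemma sqnorm_real (x : R) : sqnorm x%:C = x ^+ 2.
Proof. by rewrite /sqnorm /= expr0n addr0. Qed.

Lemma sqnorm_eq0 z : sqnorm z = 0 -> z = 0.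
Proof.
move=> /eqP; rewrite paddr_eq0 ?sqr_ge0 // !sqrf_eq0 => /andP[/eqP h1 /eqP h2].
by apply/eq_complexP.
Qed.

Lemma sqnorm_gt0 z : z != 0 -> 0 < sqnorm z.
Proof.
move=> z0; rewrite lt_neqAle sqnorm_ge0 andbT eq_sym.
by apply: contraNneq z0 => /sqnorm_eq0 ->.
Qed.

Lemma mul_conj z : z * conjc z = (sqnorm z)%:C.
Proof. by rewrite /sqnorm; case: z => a b; apply/eq_complexP; split => /=; ring. Qed.

Definition flip (b : bool) (z : C) : C := if b then z else conjc z.

Lemma flipK b : involutive (flip b).
Proof. by case: b => z //=; rewrite conjcK. Qed.

Lemma sqnorm_flip b z : sqnorm (flip b z) = sqnorm z.
Proof. by case: b z => -[x y] //; rewrite /sqnorm /= sqrrN. Qed.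

Definition signed (b : bool) (e : nat) : int := if b then e%:Z else - e%:Z.

(** All [k = min(p, q)] pairs of [z] with its conjugate are pulled out as a power of the squared
    modulus; [b] records which of the two is left. *)
Lemma mpow_flip p q : exists k b e, signed b e = p%:Z - q%:Z /\
  forall z : C, mpow p q z = (sqnorm z ^+ k)%:C * flip b z ^+ e.
Proof.
have [qp|pq] := leqP q p.
  exists q, true, (p - q)%N; split=> [|z]; first by rewrite /signed subzn.
  by rewrite rmorphXn /= -mul_conj exprMn /mpow -{1}(subnKC qp) exprD; ring.
exists p, false, (q - p)%N; split=> [|z].
  by rewrite /signed -(subzn (ltnW pq)) opprB.
rewrite rmorphXn /= -mul_conj exprMn /mpow -{1}(subnKC (ltnW pq)) exprD; ring.
Qed.

Lemma unity_roots e : (0 < e)%N -> exists us : seq C,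
  [/\ uniq us, size us = e & forall u, u ^+ e = 1 <-> u \in us].
Proof.
move=> e0; have [us usP] := closed_field_poly_normal ('X^e - 1 : {poly C}).
have mon : 'X^e - 1 \is @monic C by rewrite monicXnsubC.
rewrite (monicP mon) scale1r in usP.
exists us; split.
- rewrite -separable_prod_XsubC -usP separable_Xn_sub_1 //.
  by rewrite pnatr_eq0; lia.
- have := congr1 (fun r : {poly C} => size r) usP.
  by rewrite size_prod_XsubC size_XnsubC // => -[].
move=> u; rewrite -root_prod_XsubC -usP rootE !hornerE subr_eq0.
by split=> [->|/eqP]; rewrite ?eqxx.
Qed.

Definition dpow (e : nat) (z : C) : C := e%:R * z ^+ e.-1.

Lemma dpowS e z : dpow e.+1 z = z ^+ e + z * dpow e z.
Proof.
rewrite /dpow /= -natr1; case: e => [|e]; first by rewrite mul0r mulr0 add0r addr0 mul1r.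
by rewrite /= exprS; ring.
Qed.

(** The Cauchy-Riemann form of the derivative of a power, when the real and imaginary parts of [z]
    have constant gradients [u] and [v]. *)
Lemma C11_power (z : V -> C) (u v : V) e x :
  C11 (fun y => Re (z y)) (fun=> u) x -> C11 (fun y => Im (z y)) (fun=> v) x ->
  C11 (fun y => Re (z y ^+ e)) (fun y => Re (dpow e (z y)) *: u - Im (dpow e (z y)) *: v) x /\
  C11 (fun y => Im (z y ^+ e)) (fun y => Im (dpow e (z y)) *: u + Re (dpow e (z y)) *: v) x.
Proof.
move=> hu hv; elim: e => [|e [IH1 IH2]].
  have d0 w : dpow 0 w = 0 by rewrite /dpow mul0r.
  split.
    by apply: eq_C11 (C11_cst 1 x) => y; rewrite ?d0 ?expr0 // !scale0r subrr.
  by apply: eq_C11 (C11_cst 0 x) => y; rewrite ?d0 ?expr0 // !scale0r addr0.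
split.
  have := C11D (C11M hu IH1) (C11M (C11_cst (-1) x) (C11M hv IH2)).
  apply: eq_C11 => y; first by rewrite exprS Re_mul; ring.
  by apply/rowP => i; rewrite !mxE dpowS Re_add Im_add Re_mul Im_mul; ring.
have := C11D (C11M hu IH2) (C11M hv IH1).
apply: eq_C11 => y; first by rewrite exprS Im_mul; ring.
by apply/rowP => i; rewrite !mxE dpowS Re_add Im_add Re_mul Im_mul; ring.
Qed.

Definition usign (b : bool) : R := if b then 1 else -1.

Lemma C11_flip b (z : V -> C) (u v : V) x :
  C11 (fun y => Re (z y)) (fun=> u) x -> C11 (fun y => Im (z y)) (fun=> v) x ->
  C11 (fun y => Re (flip b (z y))) (fun=> u) x /\
  C11 (fun y => Im (flip b (z y))) (fun=> usign b *: v) x.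
Proof.
move=> hu hv; case: b; split => //=.
- by apply: eq_C11 hv => y //; rewrite /usign scale1r.
- by apply: eq_C11 hu => y //; case: (z y).
have := C11M (C11_cst (-1) x) hv; apply: eq_C11 => y; first by case: (z y) => c d /=; ring.
by rewrite scaler0 addr0.
Qed.

Lemma C11_subc f a c x : @C11 R 4 f a x -> C11 (fun y => f y - c) a x.
Proof.
by move=> hf; apply: eq_C11 (C11D hf (C11_cst (- c) x)) => y //; rewrite addr0.
Qed.

(** The zeros are the [e1 * e2] pairs of roots of unity, conjugated where required. A holomorphic
    factor has as real determinant the squared modulus of its derivative, and each conjugation
    changes the sign. Since [M > 1], all roots are interior to the cube. *)
Lemma flip_power_degree (M : nat) b1 b2 e1 e2 :
  (1 < M)%N -> (0 < e1)%N -> (0 < e2)%N ->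
  has_degree M (fun x : V => vec (flip b1 (z1_of x) ^+ e1 - 1) (flip b2 (z2_of x) ^+ e2 - 1))
    (signed b1 e1 * signed b2 e2).
Proof.
move=> M1 e10 e20.
have [us [uus sus usP]] := unity_roots e10.
have [ws [uws sws wsP]] := unity_roots e20.
pose ps := [seq vec (flip b1 u) (flip b2 w) | u <- us, w <- ws].
pose f (x : V) : C := flip b1 (z1_of x) ^+ e1.
pose g (x : V) : C := flip b2 (z2_of x) ^+ e2.
pose L (x : V) : V := vec (f x - 1) (g x - 1).
pose D1 (y : V) := dpow e1 (flip b1 (z1_of y)).
pose D2 (y : V) := dpow e2 (flip b2 (z2_of y)).
pose a (j : 'I_4) (y : V) : V :=
  if j == 0 :> nat then Re (D1 y) *: delta_mx ord0 0 - Im (D1 y) *: (usign b1 *: delta_mx ord0 1)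
  else if j == 1 :> nat then
    Im (D1 y) *: delta_mx ord0 0 + Re (D1 y) *: (usign b1 *: delta_mx ord0 1)
  else if j == 2 :> nat then
    Re (D2 y) *: delta_mx ord0 2 - Im (D2 y) *: (usign b2 *: delta_mx ord0 3)
  else Im (D2 y) *: delta_mx ord0 2 + Re (D2 y) *: (usign b2 *: delta_mx ord0 3).
have ha j x : C11 (fun y => L y ord0 j) (a j) x.
  have [h1 h2] := @C11_flip b1 (@z1_of R) _ _ x (C11_coord 0 x) (C11_coord 1 x).
  have [h3 h4] := @C11_flip b2 (@z2_of R) _ _ x (C11_coord 2 x) (C11_coord 3 x).
  have [k1 k2] := C11_power e1 h1 h2; have [k3 k4] := C11_power e2 h3 h4.
  rewrite /L (_ : (fun y => _) = (fun y => if j == 0 :> nat then Re (f y) - 1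
    else if j == 1 :> nat then Im (f y) - 0
    else if j == 2 :> nat then Re (g y) - 1 else Im (g y) - 0)); last first.
    apply/funext => y; rewrite mxE !Re_add !Im_add.
    by rewrite /= oppr0.
  rewrite /a; case: (nat_of_ord j == 0%N); first exact: C11_subc k1.
  case: (nat_of_ord j == 1%N); first exact: C11_subc k2.
  by case: (nat_of_ord j == 2%N); [exact: C11_subc k3|exact: C11_subc k4].
have cL : continuous L by move=> x; apply: (C11_continuous (a := a)) => j.
have detL x : \det (jacobian a x) = usign b1 * usign b2 * (sqnorm (D1 x) * sqnorm (D2 x)).
  rewrite det_block4; try by rewrite !mxE /= ?mulr0 ?addr0 ?subr0 ?oppr0.
  by rewrite !mxE /= /sqnorm; ring.
have psP x : x \in ps <-> f x = 1 /\ g x = 1.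
  split=> [/allpairsP[[u w] /= [uu ww ->]]|[fx gx]].
    by rewrite /f /g vecK1 vecK2 !flipK; split; [exact/usP|exact/wsP].
  apply/allpairsP; exists (flip b1 (z1_of x), flip b2 (z2_of x)) => /=.
  by rewrite !flipK vecE; split => //; [exact/usP|exact/wsP].
have sq1 (z : C) e : (0 < e)%N -> z ^+ e = 1 -> sqnorm z = 1.
  move=> e0 /(congr1 sqnorm); rewrite sqnormX [sqnorm 1](sqnorm_real 1) expr1n => /eqP.
  by rewrite pexpr_eq1 ?sqnorm_ge0 // => /eqP.
have -> : signed b1 e1 * signed b2 e2 = \sum_(x <- ps) sgz (\det (jacobian a x)).
  rewrite (eq_big_seq (fun=> signed b1 1 * signed b2 1)); last first.
    move=> x /psP[fx gx]; rewrite detL !sgzM.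
    have dpos (e : nat) z : (0 < e)%N -> z ^+ e = 1 -> sgz (sqnorm (dpow e z)) = 1.
      move=> e0 ze; rewrite gtr0_sgz //; apply: sqnorm_gt0.
      rewrite /dpow mulf_neq0 ?pnatr_eq0 -?lt0n // expf_neq0 //.
      apply/eqP => z0; move: ze; rewrite z0 expr0n; case: e e0 => // e _ /eqP.
      by rewrite eq_sym oner_eq0.
    rewrite !dpos // !mulr1.
    by case: (b1); case: (b2); rewrite /usign /signed ?sgz1 ?sgzN1.
  rewrite big_const_seq count_predT iter_addr_0 size_allpairs sus sws.
  by rewrite /signed; case: (b1); case: (b2); rewrite ?mulrN ?mulNr ?opprK -mulr_natr; lia.
apply: has_degree_regular => //.
- exact: ltnW.
- apply: allpairs_uniq => // -[u w] [u' w'] _ _ /= E.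
  have E1 := congr1 (@z1_of R) E; have E2 := congr1 (@z2_of R) E.
  move: E1 E2; rewrite !vecK1 !vecK2 => E1 E2.
  by rewrite -[u](flipK b1) -[w](flipK b2) E1 E2 !flipK.
- move=> x _ /vec_eq0[/eqP h1 /eqP h2]; apply/psP.
  by move: h1 h2; rewrite !subr_eq0 => /eqP h1 /eqP h2.
move=> x /psP[fx gx].
have n1 : sqnorm (z1_of x) = 1 by rewrite -(sqnorm_flip b1); exact: sq1 fx.
have n2 : sqnorm (z2_of x) = 1 by rewrite -(sqnorm_flip b2); exact: sq1 gx.
split.
- have le1 (s t : R) : s ^+ 2 + t ^+ 2 = 1 -> `|s| <= 1 /\ `|t| <= 1.
    by move=> st; rewrite !ler_norml; split; apply/andP; split; nra.
  have [a1 a2] := le1 _ _ n1; have [a3 a4] := le1 _ _ n2.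
  apply: (@le_lt_trans _ _ 1); last by rewrite ltr1n.
  apply/mx_norm_leP => // i; rewrite -(vecE x) mxE.
  by do 3?case: ifP.
- by rewrite -/(L x) /L fx gx !subrr vec0.
- rewrite detL.
  have u0 b : usign b != 0 by case: b; rewrite /usign ?oppr_eq0 oner_eq0.
  have dpos (e : nat) z : (0 < e)%N -> z ^+ e = 1 -> sqnorm (dpow e z) != 0.
    move=> e0 ze; apply: lt0r_neq0; apply: sqnorm_gt0.
    rewrite /dpow mulf_neq0 ?pnatr_eq0 -?lt0n // expf_neq0 //.
    apply/eqP => z0; move: ze; rewrite z0 expr0n; case: e e0 => // e _ /eqP.
    by rewrite eq_sym oner_eq0.
  by rewrite !mulf_neq0 ?u0 ?dpos.
- exact: (C11_differentiable_with (fun j => ha j x)).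
Qed.

Lemma nonvanishing_degree (M : nat) (f : V -> V) : continuous f ->
  (forall x, `|x| <= M%:R -> f x <> 0) -> has_degree M f 0.
Proof.
move=> cf nz; have := @has_degree_sum R 3 M f [::] (fun _ _ => 0) (fun=> 0).
by rewrite big_nil; apply => // x xM /(nz x xM).
Qed.

Lemma has_degree_unique (M : nat) (f : V -> V) d d' :
  has_degree M f d -> has_degree M f d' -> d = d'.
Proof.
move=> h h'; have [N _ /(_ N (leqnn N)) [<- <-]//] :
  \forall N \near \oo, grid_degree M N f = d /\ grid_degree M N f = d'.
by near=> N; split; near: N.
Unshelve. all: by end_near. Qed.

(** If an exponent is 0, its component is a power of the squared modulus; it can be deformed to the
    constant 1, so the degree is 0. Otherwise both components are deformed to a power minus 1. *)
Lemma monomial_degree (M : nat) p q p' q' d : (1 < M)%N ->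
  has_degree M (fun x : V => vec (mpow p q (z1_of x)) (mpow p' q' (z2_of x))) d ->
  d = (p%:Z - q%:Z) * (p'%:Z - q'%:Z).
Proof.
move=> M1 hd.
have [k [b [e [<- kE]]]] := mpow_flip p q.
have [k' [b' [e' [<- k'E]]]] := mpow_flip p' q'.
have hk1 : on_parts (@smooth R) (fun x : V => mpow p q (z1_of x)).
  by apply: csmooth_mpow; exact: csmooth_z1.
have hk2 : on_parts (@smooth R) (fun x : V => mpow p' q' (z2_of x)).
  by apply: csmooth_mpow; exact: csmooth_z2.
have nzx (x : V) : `|x| = M%:R -> (z1_of x, z2_of x) != (0, 0).
  move=> xM; apply/negP => /eqP E; move: xM; rewrite -(vecE x).
  rewrite (congr1 fst E : z1_of x = 0) (congr1 snd E : z2_of x = 0) vec0 normr0.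
  by move=> /esym/eqP; rewrite pnatr_eq0; lia.
have pos0 (n : nat) (z : C) (t : R) : 0 <= t <= 1 ->
    (1 - t)%:C * (sqnorm z ^+ n)%:C + t%:C * 1 = 0 -> z = 0.
  move=> /andP[t0 t1]; rewrite mulr1 -rmorphM -rmorphD /= => /complexI E.
  have s0 : 0 <= sqnorm z ^+ n by rewrite exprn_ge0 // sqnorm_ge0.
  have tz : t = 0 by nra.
  move: E; rewrite tz subr0 mul1r addr0 => /eqP; rewrite expf_eq0 => /andP[_ /eqP].
  exact: sqnorm_eq0.
have one0 : (1 : C) <> 0 by apply/eqP; rewrite oner_eq0.
have [e0|e0] := posnP e.
  have -> : signed b e = 0 by rewrite e0 /signed oppr0; case: (b).
  rewrite mul0r; apply: (@has_degree_unique M (fun x => vec 1 (mpow p' q' (z2_of x)))).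
    apply: (vec_homotopy hk1 hk2 (csmooth_cst 1) hk2 _ hd) => x t /nzx nz t01.
    rewrite kE e0 expr0 mulr1 => /(pos0 _ _ _ t01) z10.
    rewrite -mulrDl -rmorphD /= subrK mul1r => /mpow_eq0 z20.
    by case/eqP: nz; rewrite z10 z20.
  apply: nonvanishing_degree; first exact: (continuous_vec (csmooth_cst 1) hk2).
  by move=> x _ /vec_eq0[].
have [e'0|e'0] := posnP e'.
  have -> : signed b' e' = 0 by rewrite e'0 /signed oppr0; case: (b').
  rewrite mulr0; apply: (@has_degree_unique M (fun x => vec (mpow p q (z1_of x)) 1)).
    apply: (vec_homotopy hk1 hk2 hk1 (csmooth_cst 1) _ hd) => x t /nzx nz t01.
    rewrite -mulrDl -rmorphD /= subrK mul1r => /mpow_eq0 z10.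
    rewrite k'E e'0 expr0 mulr1 => /(pos0 _ _ _ t01) z20.
    by case/eqP: nz; rewrite z10 z20.
  apply: nonvanishing_degree; first exact: (continuous_vec hk1 (csmooth_cst 1)).
  by move=> x _ /vec_eq0[].
have hfl (c : bool) n (z : V -> C) : on_parts (@smooth R) z ->
    on_parts (@smooth R) (fun x => flip c (z x) ^+ n - 1).
  move=> hz; apply: (on_partsD (@smoothD R)); last exact: csmooth_cst.
  apply: (on_partsX (@smooth_cst R) (@smoothD R) (@smoothM R)).
  by case: c => //; exact: (on_parts_conj (@smooth_cst R) (@smoothM R)).
apply: has_degree_unique (flip_power_degree b b' M1 e0 e'0).
apply: (vec_homotopy hk1 hk2 (hfl b e _ (@csmooth_z1 R)) (hfl b' e' _ (@csmooth_z2 R)) _ hd).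
move=> x t xM t01.
(* A zero would give [((1 - t) |z|^(2n) + t) * flip c z ^+ m = t]. When [|z| > 1] the real factor is
   at least 1 and the power has modulus above 1, while [t] is at most 1. On the boundary of the cube
   at least one of the two variables satisfies this. *)
have big n (c : bool) m (z : C) : (0 < m)%N -> 1 < sqnorm z ->
    (1 - t)%:C * ((sqnorm z ^+ n)%:C * flip c z ^+ m) + t%:C * (flip c z ^+ m - 1) = 0 ->
    False.
  move=> m0 z1 E; have [t0 t1] := andP t01.
  have {}E : ((1 - t) * sqnorm z ^+ n + t)%:C * flip c z ^+ m = t%:C.
    apply/eqP; rewrite -subr_eq0 -E rmorphD rmorphM /=; apply/eqP; ring.
  move: E => /(congr1 sqnorm); rewrite sqnormM sqnormX sqnorm_flip !sqnorm_real.
  have s1 : 1 <= sqnorm z ^+ n by rewrite exprn_ege1 // ltW.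
  have s2 : 1 < sqnorm z ^+ m by rewrite exprn_egt1 // -lt0n.
  have s3 : 1 <= (1 - t) * sqnorm z ^+ n + t by nra.
  move: s2 s3; set u := (1 - t) * _ + t; set v := sqnorm z ^+ m => s2 s3 E.
  have v1 : v <= u ^+ 2 * v.
    by rewrite ler_peMl ?exprn_ege1 //; apply: ltW; exact: lt_trans s2.
  have t2 : t ^+ 2 <= 1 by rewrite exprn_ile1.
  by move: v1; rewrite E; lra.
have [i xi] : exists i, `|x ord0 i| = M%:R.
  have /mx_norm_neq0[[i j] /= xij] : `|x| != 0 by rewrite xM pnatr_eq0; lia.
  by exists j; rewrite -xM [RHS]xij (ord1 i).
have M2 : 1 < M%:R ^+ 2 :> R by rewrite exprn_egt1 // ltr1n.
have x2 : x ord0 i ^+ 2 = M%:R ^+ 2 by rewrite -real_normK ?num_real // xi.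
have [z1|z2] : 1 < sqnorm (z1_of x) \/ 1 < sqnorm (z2_of x).
- rewrite /sqnorm /=; move: x2; case: i {xi} => -[|[|[|[|//]]]] ii.
  + rewrite (_ : Ordinal ii = 0); last exact/val_inj.
    by move=> E; left; rewrite E ltr_wpDr ?sqr_ge0.
  + rewrite (_ : Ordinal ii = 1); last exact/val_inj.
    by move=> E; left; rewrite E ltr_wpDl ?sqr_ge0.
  + rewrite (_ : Ordinal ii = 2); last exact/val_inj.
    by move=> E; right; rewrite E ltr_wpDr ?sqr_ge0.
  + rewrite (_ : Ordinal ii = 3); last exact/val_inj.
    by move=> E; right; rewrite E ltr_wpDl ?sqr_ge0.
- by rewrite kE => /(big _ _ _ _ e0 z1).
- by rewrite k'E => _ /(big _ _ _ _ e'0 z2).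
Qed.

End MonomialDegree.

(** * Sum of the local numbers and conclusion *)

Lemma sum_of_local_degrees (R : realType) (phi : 'rV[R]_4 -> 'rV[R]_4)
    (a : 'I_4 -> 'rV[R]_4 -> 'rV[R]_4) (Ps : seq 'rV[R]_4) (eps : 'rV[R]_4 -> R)
    (n : 'rV[R]_4 -> int) (M : nat) :
  (forall j x, C11 (fun y => phi y ord0 j) (a j) x) -> uniq Ps ->
  (forall x, phi x = 0 -> x \in Ps) ->
  (forall P, P \in Ps -> [/\ 0 < eps P,
     forall v, enorm (v - P) <= eps P -> phi v = 0 -> v = P,
     sphere_map_degree (fun v => (enorm (phi v))^-1 *: phi v) P (eps P) (n P) &
     `|P| + eps P < M%:R]) ->
  has_degree M phi (\sum_(P <- Ps) n P).
Proof.
move=> ha uPs PsP epsP.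
have cphi : continuous phi by move=> x; exact: (C11_continuous (a := a)).
apply: (@has_degree_sum _ _ _ _ _
    (fun P x => phi (retraction (@enorm R) P (eps P) x))) => //.
  by move=> x _ /PsP.
move=> P PP; have [e0 hz hdeg PM] := epsP P PP.
have mx0 x : 0 < Num.max (eps P) (enorm (x - P)) by rewrite lt_max e0.
have lam0 x : 0 < eps P / Num.max (eps P) (enorm (x - P)) by rewrite divr_gt0.
split.
- have cr := @continuous_retraction R 4 (@enorm R) P (eps P) e0 (@continuous_enorm R).
  by move=> x; exact: (cts_comp (cr x) (@cphi _)).
- move=> x _ /hz; rewrite /retraction addrAC subrr add0r enormZ gtr0_norm //.
  rewrite mulrAC ler_pdivrMr // ler_pM2l // le_max lexx orbT => /(_ isT) /eqP.
  by rewrite addrC -subr_eq0 addrK scaler_eq0 gt_eqF //= subr_eq0 => /eqP.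
- exists (eps P / 2) => [|x xr]; first by rewrite divr_gt0.
  congr phi; rewrite /retraction max_l.
    by rewrite divff ?gt_eqF // scale1r addrC subrK.
  apply: le_trans (enorm_le_norm _) _; rewrite mulrC -ler_pdivlMr //.
  exact: ltW.
- exact: (local_degree (a := a)).
Qed.

Theorem theorem6 (R : realType) (F G : mixed_poly R) (dr dr' : nat) (d d' : int)
  (Ps : seq 'rV[R]_4) (n : 'rV[R]_4 -> int) :
  strongly_polar_homogeneous F dr d ->
  strongly_polar_homogeneous G dr' d' ->
  isolated_mixed_singularities F ->
  isolated_mixed_singularities G ->
  (* C /\ C' /\ {X0 = 0} is empty *)
  (forall x1 x2 : R[i], (x1, x2) != (0, 0) ->
     ~ (mp_eval F 0 x1 x2 = 0 /\ mp_eval G 0 x1 x2 = 0)) ->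
  (* C /\ C' = {P_1, ..., P_mu} (all in the chart X0 <> 0) *)
  uniq Ps ->
  (forall v, phi_map F G v = 0 <-> v \in Ps) ->
  (forall p, p \in Ps -> Itop F G p (n p)) ->
  \sum_(p <- Ps) n p = d * d'.
Proof.
move=> hF hG _ _ no_zero uPs PsP hI.
have [p [q [<- homF]]] := polar_homogeneity hF.
have [p' [q' [<- homG]]] := polar_homogeneity hG.
pose f (x : 'rV[R]_4) := mp_eval F 1 (z1_of x) (z2_of x).
pose g (x : 'rV[R]_4) := mp_eval G 1 (z1_of x) (z2_of x).
have csf : on_parts (@smooth R) f.
  exact: (csmooth_mp_eval F (csmooth_cst 1) (@csmooth_z1 R) (@csmooth_z2 R)).
have csg : on_parts (@smooth R) g.
  exact: (csmooth_mp_eval G (csmooth_cst 1) (@csmooth_z1 R) (@csmooth_z2 R)).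
have phiE : phi_map F G = fun x => vec (f x) (g x) by [].
have [a ha] := C11_vec csf csg.
have cphi : continuous (phi_map F G) by rewrite phiE; exact: continuous_vec.
have /choice[eps epsP] : forall P : 'rV[R]_4, exists e : R, P \in Ps -> [/\ 0 < e,
    forall v, enorm (v - P) <= e -> phi_map F G v = 0 -> v = P &
    sphere_map_degree (fun v => (enorm (phi_map F G v))^-1 *: phi_map F G v) P e (n P)].
  move=> P; have [PP|] := boolP (P \in Ps); last by exists 1.
  by have [e e0 [h1 h2]] := hI P PP; exists e.
have hbig : \forall N \near \oo, forall P, P \in Ps -> `|P| + eps P < N.+1%:R.
  apply: (@near_seq _ _ (fun P N => `|P| + eps P < N.+1%:R)) => P _.
  near=> N; apply: (@le_lt_trans _ _ N%:R); last by rewrite ltr_nat.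
  by near: N; exact: nbhs_infty_ger.
have hinf := homotopy_at_infinity homF homG no_zero.
(* One cube of half-side [N.+1] must contain the balls about all the intersection points, lie in the
   range of the homotopy at infinity, and have the roots of unity in its interior, whence
   [0 < N]. *)
have [N [N1 NP Ninf]] : exists N : nat, [/\ (0 < N)%N,
    forall P, P \in Ps -> `|P| + eps P < N.+1%:R &
    forall (x : 'rV[R]_4) (t : R), `|x| = N.+1%:R -> 0 <= t <= 1 ->
      (1 - t)%:C * f x + t%:C * mp_eval F 0 (z1_of x) (z2_of x) = 0 ->
      (1 - t)%:C * g x + t%:C * mp_eval G 0 (z1_of x) (z2_of x) = 0 -> False].
  have : \forall N \near \oo, [/\ (0 < N)%N,
    forall P, P \in Ps -> `|P| + eps P < N.+1%:R &
    forall (x : 'rV[R]_4) (t : R), `|x| = N.+1%:R -> 0 <= t <= 1 ->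
      (1 - t)%:C * f x + t%:C * mp_eval F 0 (z1_of x) (z2_of x) = 0 ->
      (1 - t)%:C * g x + t%:C * mp_eval G 0 (z1_of x) (z2_of x) = 0 -> False].
    near=> N; split; [by near: N; exact: nbhs_infty_gt| |].
      by near: N; exact: hbig.
    by near: N; exact: hinf.
  by move=> [N _ /(_ N (leqnn N)) h]; exists N.
have h1 : has_degree N.+1 (phi_map F G) (\sum_(P <- Ps) n P).
  apply: (sum_of_local_degrees (a := a) (eps := eps)) => //; first by move=> x /PsP.
  by move=> P PP; have [e0 hz hdeg] := epsP P PP; split => //; exact: NP.
have h2 := vec_homotopy csf csg
  (csmooth_mp_eval F (csmooth_cst 0) (@csmooth_z1 R) (@csmooth_z2 R))
  (csmooth_mp_eval G (csmooth_cst 0) (@csmooth_z1 R) (@csmooth_z2 R)) Ninf h1.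
have h3 := deform_to_monomials homF homG no_zero (ltn0Sn N) h2.
by apply: monomial_degree h3; rewrite ltnS.
Unshelve. all: by end_near. Qed.
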